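(* Let $m\ge2$ be odd, let $i\in\{1,\dots,(m-1)/2\}$ with $(i,m)=1$, and let $\lambda=e^{2\pi\sqrt{-1}/m}$. Let $H=\mathcal{A}_{4m}$ act (inner-faithfully) by $\pi_i^{-1}(u,v)$ on $A=A^-=\Bbbk\langle u,v\rangle/(u^2-\lambda^iv^2)$. Then $$A^H=\Bbbk[u^2,\,(uv)^m+(vu)^m],$$ a commutative polynomial ring on the two displayed (algebraically independent) generators. Hence $\mathcal{A}_{4m}$ is a reflection Hopf algebra for this action on $A^-$.
   Context: Ground field $\Bbbk=\mathbb{C}$. A connected graded algebra $A$ is AS regular of dimension $d$ if it has finite global dimension $d$, finite Gelfand–Kirillov dimension, and $\mathrm{Ext}^k_A(\Bbbk,A)=\delta_{k,d}\cdot\Bbbk(l)$ for some $l\in\mathbb{Z}$. An action of $H$ on an $H$-module algebra $A$ is inner-faithful if the only Hopf ideal $I$ of $H$ with $I\cdot A=0$ is $0$. $A^H=\{a\in A: h\cdot a=\epsilon(h)a\ \forall h\in H\}$. A semisimple Hopf algebra $H$ acting inner-faithfully and preserving the grading on an AS regular $H$-module algebra $A$ is a reflection Hopf algebra for $A$ if $A^H$ is AS regular. ''$H$ acts by $V$ on $A$'' means that $A$ is generated in degree 1, $A_1=V$ as an $H$-module, and the action is extended to $A$ by $h\cdot(ab)=\sum(h_{(1)}\cdot a)(h_{(2)}\cdot b)$. $\mathcal{A}_{4m}$ (Masuoka), $m\ge2$: generated by $a,s_+,s_-$ with $a$ central and grouplike, $a^2=1$, $s_\pm^2=1$, $(s_+s_-)^m=1$.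 With $e_0=(1+a)/2$, $e_1=(1-a)/2$: $\Delta(s_\pm)=s_\pm\otimes e_0s_\pm+s_\mp\otimes e_1s_\pm$, $\epsilon(s_\pm)=1$, $S(s_\pm)=e_0s_\pm+e_1s_\mp$. $\pi_i^{-1}(u,v)$ is the two-dimensional module with ordered basis $u,v$ and $s_+u=v$, $s_+v=u$, $s_-u=\lambda^iv$, $s_-v=\lambda^{-i}u$, $a$ acting by $-1$. *)

(* Defs.v *)
From HB Require Import structures.
From mathcomp Require Import all_boot all_order all_algebra.
From mathcomp Require Import mathcomp_extra boolp classical_sets reals ereal.
From mathcomp Require Import sequences exp trigo.
From mathcomp Require Import complex.
(* The notations of mpoly clash with those of mathcomp-analysis. *)
From mathcomp Require Import -(notations) mpoly.

Set Implicit Arguments.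
Unset Strict Implicit.
Unset Printing Implicit Defensive.

Import Order.TTheory GRing.Theory Num.Theory.

Local Open Scope classical_set_scope.
Local Open Scope ring_scope.

Section Span.
Variables (k : fieldType) (V : lmodType k).

Definition in_span (s : seq V) (x : V) : Prop :=
  exists c : 'I_(size s) -> k, x = \sum_i c i *: s`_i.

Definition lin_indep_on (s : seq V) (I : {set 'I_(size s)}) : Prop :=
  forall c : 'I_(size s) -> k,
    \sum_(i in I) c i *: s`_i = 0 -> forall i, i \in I -> c i = 0.

Definition span_dim (s : seq V) : nat :=
  \max_(I : {set 'I_(size s)} | `[< lin_indep_on I >]) #|I|.

End Span.

(* products of exactly [n] elements of [s] *)
Fixpoint words (A : pzRingType) (s : seq A) (n : nat) : seq A :=
  if n is n'.+1 then [seq x * y | x <- s, y <- words s n'] else [:: 1].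

(* [words (1 :: s) n] spans V^n, where V is the span of [1 :: s]; every
   finite-dimensional V containing 1 is of this form.  The junk terms n = 0, 1
   do not affect the upper limit. *)
Definition GKdim (R : realType) (k : fieldType) (A : algType k) : \bar R :=
  ereal_sup [set limn_esup (fun n : nat =>
      ((ln (span_dim (words (1 :: s) n))%:R / ln n%:R : R)%:E)%E)
    | s in [set: seq A]].

Section Modules.
Variable A : nzRingType.

Definition projective (P : lmodType A) : Prop :=
  forall (M N : lmodType A) (p : {linear M -> N}) (f : {linear P -> N}),
    (forall y, exists x, p x = y) ->
    exists g : {linear P -> M}, forall x, p (g x) = f x.

(* left modules throughout: [lmodType A] *)
Record proj_resolution (M : lmodType A) := ProjResolution {
  res_obj :> nat -> lmodType A;
  res_d : forall n, {linear res_obj n.+1 -> res_obj n};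
  res_aug : {linear res_obj 0 -> M};
  res_proj : forall n, projective (res_obj n);
  res_aug_surj : forall y, exists x, res_aug x = y;
  res_exact0 : forall x, res_aug x = 0 <-> exists y, x = res_d 0 y;
  res_exact : forall n x,
    res_d n x = 0 <-> exists y, x = res_d n.+1 y
}.

Definition projdim_le (M : lmodType A) (n : nat) : Prop :=
  exists r : proj_resolution M, forall j, (n < j)%N -> forall x : r j, x = 0.

Definition gldim_le (n : nat) : Prop := forall M : lmodType A, projdim_le M n.

Definition gldim_eq (d : nat) : Prop :=
  gldim_le d /\ forall n, gldim_le n -> (d <= n)%N.

Definition left_ideal (I : set A) : Prop :=
  [/\ I 0, forall x y, I x -> I y -> I (x + y) & forall a x, I x -> I (a * x)].

(* the left regular module is semisimple *)
Definition semisimple_ring : Prop :=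
  forall I, left_ideal I -> exists J, [/\ left_ideal J,
    forall x, exists y z, [/\ I y, J z & x = y + z] &
    forall x, I x -> J x -> x = 0].

End Modules.

Definition is_grading (I : choiceType) (M : zmodType) (G : I -> set M) : Prop :=
  [/\ forall i, G i 0 /\ forall x y, G i x -> G i y -> G i (x - y),
      forall x, exists (s : seq I) (f : I -> M),
        [/\ uniq s, forall i, G i (f i) & x = \sum_(i <- s) f i] &
      forall (s : seq I) (f : I -> M), uniq s -> (forall i, G i (f i)) ->
        \sum_(i <- s) f i = 0 -> forall i, i \in s -> f i = 0].

Section Graded.
Variables (k : fieldType) (A : algType k) (gr : nat -> set A).

Definition connected_graded : Prop :=
  [/\ is_grading gr,
      forall m n x y, gr m x -> gr n y -> gr (m + n) (x * y) &
      forall x, gr 0 x <-> exists c : k, x = c%:A].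

Definition grZ (j : int) : set A :=
  if j is Posz n then gr n else [set 0].

Definition graded_module (M : lmodType A) (G : int -> set M) : Prop :=
  is_grading G /\
  forall n j (a : A) (x : M), gr n a -> G j x -> G (n%:Z + j) (a *: x).

(* The augmentation A -> A/A_{>0} = k. *)
Definition is_augmentation (eps : {lrmorphism A -> k^o}) : Prop :=
  forall n x, (0 < n)%N -> gr n x -> eps x = 0.

End Graded.

Definition trivial_module (k : fieldType) (A : algType k)
  (eps : {lrmorphism A -> k^o}) : Type := k.

Section TrivialModule.
Variables (k : fieldType) (A : algType k) (eps : {lrmorphism A -> k^o}).
Local Notation T := (trivial_module eps).

HB.instance Definition _ := GRing.Zmodule.copy T k.

Let tscale (a : A) (c : T) : T := (eps a : k) * (c : k).

Fact tscaleA a b c : tscale a (tscale b c) = tscale (a * b) c.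
Proof. by rewrite /tscale rmorphM /= mulrA. Qed.

Fact tscale1 : left_id 1 tscale.
Proof. by move=> c; rewrite /tscale rmorph1 mul1r. Qed.

Fact tscaleDr : right_distributive tscale +%R.
Proof. by move=> a b c; rewrite /tscale mulrDr. Qed.

Fact tscaleDl c : {morph tscale^~ c : a b / a + b}.
Proof. by move=> a b; rewrite /tscale rmorphD mulrDl. Qed.

HB.instance Definition _ :=
  GRing.Zmodule_isLmodule.Build A T tscaleA tscale1 tscaleDr tscaleDl.

Definition trivial_grading (j : int) : set T := [set x | j = 0 \/ x = 0].

End TrivialModule.

Section Ext.
Variables (k : fieldType) (A : algType k) (gr : nat -> set A).
Variables (M : lmodType A) (GM : int -> set M).

Definition graded_resolution (r : proj_resolution M)
    (G : forall n, int -> set (r n)) : Prop :=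
  [/\ forall n, graded_module gr (G n),
      forall n j x, G n.+1 j x -> G n j (res_d r n x) &
      forall j x, G 0%N j x -> GM j (res_aug r x)].

Variables (r : proj_resolution M) (G : forall n, int -> set (r n)).

Definition hom_degree (n : nat) (j : int) (f : {linear r n -> A^o}) : Prop :=
  forall t x, G t x -> grZ gr (t + j) (f x).

Definition cocycle (n : nat) (j : int) (f : {linear r n -> A^o}) : Prop :=
  hom_degree j f /\ forall x, f (res_d r n x) = 0.

Definition coboundary (n : nat) (j : int) : (r n -> A) -> Prop :=
  match n return (r n -> A) -> Prop with
  | 0 => fun f => forall x, f x = 0
  | n'.+1 => fun f => exists2 g : {linear r n' -> A^o},
      hom_degree j g & forall x, f x = g (res_d r n' x)
  end.

(* the degree-j part of H^n(Hom_A(P, A)) = Ext^n_A(M, A) has dimension q *)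
Definition ext_dim (n : nat) (j : int) (q : nat) : Prop :=
  exists z : 'I_q -> {linear r n -> A^o},
  [/\ forall i, cocycle j (z i),
      forall f, cocycle j f -> exists c : 'I_q -> k,
        coboundary j (fun x => (f x : A) - \sum_i c i *: (z i x : A)) &
      forall c : 'I_q -> k,
        coboundary j (fun x => \sum_i c i *: (z i x : A)) ->
        forall i, c i = 0].

End Ext.

(* Ext^n_A(k, A) is k(l) for n = d and 0 otherwise; k(l) is k placed in degree
   -l.  A one-dimensional graded module over a connected graded algebra is
   trivial up to shift, so the graded dimension determines the module.  Ext
   may be computed from any graded projective resolution. *)
Definition AS_Gorenstein (k : fieldType) (A : algType k) (gr : nat -> set A)
    (d : nat) (l : int) : Prop :=
  exists eps : {lrmorphism A -> k^o}, is_augmentation gr eps /\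
  exists (r : proj_resolution (trivial_module eps))
         (G : forall n, int -> set (r n)),
    graded_resolution gr (@trivial_grading _ _ eps) G /\
    forall (n : nat) (j : int),
      ext_dim gr G n j ((n == d) && (j == - l)).

Definition AS_regular (R : realType) (k : fieldType) (A : algType k)
    (gr : nat -> set A) : Prop :=
  connected_graded gr /\
  exists d : nat, [/\ gldim_eq A d, (GKdim R A < +oo)%E &
    exists l : int, AS_Gorenstein gr d l].

(* Elements of U (x) V are represented by formal sums of pure tensors; two
   formal sums are equal in U (x) V iff no bilinear map separates them. *)
Section Tensors.
Variable k : fieldType.

Definition tens_eq (U V : lmodType k) (s t : seq (U * V)) : Prop :=
  forall (W : lmodType k) (b : U -> V -> W),
    (forall x, linear (b x)) -> (forall y, linear (b^~ y)) ->
    \sum_(p <- s) b p.1 p.2 = \sum_(p <- t) b p.1 p.2.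

Definition tens3_eq (U V W : lmodType k) (s t : seq (U * V * W)) : Prop :=
  forall (X : lmodType k) (b : U -> V -> W -> X),
    (forall x y, linear (b x y)) -> (forall x z, linear (b x ^~ z)) ->
    (forall y z, linear (fun x => b x y z)) ->
    \sum_(p <- s) b p.1.1 p.1.2 p.2 = \sum_(p <- t) b p.1.1 p.1.2 p.2.

End Tensors.

Record hopf_structure (k : fieldType) (H : algType k) := HopfStructure {
  comult : H -> seq (H * H);
  counit : {lrmorphism H -> k^o};
  antipode : {linear H -> H};
  comult_linear : forall (c : k) x y, tens_eq (comult (c *: x + y))
    ([seq (c *: p.1, p.2) | p <- comult x] ++ comult y);
  comult1 : tens_eq (comult 1) [:: (1, 1)];
  comultM : forall x y, tens_eq (comult (x * y))
    [seq (p.1 * q.1, p.2 * q.2) | p <- comult x, q <- comult y];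
  comultA : forall x, tens3_eq
    [seq (q.1, q.2, p.2) | p <- comult x, q <- comult p.1]
    [seq (p.1, q.1, q.2) | p <- comult x, q <- comult p.2];
  counitl : forall x, \sum_(p <- comult x) (counit p.1 : k) *: p.2 = x;
  counitr : forall x, \sum_(p <- comult x) (counit p.2 : k) *: p.1 = x;
  antipodel : forall x,
    \sum_(p <- comult x) antipode p.1 * p.2 = (counit x : k)%:A;
  antipoder : forall x,
    \sum_(p <- comult x) p.1 * antipode p.2 = (counit x : k)%:A
}.

Definition hopf_ideal (k : fieldType) (H : algType k) (hH : hopf_structure H)
    (I : set H) : Prop :=
  [/\ left_ideal I, (forall a x, I x -> I (x * a)),
      (forall x, I x -> exists s t : seq (H * H),
        [/\ forall p, p \in s -> I p.1, forall p, p \in t -> I p.2 &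
            tens_eq (comult hH x) (s ++ t)]),
      (forall x, I x -> counit hH x = 0) &
      (forall x, I x -> I (antipode hH x))].

Record module_algebra (k : fieldType) (H : algType k) (hH : hopf_structure H)
    (A : algType k) := ModuleAlgebra {
  hact :> H -> A -> A;
  hact_linear : forall h, linear (hact h);
  hact_linearl : forall x, linear (hact^~ x);
  hact1l : forall x, hact 1 x = x;
  hactMl : forall g h x, hact (g * h) x = hact g (hact h x);
  hact1 : forall h, hact h 1 = (counit hH h : k)%:A;
  hactM : forall h x y,
    hact h (x * y) = \sum_(p <- comult hH h) hact p.1 x * hact p.2 y
}.

Section Invariants.
Variables (k : fieldType) (H : algType k) (hH : hopf_structure H).
Variables (A : algType k) (act : module_algebra hH A).

Definition inner_faithful : Prop :=
  forall I, hopf_ideal hH I -> (forall h x, I h -> act h x = 0) ->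
  forall h, I h -> h = 0.

Definition hinvariant : {pred A} :=
  fun x => `[< forall h, act h x = (counit hH h : k) *: x >].

Lemma hinvariantP x :
  reflect (forall h, act h x = (counit hH h : k) *: x) (x \in hinvariant).
Proof. exact: asboolP. Qed.

Fact hinvariant_subalg : GRing.subalg_closed hinvariant.
Proof.
split.
- by apply/hinvariantP => h; rewrite hact1.
- move=> c x y /hinvariantP hx /hinvariantP hy; apply/hinvariantP => h.
  by rewrite hact_linear hx hy scalerDr !scalerA mulrC.
- move=> x y /hinvariantP hx /hinvariantP hy; apply/hinvariantP => h.
  rewrite hactM -[in RHS](counitl hH h) linear_sum scaler_suml.
  apply: eq_bigr => p _.
  by rewrite hx hy -scalerAl -scalerAr scalerA linearZ.
Qed.

HB.instance Definition _ :=
  GRing.isSubalgClosed.Build k A hinvariant hinvariant_subalg.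

Record invariants : Type :=
  Invariant { invariant_val :> A; _ : invariant_val \in hinvariant }.

HB.instance Definition _ := [isSub for invariant_val].
HB.instance Definition _ := [Choice of invariants by <:].
HB.instance Definition _ := [SubChoice_isSubAlgebra of invariants by <:].

Definition invariants_grading (gr : nat -> set A) (n : nat) : set invariants :=
  [set x | gr n (val x)].

Definition preserves_grading (gr : nat -> set A) : Prop :=
  forall h n x, gr n x -> gr n (act h x).

End Invariants.

Definition reflection_hopf_algebra (R : realType) (k : fieldType)
    (H : algType k) (hH : hopf_structure H) (A : algType k)
    (act : module_algebra hH A) (gr : nat -> set A) : Prop :=
  [/\ semisimple_ring H, inner_faithful act, preserves_grading act gr,
      AS_regular R gr & AS_regular R (invariants_grading (act := act) gr)].

(* (A, g) is the algebra generated by the g i subject to the relations [rel],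
   expressed by its universal property. *)
Definition presented_by (k : fieldType) (I : Type)
    (rel : forall B : algType k, (I -> B) -> Prop)
    (A : algType k) (g : I -> A) : Prop :=
  rel A g /\
  forall (B : algType k) (b : I -> B), rel B b ->
    exists f : {lrmorphism A -> B}, (forall i, f (g i) = b i) /\
      forall f' : {lrmorphism A -> B}, (forall i, f' (g i) = b i) -> f' =1 f.

Section Masuoka.
Variables (k : fieldType) (m : nat).

Inductive masuoka_gen := Gen_a | Gen_sp | Gen_sm.

Definition masuoka_rel (B : algType k) (g : masuoka_gen -> B) : Prop :=
  [/\ g Gen_a * g Gen_sp = g Gen_sp * g Gen_a /\
      g Gen_a * g Gen_sm = g Gen_sm * g Gen_a,
      g Gen_a ^+ 2 = 1, g Gen_sp ^+ 2 = 1, g Gen_sm ^+ 2 = 1 &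
      (g Gen_sp * g Gen_sm) ^+ m = 1].

(* (H, g) is the Hopf algebra A_{4m} with its generators a, s_+, s_- *)
Definition is_masuoka (H : algType k) (hH : hopf_structure H)
    (g : masuoka_gen -> H) : Prop :=
  let a := g Gen_a in let sp := g Gen_sp in let sm := g Gen_sm in
  let e0 : H := 2%:R^-1 *: (1 + a) in
  let e1 : H := 2%:R^-1 *: (1 - a) in
  [/\ presented_by masuoka_rel g,
      tens_eq (comult hH a) [:: (a, a)] /\ counit hH a = 1,
      tens_eq (comult hH sp) [:: (sp, e0 * sp); (sm, e1 * sp)] /\
      tens_eq (comult hH sm) [:: (sm, e0 * sm); (sp, e1 * sm)],
      counit hH sp = 1 /\ counit hH sm = 1 &
      antipode hH sp = e0 * sp + e1 * sm /\
      antipode hH sm = e0 * sm + e1 * sp].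

End Masuoka.

Section Aminus.
Variables (k : fieldType) (lam : k) (i : nat).

Inductive aminus_gen := Gen_u | Gen_v.

Definition aminus_rel (B : algType k) (x : aminus_gen -> B) : Prop :=
  x Gen_u ^+ 2 = lam ^+ i *: x Gen_v ^+ 2.

(* (A, x) is k<u,v>/(u^2 - lam^i v^2) with its generators u, v *)
Definition is_aminus (A : algType k) (x : aminus_gen -> A) : Prop :=
  presented_by aminus_rel x.

(* the grading with u and v in degree 1 *)
Definition aminus_grading (A : algType k) (x : aminus_gen -> A) (n : nat) :
    set A :=
  in_span (words [:: x Gen_u; x Gen_v] n).

(* A_1 is the H-module pi_i^{-1}(u,v) *)
Definition acts_by_pi (H : algType k) (hH : hopf_structure H)
    (g : masuoka_gen -> H) (A : algType k) (act : module_algebra hH A)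
    (x : aminus_gen -> A) : Prop :=
  let u := x Gen_u in let v := x Gen_v in
  [/\ act (g Gen_sp) u = v /\ act (g Gen_sp) v = u,
      act (g Gen_sm) u = lam ^+ i *: v /\ act (g Gen_sm) v = lam ^- i *: u &
      act (g Gen_a) u = - u /\ act (g Gen_a) v = - v].

End Aminus.

(* S = k[x, y], with x and y commuting and algebraically independent: an
   algebra morphism out of [mpoly 2 k] forces phi 'X_0 and phi 'X_1 to
   commute, and [injective phi] is algebraic independence. *)
Definition polynomial_ring_on (k : fieldType) (A : algType k) (S : {pred A})
    (x y : A) : Prop :=
  exists phi : {lrmorphism mpoly 2 k -> A},
  [/\ phi (mpolyX k (mnm1 (0 : 'I_2))) = x,
      phi (mpolyX k (mnm1 (1 : 'I_2))) = y,
      injective phi &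
      forall z, z \in S <-> exists p, z = phi p].

Definition exp_2pi_i_div (R : realType) (m : nat) : R[i] :=
  Complex (cos (2%:R * pi / m%:R)) (sin (2%:R * pi / m%:R)).
Arguments exp_2pi_i_div : clear implicits.

(* Main.v *)
Require Import Defs.
From HB Require Import structures.
From mathcomp Require Import all_boot all_order all_algebra.
From mathcomp Require Import boolp classical_sets reals ereal exp trigo complex.
From mathcomp Require Import -(notations) mpoly.
From mathcomp Require Import freeg.
From mathcomp Require Import zify ring.

Set Implicit Arguments.
Unset Strict Implicit.
Unset Printing Implicit Defensive.

Import Order.TTheory GRing.Theory Num.Theory.
Local Open Scope ring_scope.

(** The idea is that both A and its ring of invariants are quantum planes:
    algebras with two generators X and Y, one relation Y X = p X Y, and basis
    the monomials X^i Y^j.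

    Put q = lambda^i, a primitive m-th root of unity, and s^2 = q.  In terms of
    X = u - s v and Y = u + s v the relation u^2 = q v^2 reads Y X = - X Y, so A
    is the quantum plane with p = -1 and both generators in degree 1
    ([aminus_quantum_plane]).  The invariants are spanned by the monomials in
    w = u^2 and T = (uv)^m + (vu)^m, which commute, so they form the quantum
    plane with p = 1 and generators in degrees 2 and 2m
    ([invariants_quantum_plane]); this is also the polynomial ring of the
    statement ([invariants_polynomial]).  In both cases the monomials are
    independent because there are enough representations by 2 x 2 matrices to
    evaluate them at arbitrary points ([coordinates]).

    One theorem then gives the regularity of both algebras: every graded quantum
    plane B is AS regular of dimension 2 ([qp_AS_regular]).  For any B-module M
    the Koszul complex 0 -> B(x)M -> (B(x)M)^2 -> B(x)M -> M -> 0, with tensor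
    products over k, is a resolution by free modules ([koszul_exact0],
    [koszul_exact1], [koszul2_inj]): exactness is division with remainder, first
    by the degree in Y and then by the degree in X.  Hence the global dimension
    is at most 2.  It is not smaller because the last map of the resolution of k
    does not split ([resolution_split], [qp_gldim]).  Applying Hom(-, B) to the
    same resolution gives the same complex on the other side, whose cohomology
    is k in degree 2 ([ext0], [ext1], [ext2]).  Words of length n have
    coordinates in a square of side linear in n, which bounds the growth
    ([qp_GKdim]).

    To find the invariants, note that w is central, that P = uv and Q = vu
    satisfy P Q = q^-1 w^2, and that A is spanned by the w^i P^j, w^i Q^j,
    w^i P^j u and w^i Q^j v ([aminus_words]).  The central element a acts by -1
    on the odd words.  The element c = s_+ s_- has order m and acts on P^j and
    Q^j by q^(-2j) and q^(2j); as m is odd, these are 1 only if m divides j.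
    Finally s_+ exchanges P^(mj) and Q^(mj).  So the Reynolds operator kills the
    odd words and the even ones with m not dividing j, and sends the others to
    half of w^i (P^(mj) + Q^(mj)), which is a polynomial in w and T by Newton's
    recursion ([power_sums_span], [invariants_span]).

    As an algebra A_4m is the group algebra of a dihedral group times a group of
    order two, and Maschke's averaging makes it semisimple
    ([masuoka_semisimple]).  It acts faithfully on A: an element
    f1(c) + f2(c) s_+ + a (f3(c) + f4(c) s_+) that kills all words has
    polynomials f1, ..., f4 vanishing at all powers of q, and is therefore 0
    ([act_faithful]).  In particular the action is inner-faithful. *)

(** * Algebras presented by generators and relations *)

Definition mk_linear (R : nzRingType) (U V : lmodType R) (f : U -> V)
    (hf : linear f) : {linear U -> V} :=
  HB.pack f (GRing.isLinear.Build R U V *:%R f hf).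

Definition mk_lrmorphism (k : fieldType) (A B : algType k) (f : A -> B)
    (hf : linear f) (hM : monoid_morphism f) : {lrmorphism A -> B} :=
  HB.pack f (GRing.isLinear.Build k A B *:%R f hf)
    (GRing.isMonoidMorphism.Build A B f hM).

(** Here the scaling on the target is fixed; [linearZ] leaves it to unification
    and can then match the opposite or a scaling by another ring. *)
Lemma linZ (R : nzRingType) (U V : lmodType R) (f : {linear U -> V}) c x :
  f (c *: x) = c *: f x.
Proof. exact: linearZ_LR. Qed.

Section Subalgebra.
Variables (k : fieldType) (A : algType k) (S : {pred A}).

(** The closure proof is a parameter so that instances can be declared on this
    predicate for an arbitrary S. *)
Definition subalg_mem (_ : GRing.subalg_closed S) : {pred A} := S.

Variable hS : GRing.subalg_closed S.

HB.instance Definition _ :=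
  GRing.isSubalgClosed.Build k A (subalg_mem hS) hS.

Record subalgebra : Type :=
  SubalgebraElt { subalg_val :> A; _ : subalg_val \in subalg_mem hS }.

HB.instance Definition _ := [isSub for subalg_val].
HB.instance Definition _ := [Choice of subalgebra by <:].
HB.instance Definition _ := [SubChoice_isSubAlgebra of subalgebra by <:].

End Subalgebra.

Section Presented.
Variables (k : fieldType) (I : Type).
Variable rel : forall B : algType k, (I -> B) -> Prop.
(* Relations between elements of a subalgebra may be checked in the algebra. *)
Hypothesis rel_inj : forall (A B : algType k) (f : {lrmorphism B -> A})
  (b : I -> B), injective f -> rel (f \o b) -> rel b.
Variables (A : algType k) (g : I -> A).
Hypothesis presA : presented_by rel g.

(** The elements satisfying P form a subalgebra, which by the universal property
    receives a map from A.  Followed by the inclusion it is an endomorphism of A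
    that fixes the generators, so it is the identity and every element lies in
    the subalgebra. *)
Lemma presented_ind (P : A -> Prop) :
    P 1 -> (forall c x y, P x -> P y -> P (c *: x + y)) ->
    (forall x y, P x -> P y -> P (x * y)) -> (forall i, P (g i)) ->
  forall x, P x.
Proof.
move=> P1 Plin PM Pg.
pose S : {pred A} := fun x => `[< P x >].
have hS : GRing.subalg_closed S.
  split; first exact/asboolP.
  - by move=> c x y /asboolP Px /asboolP Py; apply/asboolP/Plin.
  - by move=> x y /asboolP Px /asboolP Py; apply/asboolP/PM.
have gS i : g i \in subalg_mem hS by apply/asboolP/Pg.
pose g' i : subalgebra hS := SubalgebraElt (gS i).
have [relg univ] := presA.
have relg' : rel g'.
  have valL : linear (@subalg_val k A S hS) by [].
  have valM : monoid_morphism (@subalg_val k A S hS) by [].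
  exact: (@rel_inj A _ (mk_lrmorphism valL valM) g' val_inj).
have [f [fg _]] := univ _ _ relg'.
have [h [_ hu]] := univ _ _ relg.
have fL : linear (fun x => subalg_val (f x)) by move=> c x y; rewrite linearP.
have fM : monoid_morphism (fun x => subalg_val (f x)).
  by split=> [|x y]; rewrite ?rmorph1 ?rmorphM.
have idL : linear (@id A) by [].
have idM : monoid_morphism (@id A) by [].
have e1 := hu (mk_lrmorphism fL fM) (fun i => congr1 val (fg i)).
have e2 := hu (mk_lrmorphism idL idM) (fun i => erefl).
move=> x; have : val (f x) = x by rewrite -[LHS]/(mk_lrmorphism fL fM x) e1 -e2.
by move=> <-; apply/asboolP; exact: (valP (f x)).
Qed.

(** This follows from [presented_ind] applied to the property that left
    multiplication by x preserves P. *)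
Lemma presented_left_ind (P : A -> Prop) :
    P 1 -> (forall c x y, P x -> P y -> P (c *: x + y)) ->
    (forall i x, P x -> P (g i * x)) ->
  forall x, P x.
Proof.
move=> P1 Plin Pg x; rewrite -[x]mulr1; move: x 1 P1.
apply: presented_ind => [y|c x z hx hz y Py|x z hx hz y Py|i y]; last exact: Pg.
- by rewrite mul1r.
- by rewrite mulrDl -scalerAl; apply: Plin; [exact: hx|exact: hz].
- by rewrite -mulrA; apply/hx/hz.
Qed.

End Presented.

(** * Restriction of scalars and free modules *)

(** A copy of the B-module M carrying only its k-vector space structure. *)
Definition restricted (k : fieldType) (B : algType k) (M : lmodType B) : Type :=
  M.

Section Restricted.
Variables (k : fieldType) (B : algType k) (M : lmodType B).
Local Notation V := (restricted M).

HB.instance Definition _ := GRing.Zmodule.copy V M.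

Let rscale (c : k) (x : V) : V := (c%:A : B) *: (x : M).

Fact rscaleA a b x : rscale a (rscale b x) = rscale (a * b) x.
Proof. by rewrite /rscale scalerA -scalerAl mul1r scalerA. Qed.

Fact rscale1 : left_id 1 rscale.
Proof. by move=> x; rewrite /rscale !scale1r. Qed.

Fact rscaleDr : right_distributive rscale +%R.
Proof. by move=> c x y; rewrite /rscale scalerDr. Qed.

Fact rscaleDl x : {morph rscale^~ x : a b / a + b}.
Proof. by move=> a b; rewrite /rscale !scalerDl. Qed.

HB.instance Definition _ :=
  GRing.Zmodule_isLmodule.Build k V rscaleA rscale1 rscaleDr rscaleDl.

Lemma rscaleE (c : k) (x : V) : c *: x = (c%:A : B) *: (x : M).
Proof. by []. Qed.

End Restricted.

Section Freeg.
Variables (B : nzRingType) (K : choiceType).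

(** The lift of a map on generators is known to be additive; compatibility with
    scalars is checked on the terms of a formal sum. *)
Lemma fglift_linear (N : lmodType B) (f : K -> N) : linear (@fglift B N K f).
Proof.
have addf := @lift_is_additive B K N f.
have fB D D' : fglift f (D - D') = fglift f D - fglift f D' by exact: addf.
have f0 : fglift f 0 = 0 by rewrite -[0]subr0 fB subrr.
have fN D : fglift f (- D) = - fglift f D by rewrite -sub0r fB f0 sub0r.
have fD D D' : fglift f (D + D') = fglift f D + fglift f D'.
  by rewrite -{1}[D']opprK fB fN opprK.
move=> c D D'; rewrite fD; congr (_ + _).
rewrite -{1 2}[D]freeg_sumE.
elim: (dom D) => [|x s IH]; first by rewrite !big_nil scaler0 f0 scaler0.
rewrite !big_cons scalerDr !fD IH scalerDr; congr (_ + _).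
have -> : c *: << coeff x D *g x >> = << c * coeff x D *g x >>.
  by apply/eqP/freeg_eqP => y; rewrite coeffZ !coeffU mulrA.
by rewrite !liftU scalerA.
Qed.

Definition free_module : lmodType B := {freeg K / B}.
Definition free_gen (e : K) : free_module := << e >>.

(** The codomain is written as an underlying ring so that a coefficient can
    directly scale elements of a module. *)
Definition free_coef (e : K) (D : free_module) : GRing.PzRing.sort B :=
  coeff e D.

Lemma free_moduleE (D : free_module) :
  D = \sum_(e <- dom D) free_coef e D *: free_gen e.
Proof.
rewrite -{1}[D]freeg_sumE; apply: eq_bigr => e _.
by apply/eqP/freeg_eqP => y; rewrite coeffZ !coeffU mul1r.
Qed.

Fact free_lift_subproof (N : lmodType B) (f : K -> N) :
  {F : {linear free_module -> N} | forall e, F (free_gen e) = f e}.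
Proof.
by exists (mk_linear (fglift_linear f)) => e; rewrite /= liftU scale1r.
Qed.

(** The map is extracted from an opaque proof so that conversion checks do not
    unfold it to a sum over the support. *)
Definition free_lift (N : lmodType B) (f : K -> N) := sval (free_lift_subproof f).

Lemma free_liftE (N : lmodType B) (f : K -> N) e : free_lift f (free_gen e) = f e.
Proof. exact: (svalP (free_lift_subproof f)). Qed.

Lemma free_liftED (N : lmodType B) (f : K -> N) (D : free_module) :
  free_lift f D = \sum_(e <- dom D) free_coef e D *: f e.
Proof.
rewrite {1}[D]free_moduleE linear_sum.
by apply: eq_bigr => e _; rewrite linZ free_liftE.
Qed.

Lemma free_projective : projective free_module.
Proof.
move=> M N p f psurj.
have /choice[s hs] : forall e : K, exists x, p x = f (free_gen e).
  by move=> e; apply: psurj.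
exists (free_lift s) => D; rewrite [D]free_moduleE !linear_sum.
by apply: eq_bigr => e _; rewrite !linZ free_liftE hs.
Qed.

End Freeg.

(** * Bases modulo a subspace *)

Section ComplementBasis.
Variables (k : fieldType) (V : lmodType k) (W : V -> Prop).
Hypotheses (W0 : W 0) (Wlin : forall c x y, W x -> W y -> W (c *: x + y)).

Let indep (E : set V) := forall (s : seq V) (c : V -> k), uniq s ->
  (forall x, x \in s -> E x) -> W (\sum_(x <- s) c x *: x) ->
  forall x, x \in s -> c x = 0.

Let indep_chain (F : set (set V)) :
  (F `<=` indep)%classic -> total_on F subset -> indep (\bigcup_(X in F) X)%classic.
Proof.
move=> Find Ftot s c us sF Ws.
have [-> //|/eqP s0] := eqVneq s [::].
suff [X FX sX] : exists2 X, F X & forall x, x \in s -> X x.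
  exact: (Find X FX s c us sX Ws).
elim: s s0 sF {us Ws} => // x s IH _ sF.
have [X FX Xx] := sF x (mem_head _ _).
have [s0|/eqP s0] := eqVneq s [::].
  by exists X => // y; rewrite s0 inE => /eqP ->.
have [//|Y FY Ys] := IH s0; first by move=> y ys; apply: sF; rewrite inE ys orbT.
have [XY|YX] := Ftot _ _ FX FY.
  by exists Y => // y; rewrite inE => /predU1P[->|/Ys//]; exact: XY.
by exists X => // y; rewrite inE => /predU1P[->//|/Ys]; exact: YX.
Qed.

(** A maximal subset of V independent modulo W, which exists by Zorn's lemma, is
    a basis of V/W, and crd x is the vector of coordinates of the class of x.
    For W = 0 this is a basis of V; in general x - free_lift e (crd x) is a
    linear projection of V onto W. *)
Lemma complement_basis : exists (K : choiceType) (e : K -> V)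
    (crd : {linear V -> free_module k K}),
  [/\ forall x, W (x - free_lift e (crd x)), forall x, W x -> crd x = 0 &
      forall j, crd (e j) = free_gen k j].
Proof.
have [E [Eind Emax]] := Zorn_bigcup indep_chain.
pose K : choiceType := {x : V | `[< E x >]}.
pose e (j : K) : V := sval j.
have WD x y : W x -> W y -> W (x + y).
  by move=> Wx Wy; rewrite -[x]scale1r; exact: Wlin.
have WZ c x : W x -> W (c *: x).
  by move=> Wx; rewrite -[_ *: _]addr0; exact: Wlin.
have WN x : W x -> W (- x) by rewrite -scaleN1r; exact: WZ.
have uniqD (D : free_module k K) : W (free_lift e D) -> D = 0.
  rewrite free_liftED.
  pose c (x : V) := if insub x is Some j then free_coef (j : K) D else 0.
  have cE (j : K) : c (e j) = free_coef j D by rewrite /c /e valK.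
  under eq_bigr do rewrite -cE.
  rewrite -(big_map e xpredT (fun x => c x *: x)) => WD0.
  have ue : uniq (map e (dom D)) by rewrite map_inj_uniq ?uniq_dom//; exact: val_inj.
  have eE x : x \in map e (dom D) -> E x.
    by move=> /mapP[j _ ->]; apply/asboolP; exact: (svalP j).
  have c0 := Eind _ c ue eE WD0.
  rewrite [D]free_moduleE big_seq big1 // => j jD.
  by rewrite -cE c0 ?scale0r //; exact: map_f.
have span x : exists D : free_module k K, W (x - free_lift e D).
  apply: contrapT => nx.
  have nEx : ~ E x.
    move=> Ex; apply: nx; exists (free_gen k (exist _ x (asboolT Ex))).
    by rewrite free_liftE /= subrr.
  (* If x were not in the span, E together with x would still be independent. *)
  apply: (Emax (E `|` [set x])%classic).
    split=> [y Ey|sub]; first by left.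
    by apply: nEx; apply: sub; right.
  pose gen (y : V) : free_module k K := oapp (@free_gen k K) 0 (insub y).
  have genE y : E y -> free_lift e (gen y) = y.
    move=> Ey; rewrite /gen (insubT (fun z => `[< E z >]) (asboolT Ey)) /= free_liftE.
    exact: SubK.
  have EEx y : (E `|` [set x])%classic y -> y != x -> E y.
    by case=> [//|->]; rewrite eqxx.
  move=> s c us sE Ws y ys.
  have [xs|xns] := boolP (x \in s); last first.
    apply: (Eind s c us _ Ws y ys) => z zs; apply: (EEx z (sE z zs)).
    by apply: contraNneq xns => <-.
  have remE z : z \in rem x s -> E z.
    move=> zs; apply: EEx; first exact: sE (mem_rem zs).
    by move: zs; rewrite (mem_rem_uniq _ us) inE => /andP[].
  move: Ws; rewrite (big_rem x) //= => Ws.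
  have [cx0|cx0] := eqVneq (c x) 0.
    have [-> //|yx] := eqVneq y x.
    move: Ws; rewrite cx0 scale0r add0r => Ws.
    apply: (Eind _ c (rem_uniq x us) remE Ws).
    by rewrite (mem_rem_uniq _ us) inE yx.
  case: nx; exists (- (c x)^-1 *: \sum_(z <- rem x s) c z *: gen z).
  rewrite linearZ_LR linear_sum /=.
  have -> : \sum_(z <- rem x s) free_lift e (c z *: gen z) =
            \sum_(z <- rem x s) c z *: z.
    by rewrite !big_seq; apply: eq_bigr => z /remE Ez; rewrite linearZ_LR genE.
  have := WZ (c x)^-1 _ Ws.
  by rewrite scalerDr scalerA mulVf // scale1r scaleNr opprK.
have /choice[crd crdP] := span.
have crdE x D : W (x - free_lift e D) -> crd x = D.
  move=> WxD; apply/eqP; rewrite -subr_eq0; apply/eqP/uniqD.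
  rewrite linearB /=.
  have -> : free_lift e (crd x) - free_lift e D =
            (x - free_lift e D) - (x - free_lift e (crd x)).
    by rewrite opprB [RHS]addrC subrKA.
  by apply: WD => //; exact: WN.
have crdL : linear crd.
  move=> c x y; apply: crdE; rewrite linearP /= opprD addrACA -scalerBr.
  exact: Wlin.
exists K, e, (mk_linear crdL); split=> [x|x Wx|j] /=; first exact: crdP.
- by apply: crdE; rewrite linear0 subr0.
- by apply: crdE; rewrite free_liftE subrr.
Qed.

End ComplementBasis.

(** * Comparison of projective resolutions *)

Section Image.
Variables (A : nzRingType) (M N : lmodType A) (d : {linear M -> N}).

Definition in_image : {pred N} := fun y => `[< exists x, d x = y >].

Fact in_image_submod : GRing.submod_closed in_image.
Proof.
split=> [|c x y /asboolP[x' <-] /asboolP[y' <-]]; apply/asboolP.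
  by exists 0; rewrite linear0.
by exists (c *: x' + y'); rewrite linearP.
Qed.

HB.instance Definition _ := GRing.isSubmodClosed.Build A N in_image in_image_submod.

Record image : Type := ImageElt { image_val :> N; _ : image_val \in in_image }.

HB.instance Definition _ := [isSub for image_val].
HB.instance Definition _ := [Choice of image by <:].
HB.instance Definition _ := [SubChoice_isSubLmodule of image by <:].

(** Projectivity is used for the corestriction of d to its image, which is
    surjective. *)
Lemma projective_lift (P : lmodType A) (f : P -> N) :
    projective P -> linear f -> (forall x, exists y, d y = f x) ->
  exists g : {linear P -> M}, forall x, d (g x) = f x.
Proof.
move=> projP fL fd.
have inI x : f x \in in_image by apply/asboolP.
have inI' x : d x \in in_image by apply/asboolP; exists x.
have fL' : linear (fun x => ImageElt (inI x) : image).
  by move=> c x y; apply: val_inj; rewrite [RHS]linearP; exact: fL.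
have dL' : linear (fun x => ImageElt (inI' x) : image).
  by move=> c x y; apply: val_inj; rewrite [RHS]linearP; exact: linearP.
have [|g gP] := projP _ _ (mk_linear dL') (mk_linear fL').
  move=> [y yI]; have /asboolP[x xy] := yI; exists x.
  exact: val_inj.
by exists g => x; have /(congr1 val) := gP x.
Qed.

End Image.

Section Split.
Variables (A : nzRingType) (M : lmodType A) (r s : proj_resolution M).

(** The comparison maps s -> r -> s are homotopic to the identity of s.  As r
    vanishes in degree 2, the composite vanishes there, so in degree 2 the
    homotopy is a retraction of the last map of s.  Conversely, a resolution of
    length 2 whose last map has no retraction rules out resolutions of length
    one. *)
Lemma resolution_split : (forall x : r 2%N, x = 0) -> (forall x : s 3%N, x = 0) ->
  exists h : {linear s 1%N -> s 2%N}, forall x, h (res_d s 1 x) = x.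
Proof.
move=> r2 s3.
have augd (t : proj_resolution M) x : res_aug t (res_d t 0 x) = 0.
  by apply/res_exact0; exists x.
have dd (t : proj_resolution M) n x : res_d t n (res_d t n.+1 x) = 0.
  by apply/res_exact; exists x.
have ex0 (t : proj_resolution M) x : res_aug t x = 0 -> exists y, res_d t 0 y = x.
  by move/res_exact0 => [y ->]; exists y.
have ex1 (t : proj_resolution M) n x : res_d t n x = 0 -> exists y, res_d t n.+1 y = x.
  by move/res_exact => [y ->]; exists y.
have cmp0 (t t' : proj_resolution M) : exists f : {linear t 0%N -> t' 0%N},
    forall x, res_aug t' (f x) = res_aug t x.
  have L : linear (res_aug t) by move=> ? ? ?; rewrite linearP.
  apply: projective_lift L _; first exact: res_proj.
  by move=> x; apply: res_aug_surj.
have cmp1 (t t' : proj_resolution M) (f : {linear t 0%N -> t' 0%N}) :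
    (forall x, res_aug t' (f x) = res_aug t x) ->
    exists g : {linear t 1%N -> t' 1%N}, forall x, res_d t' 0 (g x) = f (res_d t 0 x).
  move=> hf.
  have L : linear (fun x => f (res_d t 0 x)) by move=> ? ? ?; rewrite !linearP.
  apply: projective_lift L _; first exact: res_proj.
  by move=> x; apply: ex0; rewrite hf augd.
(* p : s -> r and q : r -> s in degrees 0 and 1, then the homotopy h0, h1
   between q p and the identity. *)
have [p0 p0E] := cmp0 s r; have [p1 p1E] := cmp1 _ _ _ p0E.
have [q0 q0E] := cmp0 r s; have [q1 q1E] := cmp1 _ _ _ q0E.
have [h0 h0E] : exists h0 : {linear s 0%N -> s 1%N},
    forall x, res_d s 0 (h0 x) = x - q0 (p0 x).
  have L : linear (fun x => x - q0 (p0 x)).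
    by move=> c x y; rewrite !linearP /= addrACA -scalerDr.
  apply: projective_lift L _; first exact: res_proj.
  by move=> x; apply: ex0; rewrite linearB /= q0E p0E subrr.
have [h1 h1E] : exists h1 : {linear s 1%N -> s 2%N},
    forall x, res_d s 1 (h1 x) = x - q1 (p1 x) - h0 (res_d s 0 x).
  have L : linear (fun x => x - q1 (p1 x) - h0 (res_d s 0 x)).
    move=> c x y; rewrite !linearP /=.
    by rewrite (addrACA (c *: x)) [LHS]addrACA -!scalerDr.
  apply: projective_lift L _; first exact: res_proj.
  move=> x; apply: ex1.
  by rewrite !linearB /= q1E p1E h0E subrr.
exists h1 => x; apply/eqP; rewrite -subr_eq0; apply/eqP.
have p1d : p1 (res_d s 1 x) = 0.
  have [y <-] : exists y, res_d r 1 y = p1 (res_d s 1 x).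
    by apply: ex1; rewrite p1E dd linear0.
  by rewrite (r2 y) linear0.
have [y <-] : exists y, res_d s 2 y = h1 (res_d s 1 x) - x.
  apply: ex1; rewrite linearB /= h1E dd p1d !linear0 !addr0; exact: subrr.
by rewrite (s3 y) linear0.
Qed.

End Split.

(** * Quantum planes and their Koszul complex *)

(** The algebra k_p[X, Y] with Y X = p X Y, graded by giving X and Y the degrees
    dx and dy.  The basis X^i Y^j is recorded through its coordinate functions,
    because all later arguments compare coefficients. *)
Record quantum_plane (k : fieldType) (B : algType k) (X Y : B) (p : k)
    (dx dy : nat) (gr : nat -> set B) := QuantumPlane {
  qp_p : p != 0;
  qp_dx : (0 < dx)%N;
  qp_dy : (0 < dy)%N;
  qp_comm : Y * X = p *: (X * Y);
  qp_coef : nat -> nat -> {linear B -> k^o};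
  qp_coefE : forall i j a b,
    qp_coef i j (X ^+ a * Y ^+ b) = ((i == a) && (j == b))%:R;
  qp_span : forall b, exists n,
    b = \sum_(i < n) \sum_(j < n) qp_coef i j b *: (X ^+ i * Y ^+ j);
  qp_gr : forall n b,
    gr n b <-> forall i j, (dx * i + dy * j)%N != n -> qp_coef i j b = 0
}.

Section QuantumPlane.
Variables (k : fieldType) (B : algType k) (X Y : B) (p : k) (dx dy : nat).
Variable gr : nat -> set B.
Hypothesis qp : quantum_plane X Y p dx dy gr.
Local Notation coef := (qp_coef qp).

Lemma qp_ind (Q : B -> Prop) : (forall x y, Q x -> Q y -> Q (x + y)) ->
    (forall c a b, Q (c *: (X ^+ a * Y ^+ b))) -> forall x, Q x.
Proof.
move=> QD QM x; have Q0 : Q 0 by rewrite -(scale0r (X ^+ 0 * Y ^+ 0)).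
have [n ->] := qp_span qp x.
by apply: big_ind => // i _; apply: big_ind.
Qed.

Lemma qp_YX i j : Y ^+ j * X ^+ i = p ^+ (j * i) *: (X ^+ i * Y ^+ j).
Proof.
have YX i' : Y * X ^+ i' = p ^+ i' *: (X ^+ i' * Y).
  elim: i' => [|i' IH]; first by rewrite !expr0 mulr1 mul1r scale1r.
  by rewrite exprSr mulrA IH -scalerAl -(mulrA _ Y X) (qp_comm qp) -scalerAr scalerA exprSr mulrA.
elim: j => [|j IH]; first by rewrite !expr0 mulr1 mul1r scale1r.
rewrite exprSr -[LHS]mulrA YX -scalerAr (mulrA (Y ^+ j)) IH -scalerAl scalerA -exprD mulSn.
by rewrite mulrA.
Qed.

Lemma qp_monM i j a b :
  (X ^+ i * Y ^+ j) * (X ^+ a * Y ^+ b) =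
  p ^+ (j * a) *: (X ^+ (i + a) * Y ^+ (j + b)).
Proof.
rewrite -mulrA [Y ^+ j * _]mulrA qp_YX -scalerAl -scalerAr.
by rewrite !exprD !mulrA.
Qed.

Lemma qp_monX a b : (X ^+ a * Y ^+ b) * X = p ^+ b *: (X ^+ a.+1 * Y ^+ b).
Proof. by have := qp_monM a b 1 0; rewrite expr1 expr0 mulr1 muln1 addn1 addn0. Qed.

Lemma qp_ext x y : (forall i j, coef i j x = coef i j y) -> x = y.
Proof.
move=> h; apply/eqP; rewrite -subr_eq0; apply/eqP.
have [n ->] := qp_span qp (x - y).
by rewrite big1 // => i _; rewrite big1 // => j _; rewrite linearB /= h subrr scale0r.
Qed.

Section Induced.
Variables (M P : lmodType B) (xi : M -> P) (cf : nat -> nat -> P -> M).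

(** P is the module B (x)_k M, with xi m = 1 (x) m and with cf i j z the
    coefficient in M of X^i Y^j in z.  It is characterised rather than
    constructed, so that for M = k one may take B itself. *)
Record induced : Prop := Induced {
  xiD : forall x y, xi (x + y) = xi x + xi y;
  xiZ : forall (c : k) x, xi (c%:A *: x) = c%:A *: xi x;
  cfD : forall i j x y, cf i j (x + y) = cf i j x + cf i j y;
  cfE : forall i j a b m, cf i j ((X ^+ a * Y ^+ b) *: xi m) =
     if (i == a) && (j == b) then m else 0;
  cf_span : forall z, exists n,
     z = \sum_(i < n) \sum_(j < n) (X ^+ i * Y ^+ j) *: xi (cf i j z);
  induced_projective : projective P;
  induced_univ : forall (N : lmodType B) (f : M -> N),
     (forall x y, f (x + y) = f x + f y) ->
     (forall (c : k) x, f (c%:A *: x) = c%:A *: f x) ->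
     exists F : {linear P -> N}, forall m, F (xi m) = f m
}.

Hypothesis ind : induced.

Lemma xi0 : xi 0 = 0.
Proof. by apply: (addIr (xi 0)); rewrite add0r -(xiD ind) // addr0. Qed.

Lemma cf0 i j : cf i j 0 = 0.
Proof. by apply: (addIr (cf i j 0)); rewrite add0r -(cfD ind) // addr0. Qed.

Lemma induced_ind (Q : P -> Prop) : (forall x y, Q x -> Q y -> Q (x + y)) ->
  (forall a b m, Q ((X ^+ a * Y ^+ b) *: xi m)) -> forall z, Q z.
Proof.
move=> QD QM z; have Q0 : Q 0 by rewrite -(scaler0 _ (X ^+ 0 * Y ^+ 0)) -xi0.
have [n ->] := cf_span ind z.
by apply: big_ind => // i _; apply: big_ind.
Qed.

Lemma cf_ext z : (forall i j, cf i j z = 0) -> z = 0.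
Proof.
move=> h; have [n ->] := cf_span ind z.
by rewrite big1 // => i _; rewrite big1 // => j _; rewrite h xi0 scaler0.
Qed.

Lemma cf_fin z : exists n, forall i j, (n <= i)%N || (n <= j)%N -> cf i j z = 0.
Proof.
elim/induced_ind: z => [x y [n hn] [n' hn']|a b m].
  exists (maxn n n') => i j; rewrite !geq_max => h.
  have [h1 h2] : (n <= i)%N || (n <= j)%N /\ (n' <= i)%N || (n' <= j)%N.
    by case/orP: h => /andP[-> ->]; rewrite ?orbT.
  by rewrite (cfD ind) hn // hn' // addr0.
exists (maxn a b).+1 => i j h; rewrite (cfE ind) //; case: ifP => // /andP[/eqP ia /eqP jb].
by move: h; rewrite ia jb !gtn_max !ltnn andbF.
Qed.

Lemma algZ (N : lmodType B) (c : k) (b : B) (z : N) :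
  c%:A *: (b *: z) = b *: (c%:A *: z).
Proof. by rewrite !scalerA mulr_algl mulr_algr. Qed.

(** A scalar in front of b moves to the vector, where it appears as an element of
    B: modules over B carry no separate scaling by k. *)
Lemma algZM (N : lmodType B) (c : k) (b : B) (z : N) :
  (c *: b) *: z = b *: (c%:A *: z).
Proof. by rewrite scalerA mulr_algr. Qed.

Lemma cfZ i j c z : cf i j (c%:A *: z) = c%:A *: cf i j z.
Proof.
elim/induced_ind: z => [x y IHx IHy|a b m].
  by rewrite scalerDr !(cfD ind) // IHx IHy scalerDr.
by rewrite algZ -(xiZ ind) // !(cfE ind) //; case: ifP => //; rewrite scaler0.
Qed.

Lemma cfN i j z : cf i j (- z) = - cf i j z.
Proof. by apply: (addIr (cf i j z)); rewrite -(cfD ind) // !addNr cf0. Qed.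

Lemma cfB i j x y : cf i j (x - y) = cf i j x - cf i j y.
Proof. by rewrite (cfD ind) // cfN. Qed.

(* rX sends b (x) m to bX (x) m and lX sends it to b (x) Xm; aug is the action
   map b (x) m -> bm. *)
Variables (rX lX rY lY : {linear P -> P}) (aug : {linear P -> M}).
Hypotheses (rXE : forall m, rX (xi m) = X *: xi m)
  (rYE : forall m, rY (xi m) = Y *: xi m)
  (lXE : forall m, lX (xi m) = xi (X *: m))
  (lYE : forall m, lY (xi m) = xi (Y *: m))
  (augE : forall m, aug (xi m) = m).

Lemma cf_rXS i j z : cf i.+1 j (rX z) = (p ^+ j)%:A *: cf i j z.
Proof.
elim/induced_ind: z => [x y IHx IHy|a b m].
  by rewrite linearD /= !(cfD ind) // IHx IHy scalerDr.
rewrite linZ rXE scalerA qp_monX algZM -(xiZ ind) !(cfE ind) eqSS.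
by case: ifP => [/andP[_ /eqP->]//|_]; rewrite scaler0.
Qed.

Lemma cf_rX0 j z : cf 0 j (rX z) = 0.
Proof.
elim/induced_ind: z => [x y IHx IHy|a b m].
  by rewrite linearD /= !(cfD ind) // IHx IHy addr0.
by rewrite linZ rXE scalerA qp_monX algZM -(xiZ ind) !(cfE ind).
Qed.

Lemma cf_rYS i j z : cf i j.+1 (rY z) = cf i j z.
Proof.
elim/induced_ind: z => [x y IHx IHy|a b m].
  by rewrite linearD /= !(cfD ind) // IHx IHy.
by rewrite linZ rYE scalerA -mulrA -exprSr !(cfE ind).
Qed.

Lemma cf_lX i j z : cf i j (lX z) = X *: cf i j z.
Proof.
elim/induced_ind: z => [x y IHx IHy|a b m].
  by rewrite linearD /= !(cfD ind) // IHx IHy scalerDr.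
by rewrite linZ lXE !(cfE ind) //; case: ifP; rewrite ?scaler0.
Qed.

Lemma cf_lY i j z : cf i j (lY z) = Y *: cf i j z.
Proof.
elim/induced_ind: z => [x y IHx IHy|a b m].
  by rewrite linearD /= !(cfD ind) // IHx IHy scalerDr.
by rewrite linZ lYE !(cfE ind) //; case: ifP; rewrite ?scaler0.
Qed.

Lemma rXlY z : rX (lY z) = lY (rX z).
Proof.
elim/induced_ind: z => [x y IHx IHy|a b m]; first by rewrite !linearD /= IHx IHy.
by rewrite !linZ lYE !rXE linZ lYE.
Qed.

Lemma rYlX z : rY (lX z) = lX (rY z).
Proof.
elim/induced_ind: z => [x y IHx IHy|a b m]; first by rewrite !linearD /= IHx IHy.
by rewrite !linZ lXE !rYE linZ lXE.
Qed.

Lemma rXrY z : rX (rY z) = p%:A *: rY (rX z).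
Proof.
elim/induced_ind: z => [x y IHx IHy|a b m].
  by rewrite !linearD /= IHx IHy scalerDr.
by rewrite !(linZ, rXE, rYE) !algZ (scalerA Y X) (qp_comm qp) algZM (scalerA X Y).
Qed.

Lemma lYlX z : lY (lX z) = p%:A *: lX (lY z).
Proof.
elim/induced_ind: z => [x y IHx IHy|a b m].
  by rewrite !linearD /= IHx IHy scalerDr.
rewrite !(linZ, lXE, lYE) algZ -(xiZ ind) //; congr (_ *: xi _).
by rewrite scalerA (qp_comm qp) algZM !algZ scalerA.
Qed.

Lemma augrX z : aug (rX z) = aug (lX z).
Proof.
elim/induced_ind: z => [x y IHx IHy|a b m]; first by rewrite !linearD /= IHx IHy.
by rewrite !(linZ, rXE, lXE) !augE.
Qed.

Lemma augrY z : aug (rY z) = aug (lY z).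
Proof.
elim/induced_ind: z => [x y IHx IHy|a b m]; first by rewrite !linearD /= IHx IHy.
by rewrite !(linZ, rYE, lYE) !augE.
Qed.

(** The Koszul complex of M.  The factors p in the second map compensate the two
    commutation rules rX rY = p rY rX and lY lX = p lX lY, which have opposite
    orders; all other pairs of r and l commute. *)
Definition koszul1 (fg : P * P) : P := rX fg.1 - lX fg.1 + (rY fg.2 - lY fg.2).
Definition koszul2 (h : P) : P * P := (rY h - p%:A *: lY h, lX h - p%:A *: rX h).

Fact koszul1_linear : linear koszul1.
Proof.
move=> c [f g] [f' g']; rewrite /koszul1 /= !linearP /=.
by rewrite (addrACA (c *: rX f)) (addrACA (c *: rY g)) [LHS]addrACA -!scalerDr.
Qed.

Fact koszul2_linear : linear koszul2.
Proof.
move=> c h h'; rewrite /koszul2; apply: injective_projections => /=.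
  by rewrite !linearP /= scalerDr (algZ p c) opprD addrACA -scalerBr.
by rewrite !linearP /= scalerDr (algZ p c) opprD addrACA -scalerBr.
Qed.

HB.instance Definition _ :=
  GRing.isLinear.Build B (P * P)%type P *:%R koszul1 koszul1_linear.
HB.instance Definition _ :=
  GRing.isLinear.Build B P (P * P)%type *:%R koszul2 koszul2_linear.

Lemma koszul12 h : koszul1 (koszul2 h) = 0.
Proof.
rewrite /koszul1 /koszul2 /= !linearB /=.
rewrite (linZ rX) (linZ lX) (linZ rY) (linZ lY) rXrY lYlX rXlY rYlX !opprK.
apply/eqP; rewrite addr_eq0 !opprD !opprK addrACA.
by rewrite (addrC (p%:A *: rY _)) (addrC (- (p%:A *: lY _))).
Qed.

Lemma koszul_aug fg : aug (koszul1 fg) = 0.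
Proof. by rewrite /koszul1 linearD !linearB /= augrX augrY !subrr addr0. Qed.

(** rY raises the degree in Y by one while lY preserves it, so division by
    rY - c lY leaves a remainder of degree 0 in Y. *)
Lemma divY (c : k) z : exists h z0,
  z = rY h - c%:A *: lY h + z0 /\ forall i j, cf i j.+1 z0 = 0.
Proof.
elim/induced_ind: z => [x y [h [x0 [-> hx]]] [h' [y0 [-> hy]]]|a b m].
  exists (h + h'), (x0 + y0); split=> [|i j]; last by rewrite (cfD ind) hx hy addr0.
  by rewrite !linearD /= scalerDr opprD [LHS]addrACA (addrACA (rY h)).
elim: b m => [|b IH] m.
  exists 0, ((X ^+ a * Y ^+ 0) *: xi m); split=> [|i j]; last by rewrite (cfE ind) andbF.
  by rewrite (linear0 rY) (linear0 lY) scaler0 subrr add0r.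
have [h [z0 [e hz]]] := IH (c%:A *: (Y *: m)).
exists ((X ^+ a * Y ^+ b) *: xi m + h), z0; split=> //.
rewrite !linearD /= scalerDr opprD [X in _ = X + _]addrACA -[RHS]addrA -e (linZ rY) (linZ lY) rYE lYE.
by rewrite (xiZ ind) algZ subrK scalerA -mulrA -exprSr.
Qed.

(** The same division by rX - lX, among the elements of degree 0 in Y. *)
Lemma divX z : (forall i j, cf i j.+1 z = 0) -> exists h m, z = rX h - lX h + xi m.
Proof.
move=> z0; have [n ->] := cf_span ind z.
pose Q z := exists h m, z = rX h - lX h + xi m.
have Q0 : Q 0.
  by exists 0, 0; rewrite (linear0 rX) (linear0 lX) subrr add0r xi0.
have QD x y : Q x -> Q y -> Q (x + y).
  move=> [h [m ->]] [h' [m' ->]]; exists (h + h'), (m + m').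
  by rewrite !linearD /= (xiD ind) [LHS]addrACA (addrACA (rX h)).
apply: (big_ind Q) => // i _; apply: (big_ind Q) => // j _.
case: j => [[|j] _] /=; last by rewrite z0 xi0 scaler0.
move: (cf _ _ _) => m; rewrite expr0 mulr1.
elim: (i : nat) m => [|a IH] m.
  by exists 0, m; rewrite (linear0 rX) (linear0 lX) subrr add0r expr0 scale1r.
have [h [m' e]] := IH (X *: m).
exists (X ^+ a *: xi m + h), m'.
rewrite !linearD /= [X in _ = X + _]addrACA -[RHS]addrA -e (linZ rX) (linZ lX) rXE lXE.
by rewrite subrK scalerA -exprSr.
Qed.

(** Downward induction along a recursion, from indices where u vanishes. *)
Lemma descent (u : nat -> M) (T : M -> M) : T 0 = 0 ->
  (forall i, u i = T (u i.+1)) -> (exists n, forall i, (n <= i)%N -> u i = 0) ->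
  forall i, u i = 0.
Proof.
move=> T0 uT [n un] i; have [/un//|/ltnW ni] := leqP n i.
rewrite -(subKn ni); elim: (n - i)%N => [|d IH]; first by rewrite subn0 un.
have [dn|nd] := ltnP d n; first by rewrite uT subnSK // IH T0.
by move: IH; rewrite (eqnP nd) (eqnP (leqW nd)).
Qed.

(** The hypothesis expresses each coefficient as c Y times the next one in the
    direction of Y, and those of high degree vanish. *)
Lemma divY_inj (c : k) z : (forall i j, cf i j.+1 (rY z - c%:A *: lY z) = 0) -> z = 0.
Proof.
move=> h; apply: cf_ext => i; apply: (@descent _ (fun m => c%:A *: (Y *: m))).
- by rewrite !scaler0.
- move=> j; have /eqP := h i j; rewrite cfB cfZ cf_rYS cf_lY subr_eq0.
  by move/eqP.
- have [n hn] := cf_fin z; exists n => j nj; apply: hn; rewrite nj orbT //.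
Qed.

Lemma koszul2_inj h : koszul2 h = 0 -> h = 0.
Proof.
move/(congr1 fst) => /= e; apply: (@divY_inj p) => i j.
by rewrite e cf0.
Qed.

(** Subtracting a boundary makes the first component f0 of degree 0 in Y.  The
    part of positive degree in Y of the cycle equation then involves only the
    second component and kills it by [divY_inj]; what remains of the equation
    kills f0 by descent on the degree in X. *)
Lemma koszul_exact1 fg : koszul1 fg = 0 -> exists h, fg = koszul2 h.
Proof.
case: fg => f g e; have [h [f0 [ef hf]]] := divY p f.
exists h; pose g' := g - (lX h - p%:A *: rX h).
have efg : koszul1 (f0, g') = 0.
  have -> : (f0, g') = (f, g) - koszul2 h.
    by apply: injective_projections; rewrite /= // ef addrC addKr.
  by rewrite linearB /= e koszul12 subr0.
have g'0 : g' = 0.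
  apply: (@divY_inj 1) => i j; have /(congr1 (cf i j.+1)) := efg.
  rewrite /koszul1 /= cf0 (cfD ind) cfB cf_lX hf scaler0 subr0 !scale1r => <-.
  case: i => [|i]; first by rewrite cf_rX0 add0r.
  by rewrite cf_rXS hf scaler0 add0r.
have f00 : f0 = 0.
  move: efg; rewrite g'0 /koszul1 /= (linear0 rY) (linear0 lY) subrr addr0 => /eqP.
  rewrite subr_eq0 => /eqP e0; apply: cf_ext => i [|j]; last exact: hf.
  move: i; apply: (@descent _ (fun m => X *: m)); first by rewrite scaler0.
    by move=> i; rewrite -cf_lX -e0 cf_rXS expr0 !scale1r.
  by have [n hn] := cf_fin f0; exists n => j nj; apply: hn; rewrite nj.
apply: injective_projections => /=; first by rewrite ef f00 addr0.
by apply/eqP; rewrite -subr_eq0; apply/eqP.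
Qed.

(** Dividing by rY - lY and then by rX - lX leaves a remainder xi m, on which the
    augmentation is m. *)
Lemma koszul_exact0 z : aug z = 0 -> exists fg, z = koszul1 fg.
Proof.
have [g [z0 [-> hz]]] := divY 1 z; have [f [m ->]] := divX hz.
rewrite scale1r scale1r !linearD !linearN /= augrX augrY augE !subrr !add0r => ->.
by exists (f, g); rewrite /koszul1 /= xi0 addr0 addrC.
Qed.

End Induced.
End QuantumPlane.

(** * The Koszul resolution of an arbitrary module *)

Section MoreModules.
Variable A : nzRingType.

Lemma projective_pair (P Q : lmodType A) :
  projective P -> projective Q -> projective (P * Q)%type.
Proof.
move=> hP hQ M N p f ps.
have fP : linear (fun x : P => f (x, 0)).
  by move=> c x y; rewrite -linearP; congr (f (_, _)); rewrite /= scaler0 addr0.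
have fQ : linear (fun y : Q => f (0, y)).
  by move=> c x y; rewrite -linearP; congr (f (_, _)); rewrite /= scaler0 addr0.
have [g gE] := hP M N p (mk_linear fP) ps.
have [h hE] := hQ M N p (mk_linear fQ) ps.
have gh : linear (fun xy : P * Q => g xy.1 + h xy.2).
  by move=> c x y; rewrite !linearP /= addrACA -scalerDr.
exists (mk_linear gh) => -[x y] /=; rewrite linearD /= gE hE /= -linearD.
by congr (f (_, _)); rewrite /= ?addr0 ?add0r.
Qed.

Definition zero_module : lmodType A := 'rV[A]_0.

Lemma zero_moduleE (x : zero_module) : x = 0.
Proof. exact: thinmx0. Qed.

Fact zero_map_linear (P Q : lmodType A) : linear (fun _ : P => 0 : Q).
Proof. by move=> c x y; rewrite scaler0 addr0. Qed.

Definition zero_map (P Q : lmodType A) : {linear P -> Q} :=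
  mk_linear (@zero_map_linear P Q).

Lemma zero_projective : projective zero_module.
Proof.
move=> M N p f _; exists (zero_map _ _) => x.
by rewrite [x]zero_moduleE !linear0.
Qed.

Lemma regular_projective : projective A^o.
Proof.
move=> M N p f ps; have [y yE] := ps (f 1).
have L : linear (fun b : A^o => (b : A) *: y).
  by move=> c b b'; rewrite scalerDl scalerA.
exists (mk_linear L) => b /=.
by rewrite linZ yE -linZ; congr (f _); rewrite -[RHS]mulr1.
Qed.

End MoreModules.

Section Resolution.
Variables (k : fieldType) (B : algType k) (X Y : B) (p : k) (dx dy : nat).
Variable gr : nat -> set B.
Hypothesis qp : quantum_plane X Y p dx dy gr.
Local Notation coef := (qp_coef qp).

Lemma qp_coefZ i j c x : coef i j (c *: x) = c * (coef i j x : k).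
Proof. exact: linearZ. Qed.

Section KoszulResolution.
Variables (M P : lmodType B) (xi : M -> P) (cf : nat -> nat -> P -> M).
Hypothesis ind : induced X Y xi cf.
Variables (rX lX rY lY : {linear P -> P}) (aug : {linear P -> M}).
Hypotheses (rXE : forall m, rX (xi m) = X *: xi m)
  (rYE : forall m, rY (xi m) = Y *: xi m)
  (lXE : forall m, lX (xi m) = xi (X *: m))
  (lYE : forall m, lY (xi m) = xi (Y *: m))
  (augE : forall m, aug (xi m) = m).

Definition koszul_obj (n : nat) : lmodType B :=
  match n with 0 => P | 1 => (P * P)%type | 2 => P | _ => zero_module B end.

Definition koszul_d (n : nat) : {linear koszul_obj n.+1 -> koszul_obj n} :=
  match n with
  | 0 => koszul1 rX lX rY lY
  | 1 => koszul2 p rX lX rY lY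
  | n.+2 => zero_map _ _
  end.

Definition koszul_resolution : proj_resolution M.
Proof.
refine (@ProjResolution _ M koszul_obj koszul_d aug _ _ _ _).
- have pP := induced_projective ind.
  case=> [|[|[|n]]] //=; [exact: projective_pair|exact: zero_projective].
- by move=> m; exists (xi m).
- move=> x; split=> [|[y ->]]; last first.
    exact: (koszul_aug ind rXE rYE lXE lYE augE).
  exact: (koszul_exact0 ind rXE rYE lXE lYE augE).
- case=> [|[|n]] x /=; split.
  + exact: (koszul_exact1 qp ind rXE rYE lXE lYE).
  + by move=> [y ->]; exact: (koszul12 qp ind rXE rYE lXE lYE).
  + by move/(koszul2_inj ind rYE lYE) => ->; exists 0.
  + by move=> [y ->]; rewrite linear0.
  + by move=> _; exists 0; rewrite [x]zero_moduleE.
  + by [].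
Defined.

End KoszulResolution.

Lemma qp_span_big b : exists n, forall N, (n <= N)%N ->
  b = \sum_(i < N) \sum_(j < N) coef i j b *: (X ^+ i * Y ^+ j).
Proof.
elim/(qp_ind qp): b => [x y [n hn] [n' hn']|c a b].
  exists (maxn n n') => N; rewrite geq_max => /andP[/hn ex /hn' ey].
  rewrite {1}ex {1}ey -big_split /=; apply: eq_bigr => i _.
  rewrite -big_split /=; apply: eq_bigr => j _.
  by rewrite linearD /= scalerDl.
exists (maxn a b).+1 => N; rewrite gtn_max => /andP[aN bN].
rewrite (bigD1 (Ordinal aN)) //= (bigD1 (Ordinal bN)) //= qp_coefZ qp_coefE !eqxx.
rewrite [X in _ + X + _]big1 => [|j /negbTE jb]; last first.
  by rewrite qp_coefZ qp_coefE eqxx /= -[_ == b]/(j == Ordinal bN) jb mulr0 scale0r.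
rewrite big1 => [|i /negbTE ia]; first by rewrite !addr0 mulr1.
rewrite big1 // => j _; rewrite qp_coefZ qp_coefE.
by rewrite -[_ == a]/(i == Ordinal aN) ia mulr0 scale0r.
Qed.

Section FreeSum.
Variables (K : choiceType) (V : zmodType) (h : K -> B -> V).
Hypothesis hD : forall e x y, h e (x + y) = h e x + h e y.

(** The supports of z, z' and z + z' differ, but all three sums may be taken over
    the union of the first two, since h vanishes at 0. *)
Lemma free_sumD (z z' : free_module B K) :
  \sum_(e <- dom (z + z')) h e (free_coef e (z + z')) =
  \sum_(e <- dom z) h e (free_coef e z) + \sum_(e <- dom z') h e (free_coef e z').
Proof.
have h0 e : h e 0 = 0 by apply: (addIr (h e 0)); rewrite -hD !add0r.
have sumE (s : seq K) (x : free_module B K) : uniq s -> {subset dom x <= s} ->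
    \sum_(e <- dom x) h e (free_coef e x) = \sum_(e <- s) h e (free_coef e x).
  move=> us sub; rewrite [RHS](bigID (mem (dom x))) /= [X in _ = _ + X]big1 ?addr0.
    rewrite -[RHS]big_filter; apply: perm_big; apply: uniq_perm.
    - exact: uniq_dom.
    - exact: filter_uniq.
    - by move=> e; rewrite mem_filter /=; case: (boolP (e \in dom x)) => // /sub ->.
  by move=> e /coeff_outdom xe; rewrite /free_coef xe h0.
pose s := undup (dom z ++ dom z').
have us : uniq s by exact: undup_uniq.
rewrite (sumE s z) // ?(sumE s z') // ?(sumE s (z + z')) //.
- by rewrite -big_split /=; apply: eq_bigr => e _; rewrite -hD /free_coef coeffD.
- by move=> e /domD_subset; rewrite mem_undup.
- by move=> e ez; rewrite mem_undup mem_cat ez orbT.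
- by move=> e ez; rewrite mem_undup mem_cat ez.
Qed.

Lemma free_sumU (b : B) (e : K) :
  \sum_(e' <- dom (b *: free_gen B e)) h e' (free_coef e' (b *: free_gen B e)) =
  h e b.
Proof.
have h0 e' : h e' 0 = 0 by apply: (addIr (h e' 0)); rewrite -hD !add0r.
have cE e' : free_coef e' (b *: free_gen B e) = b * (e == e')%:R.
  by rewrite /free_coef /free_gen coeffZ coeffU mul1r.
have [b0|b0] := eqVneq b 0.
  by rewrite b0 scale0r dom0 big_nil h0.
have -> : b *: free_gen B e = << b *g e >>.
  by apply/eqP/freeg_eqP => y; rewrite coeffZ !coeffU mul1r.
rewrite domU // big_seq1; congr (h _ _).
by rewrite /free_coef coeffU eqxx mulr1.
Qed.

End FreeSum.

(** P is the free B-module on a k-basis of M. *)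
Lemma induced_exists (M : lmodType B) :
  exists (P : lmodType B) (xi : M -> P) (cf : nat -> nat -> P -> M),
    induced X Y xi cf.
Proof.
pose V : lmodType k := restricted M.
have [|K [e [crd [crdK _ crdE]]]] := @complement_basis k V (fun x => x = 0) erefl.
  by move=> c x y -> ->; rewrite scaler0 addr0.
have {}crdK x : x = free_lift e (crd x) by apply/eqP; rewrite -subr_eq0; apply/eqP.
have basis_ext (W : lmodType k) (f g : V -> W) : linear f -> linear g ->
    (forall j, f (e j) = g (e j)) -> f =1 g.
  move=> fL gL fg x; rewrite [x]crdK free_liftED.
  elim: (dom _) => [|j s IH]; last by rewrite big_cons fL gL IH fg.
  rewrite big_nil; have z h (hL : linear h) : h (0 : V) = 0 :> W.
    by apply: (addIr (h 0)); rewrite add0r -{1}[h 0]scale1r -hL scaler0 add0r.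
  by rewrite !z.
pose P := free_module B K.
pose xi (m : V) : restricted P := free_lift (fun j => free_gen B j : restricted P) (crd m).
have xiE j : xi (e j) = free_gen B j by rewrite /xi crdE free_liftE.
have xiL : linear xi by move=> c x y; rewrite /xi !linearP.
pose h i j l (b : B) : V := (coef i j b : k) *: e l.
have hD i j l x y : h i j l (x + y) = h i j l x + h i j l y.
  by rewrite /h linearD /= scalerDl.
pose cf i j (z : P) : V := \sum_(l <- dom z) h i j l (free_coef l z).
have cfD i j x y : cf i j (x + y) = cf i j x + cf i j y.
  by apply: free_sumD; exact: hD.
have cfU i j b l : cf i j (b *: free_gen B l) = h i j l b.
  by apply: free_sumU; exact: hD.
have xiD (x y : M) : xi (x + y) = xi x + xi y :> P.
  by have := xiL 1 x y; rewrite !scale1r.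
have xi0 : xi 0 = 0 by apply: (addIr (xi 0)); rewrite add0r -[LHS]xiD addr0.
have xiZ (c : k) (x : M) : xi (c%:A *: x) = c%:A *: (xi x : P) :> P.
  by have := xiL c x 0; rewrite xi0 !addr0.
have P_ind (Q : P -> Prop) : Q 0 -> (forall x y, Q x -> Q y -> Q (x + y)) ->
    (forall b l, Q (b *: free_gen B l)) -> forall z, Q z.
  by move=> Q0 QD Qg z; rewrite [z]free_moduleE; apply: big_ind.
have cf0 i j : cf i j 0 = 0 by apply: (addIr (cf i j 0)); rewrite add0r -cfD addr0.
have cfZ i j (c : k) (z : P) : cf i j (c%:A *: z) = c *: cf i j z.
  elim/P_ind: z => [|x y IHx IHy|b l]; first by rewrite scaler0 cf0 scaler0.
    by rewrite scalerDr !cfD IHx IHy scalerDr.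
  by rewrite scalerA mulr_algl !cfU /h qp_coefZ scalerA.
have cfxi i j (b : B) (m : V) : cf i j (b *: (xi m : P)) = (coef i j b : k) *: m.
  pose f1 (m : V) : V := cf i j (b *: (xi m : P)).
  pose f2 (m : V) : V := (coef i j b : k) *: m.
  apply: (@basis_ext V f1 f2) m => [c x y|c x y|l]; rewrite /f1 /f2.
  + by rewrite xiL scalerDr cfD rscaleE -algZ cfZ.
  + by rewrite scalerDr !scalerA mulrC.
  + by rewrite xiE cfU.
exists P, xi, cf; split => //.
- by move=> i j a b m; rewrite cfxi qp_coefE; case: ifP; rewrite ?scale1r ?scale0r.
- pose S N (z : P) : P := \sum_(i < N) \sum_(j < N)
    (X ^+ i * Y ^+ j) *: (xi (cf i j z) : P).
  have SD N x y : S N (x + y) = S N x + S N y.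
    rewrite /S -big_split; apply: eq_bigr => i _.
    rewrite -big_split /=; apply: eq_bigr => j _.
    by rewrite cfD xiD scalerDr.
  have S0 N : S N 0 = 0 by apply: (addIr (S N 0)); rewrite add0r -SD addr0.
  suff big z : exists n, forall N, (n <= N)%N -> z = S N z.
    by move=> z; have [n /(_ n (leqnn n))] := big z; exists n.
  elim/P_ind: z => [|x y [n hn] [n' hn']|b l]; first by exists 0%N => N _; rewrite S0.
    exists (maxn n n') => N; rewrite geq_max => /andP[/hn ex /hn' ey].
    by rewrite SD -ex -ey.
  have [n hn] := qp_span_big b; exists n => N /hn {1}->.
  rewrite scaler_suml /S; apply: eq_bigr => i _.
  rewrite scaler_suml; apply: eq_bigr => j _.
  rewrite cfU /h.
  have -> : xi ((coef i j b : k) *: e l) = (coef i j b : k)%:A *: (free_gen B l : P).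
    by rewrite -xiE -xiZ.
  by rewrite algZM.
- exact: free_projective.
- move=> N f fD fZ; exists (free_lift (f \o e)) => m.
  pose f1 (m : V) : restricted N := free_lift (f \o e) (xi m).
  pose f2 (m : V) : restricted N := f m.
  apply: (@basis_ext (restricted N) f1 f2) m => [c x y|c x y|l]; rewrite /f1 /f2.
  + have -> : xi (c *: x + y) = c%:A *: (xi x : P) + (xi y : P) :> P by exact: xiL.
    by rewrite linearD /= linZ.
  + by rewrite fD; congr (_ + _); exact: fZ.
  + by rewrite xiE free_liftE.
Qed.

Lemma induced_projdim (M P : lmodType B) (xi : M -> P) (cf : nat -> nat -> P -> M) :
  induced X Y xi cf -> projdim_le M 2.
Proof.
move=> ind.
have smulD (b : B) (N : lmodType B) (x y : N) : b *: (x + y) = b *: x + b *: y.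
  exact: scalerDr.
have rex (b : B) : exists r : {linear P -> P}, forall m, r (xi m) = b *: xi m.
  apply: (induced_univ ind) => [x y|c x]; first by rewrite (xiD ind) scalerDr.
  by rewrite (xiZ ind) algZ.
have lex (b : B) : exists l : {linear P -> P}, forall m, l (xi m) = xi (b *: m).
  apply: (induced_univ ind) => [x y|c x]; first by rewrite scalerDr (xiD ind).
  by rewrite -algZ (xiZ ind).
have [aug augE] : exists aug : {linear P -> M}, forall m, aug (xi m) = m.
  by apply: (induced_univ ind).
have [[rX rXE] [rY rYE]] := (rex X, rex Y).
have [[lX lXE] [lY lYE]] := (lex X, lex Y).
exists (koszul_resolution ind rXE rYE lXE lYE augE).
by case=> [|[|[|j]]] // _ x; exact: zero_moduleE.
Qed.

Lemma qp_gldim_le : gldim_le B 2.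
Proof.
move=> M; have [P [xi [cf ind]]] := induced_exists M.
exact: induced_projdim ind.
Qed.

End Resolution.

(** * Gradings and coefficients of a quantum plane *)

Section Gradings.

(** A grading given by its projections.  In this form products and shifts of
    gradings are immediate. *)
Record projections (I : choiceType) (M : zmodType) (G : I -> set M)
    (pr : I -> M -> M) : Prop := Projections {
  prB : forall i x y, pr i (x - y) = pr i x - pr i y;
  pr_id : forall i x, G i x -> pr i x = x;
  pr_ne : forall i j x, G i x -> j != i -> pr j x = 0;
  pr_in : forall i x, G i (pr i x);
  pr_sum : forall x, exists s, [/\ uniq s, x = \sum_(i <- s) pr i x &
                                 forall i, i \notin s -> pr i x = 0]
}.

Lemma projections_grading (I : choiceType) (M : zmodType) (G : I -> set M) pr :
  projections G pr -> is_grading G.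
Proof.
move=> h; have pr0 i : pr i 0 = 0 by have := prB h i 0 0; rewrite !subrr.
have prD i x y : pr i (x + y) = pr i x + pr i y.
  have prN : pr i (- y) = - pr i y by rewrite -sub0r (prB h) pr0 sub0r.
  by rewrite -{1}[y]opprK (prB h) prN opprK.
split=> [i|x|s f us Gf s0 i si].
- split; first by rewrite -(pr0 i); exact: (pr_in h).
  by move=> x y Gx Gy; rewrite -(pr_id h Gx) -(pr_id h Gy) -(prB h); exact: (pr_in h).
- have [s [us xs _]] := pr_sum h x; exists s, (pr^~ x); split=> // i.
  exact: (pr_in h).
- have : pr i (\sum_(j <- s) f j) = 0 by rewrite s0 pr0.
  rewrite (bigD1_seq i) //= prD (pr_id h (Gf i)).
  rewrite (big_morph (pr i) (prD i) (pr0 i)) big1 ?addr0 // => j ji.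
  by rewrite (pr_ne h (Gf j)) // eq_sym.
Qed.

Lemma projections_pair (I : choiceType) (M N : zmodType) (G : I -> set M)
    (G' : I -> set N) pr pr' : projections G pr -> projections G' pr' ->
  projections (fun i (x : M * N) => G i x.1 /\ G' i x.2)
              (fun i (x : M * N) => (pr i x.1, pr' i x.2)).
Proof.
move=> h h'; split=> [i [x x'] [y y']|i [x x'] [] /= Gx Gx'|i j [x x'] [] /= Gx Gx' ij
  |i [x x']|[x x']] /=.
- by rewrite (prB h) (prB h').
- by rewrite (pr_id h) ?(pr_id h').
- by rewrite (pr_ne h Gx) ?(pr_ne h' Gx').
- by split; [exact: (pr_in h)|exact: (pr_in h')].
have [s [us xs s0]] := pr_sum h x; have [s' [us' xs' s0']] := pr_sum h' x'.
have sumE (V : zmodType) (f : I -> V) (r t : seq I) : uniq r -> uniq t ->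
    {subset r <= t} -> (forall i, i \notin r -> f i = 0) ->
    \sum_(i <- r) f i = \sum_(i <- t) f i.
  move=> ur ut rt f0; rewrite [RHS](bigID (mem r)) /= [X in _ = _ + X]big1 ?addr0 //.
  rewrite -[RHS]big_filter; apply: perm_big; apply: uniq_perm => //.
    exact: filter_uniq.
  by move=> i; rewrite mem_filter /=; case: (boolP (i \in r)) => // /rt ->.
pose t := undup (s ++ s').
have ut : uniq t by exact: undup_uniq.
have st : {subset s <= t} by move=> i si; rewrite mem_undup mem_cat si.
have st' : {subset s' <= t} by move=> i si; rewrite mem_undup mem_cat si orbT.
exists t; split=> // [|i].
  apply: injective_projections.
    by rewrite (big_morph fst (id1 := 0) (op1 := +%R)) //= {1}xs; apply: sumE.
  by rewrite (big_morph snd (id1 := 0) (op1 := +%R)) //= {1}xs'; apply: sumE.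
by rewrite mem_undup mem_cat negb_or => /andP[/s0 -> /s0' ->].
Qed.

Lemma projections_shift (M : zmodType) (G : int -> set M) pr (d : int) :
  projections G pr -> projections (fun i => G (i - d)) (fun i => pr (i - d)).
Proof.
move=> h; split=> [i x y|i x|i j x Gx ij|i x|x]; rewrite ?(prB h) //.
- exact: (pr_id h).
- by apply: (pr_ne h Gx); apply: contraNneq ij => /addIr ->.
- exact: (pr_in h).
have [s [us xs s0]] := pr_sum h x; exists (map (fun i => i + d) s); split=> [||i].
- by rewrite map_inj_uniq //; exact: addIr.
- by rewrite big_map {1}xs; apply: eq_bigr => i _; rewrite addrK.
- by move=> ids; apply: s0; apply: contra ids => /(map_f (fun i => i + d)); rewrite subrK.
Qed.

End Gradings.

Section Regular.
Variables (k : fieldType) (B : algType k) (X Y : B) (p : k) (dx dy : nat).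
Variable gr : nat -> set B.
Hypothesis qp : quantum_plane X Y p dx dy gr.
Local Notation coef := (qp_coef qp).
Local Notation deg i j := (dx * i + dy * j)%N.

Lemma coef_Xl0 j b : coef 0 j (X * b) = 0.
Proof.
elim/(qp_ind qp): b => [x y hx hy|c a b]; first by rewrite mulrDr linearD /= hx hy addr0.
by rewrite -scalerAr mulrA -exprS qp_coefZ qp_coefE mulr0.
Qed.

Lemma coef_XlS i j b : coef i.+1 j (X * b) = coef i j b.
Proof.
elim/(qp_ind qp): b => [x y hx hy|c a b]; first by rewrite mulrDr !linearD /= hx hy.
by rewrite -scalerAr mulrA -exprS !qp_coefZ !qp_coefE eqSS.
Qed.

Lemma qp_Ymon a b : Y * (X ^+ a * Y ^+ b) = p ^+ a *: (X ^+ a * Y ^+ b.+1).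
Proof. by have := qp_monM qp 0 1 a b; rewrite expr1 expr0 mul1r mul1n. Qed.

Lemma coef_Yl0 i b : coef i 0 (Y * b) = 0.
Proof.
elim/(qp_ind qp): b => [x y hx hy|c a b]; first by rewrite mulrDr linearD /= hx hy addr0.
by rewrite -scalerAr qp_Ymon !qp_coefZ qp_coefE andbF !mulr0.
Qed.

Lemma coef_YlS i j b : coef i j.+1 (Y * b) = p ^+ i * (coef i j b : k).
Proof.
elim/(qp_ind qp): b => [x y hx hy|c a b].
  by rewrite mulrDr !linearD /= hx hy -mulrDr.
rewrite -scalerAr qp_Ymon !qp_coefZ !qp_coefE eqSS.
by case: eqVneq => [->|_] /=; rewrite ?mulr0 // mulrCA.
Qed.

Lemma coef_fin b : exists n, forall i j, coef i j b != 0 -> (i < n)%N && (j < n)%N.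
Proof.
elim/(qp_ind qp): b => [x y [n hn] [n' hn']|c a b].
  exists (maxn n n') => i j; have [x0|/hn] := eqVneq (coef i j x) 0; last first.
    by move=> /andP[? ?] _; lia.
  by rewrite linearD /= x0 add0r => /hn'; lia.
exists (maxn a b).+1 => i j; rewrite qp_coefZ qp_coefE.
case: (eqVneq i a) => [->|_]; last by rewrite mulr0 eqxx.
case: (eqVneq j b) => [->|_]; last by rewrite mulr0 eqxx.
move=> _; lia.
Qed.

Lemma coef_filter (Q : nat -> nat -> bool) b : exists b', forall i j,
  coef i j b' = if Q i j then coef i j b else 0.
Proof.
elim/(qp_ind qp): b => [x y [x' hx] [y' hy]|c a b].
  by exists (x' + y') => i j; rewrite !linearD /= hx hy; case: ifP; rewrite ?addr0.
exists (if Q a b then c *: (X ^+ a * Y ^+ b) else 0) => i j.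
case: ifP => Qab; rewrite ?linear0 ?qp_coefZ ?qp_coefE; case: (eqVneq i a) => [->|_] //=.
- by case: (eqVneq j b) => [->|_]; rewrite ?Qab ?mulr0 // if_same.
- by rewrite mulr0 if_same.
- by case: (eqVneq j b) => [->|_]; rewrite ?Qab ?mulr0 // if_same.
- by rewrite mulr0 if_same.
Qed.

(** Division by X on the left, dropping the remainder. *)
Lemma coef_unshiftX b : exists b', forall i j, coef i j b' = coef i.+1 j b.
Proof.
elim/(qp_ind qp): b => [x y [x' hx] [y' hy]|c [|a] b].
- by exists (x' + y') => i j; rewrite !linearD /= hx hy.
- by exists 0 => i j; rewrite linear0 qp_coefZ qp_coefE mulr0.
- by exists (c *: (X ^+ a * Y ^+ b)) => i j; rewrite !qp_coefZ !qp_coefE eqSS.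
Qed.

(** Division by Y of the part of b that contains no X. *)
Lemma coef_unshiftY b : exists b', forall i j,
  coef i j b' = if i == 0 then coef 0 j.+1 b else 0.
Proof.
elim/(qp_ind qp): b => [x y [x' hx] [y' hy]|c a [|b]].
- by exists (x' + y') => i j; rewrite !linearD /= hx hy; case: ifP; rewrite ?addr0.
- by exists 0 => i j; rewrite linear0 qp_coefZ qp_coefE andbF mulr0 if_same.
exists (if a == 0 then c *: (X ^+ a * Y ^+ b) else 0) => i j.
rewrite qp_coefZ qp_coefE eqSS eq_sym; case: eqVneq => [->|an0] /=.
  by rewrite qp_coefZ qp_coefE; case: eqVneq => //=; rewrite mulr0.
by rewrite linear0 mulr0 if_same.
Qed.

Lemma grZE t b : grZ gr t b <->
  forall i j, (deg i j)%:Z != t -> coef i j b = 0.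
Proof.
case: t => [n|n] /=.
  rewrite (qp_gr qp); split=> h i j d; apply: h; first by [].
  by [].
split=> [-> i j _|h]; first by rewrite linear0.
by change (b = 0); apply: (@qp_ext _ _ _ _ _ _ _ _ qp b 0) => i j; rewrite h // linear0.
Qed.

Lemma grZ0 t : grZ gr t 0.
Proof. by apply/grZE => i j _; rewrite linear0. Qed.

Lemma grZD t x y : grZ gr t x -> grZ gr t y -> grZ gr t (x + y).
Proof.
move=> /grZE hx /grZE hy; apply/grZE => i j d.
by rewrite linearD /= hx // hy // addr0.
Qed.

Lemma grZZ t c x : grZ gr t x -> grZ gr t (c *: x).
Proof. by move=> /grZE hx; apply/grZE => i j d; rewrite qp_coefZ hx // mulr0. Qed.

Lemma grZmon a b : grZ gr (deg a b)%:Z (X ^+ a * Y ^+ b).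
Proof.
apply/grZE => i j d; rewrite qp_coefE; case: eqVneq => //= ia.
by case: eqVneq => //= jb; move: d; rewrite ia jb eqxx.
Qed.

Lemma grZ_ind t (Q : B -> Prop) : Q 0 -> (forall x y, Q x -> Q y -> Q (x + y)) ->
    (forall c a b, (deg a b)%:Z = t -> Q (c *: (X ^+ a * Y ^+ b))) ->
  forall x, grZ gr t x -> Q x.
Proof.
move=> Q0 QD QM x /grZE hx; have [n ->] := qp_span qp x.
apply: (big_ind Q) => // i _; apply: (big_ind Q) => // j _.
have [d|d] := eqVneq (deg i j)%:Z t; first exact: QM.
by rewrite hx // scale0r.
Qed.

Lemma grZM s t x y : grZ gr s x -> grZ gr t y -> grZ gr (s + t) (x * y).
Proof.
move=> gx; elim/grZ_ind => [|y1 y2 h1 h2|c a b e].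
- by rewrite mulr0; exact: grZ0.
- by rewrite mulrDr; exact: grZD.
rewrite -scalerAr; apply: grZZ; elim/grZ_ind: gx => [|x1 x2 h1 h2|c' a' b' e'].
- by rewrite mul0r; exact: grZ0.
- by rewrite mulrDl; exact: grZD.
rewrite -scalerAl (qp_monM qp); do 2!apply: grZZ.
have -> : s + t = (deg (a' + a) (b' + b))%:Z by lia.
exact: grZmon.
Qed.

Lemma grZX : grZ gr dx X.
Proof.
have := grZmon 1 0; rewrite expr1 expr0 mulr1.
by congr (grZ gr _ X); lia.
Qed.

Lemma grZY : grZ gr dy Y.
Proof.
have := grZmon 0 1; rewrite expr1 expr0 mul1r.
by congr (grZ gr _ Y); lia.
Qed.

(** Homogeneous components are obtained by filtering the coefficients by degree;
    only finitely many degrees occur. *)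
Lemma grZ_projections : exists pr, projections (grZ gr) pr.
Proof.
pose Q (t : int) i j := (deg i j)%:Z == t.
pose pr t b := sval (cid (coef_filter (Q t) b)).
have prE t b i j : coef i j (pr t b) = if Q t i j then coef i j b else 0.
  exact: (svalP (cid (coef_filter (Q t) b))).
have prD t x y : pr t (x + y) = pr t x + pr t y.
  apply: (@qp_ext _ _ _ _ _ _ _ _ qp _ _) => i j; rewrite linearD /= !prE linearD /=.
  by case: ifP; rewrite ?addr0.
have prB t x y : pr t (x - y) = pr t x - pr t y.
  apply: (@qp_ext _ _ _ _ _ _ _ _ qp _ _) => i j; rewrite linearB /= !prE linearB /=.
  by case: ifP; rewrite ?subr0.
exists pr; split=> // [t x /grZE gx|t s x /grZE gx st|t x|x].
- apply: (@qp_ext _ _ _ _ _ _ _ _ qp _ _) => i j; rewrite prE; case: ifP => // /negbT d.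
  by rewrite gx.
- apply: (@qp_ext _ _ _ _ _ _ _ _ qp _ _) => i j; rewrite prE linear0; case: ifP => // /eqP d.
  by rewrite gx // d.
- by apply/grZE => i j d; rewrite prE /Q (negbTE d).
have [n xn] := coef_fin x; pose N := (dx * n + dy * n).+1.
have degN i j : coef i j x != 0 -> (deg i j < N)%N.
  by move=> /xn /andP[hi hj]; rewrite ltnS leq_add // leq_mul2l ltnW ?orbT.
have us : uniq (map Posz (iota 0 N)) by rewrite map_inj_uniq ?iota_uniq// => ? ? [].
have memN d : (d < N)%N -> Posz d \in map Posz (iota 0 N).
  by move=> h; apply/mapP; exists d; rewrite ?mem_iota.
exists (map Posz (iota 0 N)); split=> [//||t].
  apply: (@qp_ext _ _ _ _ _ _ _ _ qp _ _) => i j; rewrite linear_sum /=.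
  under eq_bigr do rewrite prE /Q.
  have [->|/degN d] := eqVneq (coef i j x) 0; first by rewrite big1 // => t _; case: ifP.
  rewrite (bigD1_seq (deg i j : int)) //= ?eqxx; last exact: memN.
  by rewrite big1 ?addr0 // => t; rewrite eq_sym => /negbTE ->.
move=> tN; apply: (@qp_ext _ _ _ _ _ _ _ _ qp _ _) => i j; rewrite prE linear0 /Q; case: eqVneq => // d.
apply/eqP; apply: contraNT tN => /degN; rewrite -d => h.
exact: memN.
Qed.

End Regular.

(** * The trivial module and the global dimension *)

Section Connected.
Variables (k : fieldType) (B : algType k) (X Y : B) (p : k) (dx dy : nat).
Variable gr : nat -> set B.
Hypothesis qp : quantum_plane X Y p dx dy gr.
Local Notation coef := (qp_coef qp).
Local Notation deg i j := (dx * i + dy * j)%N.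
Local Notation ext := (@qp_ext _ _ _ _ _ _ _ _ qp _ _).

Lemma coef1 i j : coef i j 1 = ((i == 0%N) && (j == 0%N))%:R.
Proof. by have := qp_coefE qp i j 0 0; rewrite !expr0 mulr1. Qed.

(** The ideal generated by X and Y is spanned by the monomials other than 1, so
    the constant coefficient is multiplicative. *)
Lemma coef00M x y : coef 0 0 (x * y) = (coef 0 0 x : k) * (coef 0 0 y : k).
Proof.
elim/(qp_ind qp): x => [x x' hx hx'|c a b].
  by rewrite mulrDl !linearD /= hx hx' mulrDl.
elim/(qp_ind qp): y => [y y' hy hy'|c' a' b'].
  by rewrite mulrDr !linearD /= hy hy' mulrDr.
rewrite -scalerAl -scalerAr (qp_monM qp) !qp_coefZ !qp_coefE -!mulrA; congr (_ * _).
case: a => [|a]; last by rewrite addSn /= !mulr0 !mul0r.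
case: b => [|b]; last by rewrite addSn andbF !mulr0 !mul0r.
by rewrite mul0n !add0n expr0 !mul1r.
Qed.

Fact eps_linear : linear (coef 0 0 : B -> k^o).
Proof. by move=> c x y; rewrite linearP. Qed.

Fact eps_monoid : monoid_morphism (coef 0 0 : B -> k^o).
Proof. by split=> [|x y]; rewrite ?coef1 ?coef00M. Qed.

Fact qp_eps_subproof : {e : {lrmorphism B -> k^o} | forall x, e x = coef 0 0 x}.
Proof. by exists (mk_lrmorphism eps_linear eps_monoid). Qed.

(** Kept behind an opaque proof, like [free_lift]. *)
Definition qp_eps : {lrmorphism B -> k^o} := sval qp_eps_subproof.

Lemma qp_epsE x : qp_eps x = coef 0 0 x.
Proof. exact: (svalP qp_eps_subproof). Qed.

Lemma qp_epsZ c x : qp_eps (c *: x) = c * (qp_eps x : k).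
Proof. by rewrite !qp_epsE qp_coefZ. Qed.

Lemma qp_eps_augmentation : is_augmentation gr qp_eps.
Proof.
move=> n x n0 /(qp_gr qp) gx; rewrite qp_epsE; apply: gx.
by rewrite !muln0 eq_sym -lt0n.
Qed.

Lemma qp_connected_graded : connected_graded gr.
Proof.
have [pr hpr] := grZ_projections qp.
split.
- apply: (@projections_grading _ _ _ (fun n => pr n%:Z)); split.
  + by move=> i x y; rewrite (prB hpr).
  + by move=> i x gx; apply: (pr_id hpr).
  + by move=> i j x gx ij; apply: (pr_ne hpr (i := i%:Z)).
  + by move=> i x; exact: (pr_in hpr i%:Z).
  + move=> x; have [s [us xs s0]] := pr_sum hpr x.
    exists (map absz [seq t <- s | 0 <= t]); split.
    * rewrite map_inj_in_uniq ?filter_uniq // => i j.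
      by rewrite !mem_filter => /andP[i0 _] /andP[j0 _]; lia.
    * rewrite big_map big_filter {1}xs [LHS](bigID (fun t : int => 0 <= t)) /=.
      rewrite [X in _ + X]big1 ?addr0 => [|t]; last first.
        by case: t => // n _; exact: (pr_in hpr (Negz n) x).
      by apply: eq_bigr => t t0; congr (pr _ _); lia.
    * move=> i ns; apply: s0; apply: contra ns => si.
      by apply/mapP; exists i%:Z; rewrite // mem_filter si.
- by move=> m n x y gx gy; have := @grZM _ _ _ _ _ _ _ _ qp m%:Z n%:Z x y gx gy.
- move=> x; split=> [/(qp_gr qp) gx|[c ->]]; last first.
    apply/(qp_gr qp) => i j d; rewrite qp_coefZ coef1.
    by case: i d => [|i]; case: j => [|j]; rewrite ?muln0 ?mulr0.
  exists (coef 0 0 x); apply: ext => i j; rewrite qp_coefZ coef1.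
  have := qp_dx qp; have := qp_dy qp.
  by case: i => [|i]; case: j => [|j] hx hy; rewrite ?mulr1 ?mulr0 // gx //; lia.
Qed.

Local Notation T := (trivial_module qp_eps).

Definition triv_xi (c : T) : B^o := (c : k)%:A.
Definition triv_cf i j (z : B^o) : T := coef i j z.

Lemma trivE (b : B) (c : T) : b *: c = (qp_eps b : k) * (c : k) :> k.
Proof. by []. Qed.

Lemma triv_scalar (c : k) (x : T) : c%:A *: x = c * (x : k) :> k.
Proof. by rewrite trivE qp_epsE qp_coefZ coef1 mulr1. Qed.

(** B is the module B (x)_k k induced from the trivial module, so that the Koszul
    resolution of k takes its usual form with terms B, B^2 and B. *)
Lemma triv_induced : induced X Y triv_xi triv_cf.
Proof.
split=> [x y|c x|i j x y|i j a b m|z||N f fD fZ].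
- exact: (scalerDl (1 : B) (x : k) (y : k)).
- have -> : triv_xi (c%:A *: x) = (c * (x : k))%:A by rewrite /triv_xi triv_scalar.
  by rewrite -scalerA -(mulr_algl c ((x : k)%:A : B)).
- exact: linearD.
- rewrite /triv_cf /triv_xi /GRing.scale /= mulr_algr qp_coefZ qp_coefE.
  by case: ifP; rewrite ?mulr1 ?mulr0.
- have [n zn] := qp_span qp z; exists n; rewrite {1}zn; apply: eq_bigr => i _.
  by apply: eq_bigr => j _; rewrite [RHS]mulr_algr.
- exact: regular_projective.
have L : linear (fun b : B^o => (b : B) *: f (1 : k)).
  by move=> c x y; rewrite scalerDl scalerA.
exists (mk_linear L) => m; rewrite /= /triv_xi -fZ; congr f.
exact: (etrans (triv_scalar (m : k) (1 : k)) (mulr1 _)).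
Qed.

Fact triv_rX_linear : linear (fun b : B^o => (b : B) * X : B^o).
Proof. by move=> c x y; rewrite mulrDl -mulrA. Qed.
Fact triv_rY_linear : linear (fun b : B^o => (b : B) * Y : B^o).
Proof. by move=> c x y; rewrite mulrDl -mulrA. Qed.
Fact triv_aug_linear : linear (fun b : B^o => qp_eps b : T).
Proof. by move=> c x y; rewrite rmorphD rmorphM. Qed.

Definition triv_rX := mk_linear triv_rX_linear.
Definition triv_rY := mk_linear triv_rY_linear.
(** Both X and Y act by zero on k. *)
Definition triv_l : {linear B^o -> B^o} := zero_map _ _.
Definition triv_aug : {linear B^o -> T} := mk_linear triv_aug_linear.

Lemma epsX : qp_eps X = 0.
Proof. by rewrite qp_epsE; have := coef_Xl0 qp 0 1; rewrite mulr1. Qed.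
Lemma epsY : qp_eps Y = 0.
Proof. by rewrite qp_epsE; have := coef_Yl0 qp 0 1; rewrite mulr1. Qed.

Lemma triv_rXE m : triv_rX (triv_xi m) = X *: triv_xi m.
Proof. by rewrite /= /triv_xi [LHS]mulr_algl [RHS]mulr_algr. Qed.
Lemma triv_rYE m : triv_rY (triv_xi m) = Y *: triv_xi m.
Proof. by rewrite /= /triv_xi [LHS]mulr_algl [RHS]mulr_algr. Qed.
Lemma triv_lXE m : triv_l (triv_xi m) = triv_xi (X *: m).
Proof. by rewrite /= /triv_xi trivE epsX mul0r scale0r. Qed.
Lemma triv_lYE m : triv_l (triv_xi m) = triv_xi (Y *: m).
Proof. by rewrite /= /triv_xi trivE epsY mul0r scale0r. Qed.
Lemma triv_augE m : triv_aug (triv_xi m) = m.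
Proof. by rewrite /= /triv_xi qp_epsE qp_coefZ coef1 mulr1. Qed.

Definition triv_resolution : proj_resolution T :=
  koszul_resolution qp triv_induced triv_rXE triv_rYE triv_lXE triv_lYE triv_augE.

Lemma triv_koszul1 fg :
  koszul1 triv_rX triv_l triv_rY triv_l fg = fg.1 * X + fg.2 * Y :> B.
Proof. by rewrite /koszul1 /= !subr0. Qed.

Lemma triv_koszul2 (h : B) :
  koszul2 p triv_rX triv_l triv_rY triv_l (h : B^o) = (h * Y, - (p *: (h * X))) :> B^o * B^o.
Proof.
rewrite /koszul2 /= scaler0 subr0 sub0r; congr (_, - _).
exact: (mulr_algl p (h * X)).
Qed.

(** If the global dimension were less than 2, [resolution_split] would provide a
    retraction h of the map b -> (bY, - p bX) from B to B^2.  Then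
    1 = Y h(1, 0) - p X h(0, 1), which the augmentation sends to 0. *)
Lemma qp_gldim : gldim_eq B 2.
Proof.
split=> [|n hn]; first exact: (qp_gldim_le qp).
rewrite ltnNge; apply/negP => n1.
have [r r0] := hn T.
have [||h hE] := @resolution_split B T r triv_resolution.
- by apply: r0; lia.
- exact: zero_moduleE.
have /(congr1 qp_eps) := hE (1 : B^o); rewrite rmorph1.
have -> : res_d triv_resolution 1 (1 : B^o) = (Y, - (p *: X)) :> B^o * B^o.
  by have := triv_koszul2 1; rewrite !mul1r.
have -> : (Y, - (p *: X)) = Y *: (1, 0) + (- (p *: X)) *: (0, 1) :> B^o * B^o.
  apply: injective_projections => /=.
    by rewrite scaler0 addr0; symmetry; exact: mulr1.
  by rewrite scaler0 add0r; symmetry; exact: mulr1.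
have := linearD h; move=> /(_ (Y *: (1, 0)) ((- (p *: X)) *: (0, 1))) ->.
have hZ (b : B) (z : B^o * B^o) : h (b *: z) = b * h z :> B by exact: (linZ h).
have e0 : qp_eps (- (p *: X)) = 0 by rewrite -scaleNr qp_epsZ epsX mulr0.
have epsM a b : qp_eps (a * b) = (qp_eps a : k) * (qp_eps b : k) by exact: rmorphM.
have fin (a b : B) : qp_eps (Y * a + (- (p *: X)) * b) = 0.
  by rewrite raddfD /= !epsM e0 epsY !mul0r addr0.
rewrite !hZ fin => /eqP; by rewrite eq_sym oner_eq0.
Qed.

End Connected.

(** * The Gorenstein condition *)

Section Gorenstein.
Variables (k : fieldType) (B : algType k) (X Y : B) (p : k) (dx dy : nat).
Variable gr : nat -> set B.
Hypothesis qp : quantum_plane X Y p dx dy gr.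
Local Notation coef := (qp_coef qp).
Local Notation deg i j := (dx * i + dy * j)%N.
Local Notation ext := (@qp_ext _ _ _ _ _ _ _ _ qp _ _).
Local Notation res := (triv_resolution qp).

(** The shifts by dx, dy and dx + dy make the Koszul differentials homogeneous of
    degree 0; the terms of degree 3 and more are zero modules. *)
Definition triv_gradings (n : nat) : int -> set (koszul_obj (B^o : lmodType B) n) :=
  match n return int -> set (koszul_obj (B^o : lmodType B) n) with
  | 0 => grZ gr
  | 1 => fun j x => grZ gr (j - dx%:Z) x.1 /\ grZ gr (j - dy%:Z) x.2
  | 2 => fun j x => grZ gr (j - (dx + dy)%:Z) x
  | _ => fun _ => setT
  end.

Lemma res_d0 fg : res_d res 0 fg = (fg.1 : B) * X + (fg.2 : B) * Y :> B.
Proof. exact: triv_koszul1. Qed.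

Lemma res_d1 (h : B) : res_d res 1 (h : B^o) = (h * Y, - (p *: (h * X))) :> B^o * B^o.
Proof. exact: triv_koszul2. Qed.

Lemma triv_graded : graded_resolution gr (@trivial_grading _ _ (qp_eps qp)) (r := res)
  triv_gradings.
Proof.
have [pr hpr] := grZ_projections qp.
split.
- case=> [|[|[|n]]].
  + split; first exact: (projections_grading hpr).
    by move=> n j a x ga gx; exact: (grZM qp (s := n%:Z)).
  + split; last first.
      move=> n j a [x y] ga [gx gy]; rewrite /triv_gradings -!addrA.
      by split; exact: (grZM qp (s := n%:Z)).
    have := projections_pair (projections_shift dx%:Z hpr) (projections_shift dy%:Z hpr).
    exact: projections_grading.
  + split; first exact: (projections_grading (projections_shift _ hpr)).
    by move=> n j a x ga gx; rewrite /triv_gradings -addrA; exact: (grZM qp (s := n%:Z)).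
  + split=> //; apply: (@projections_grading _ _ _ (fun _ _ => 0)); split=> //.
    * by move=> *; rewrite subr0.
    * by move=> i x _; rewrite [x]zero_moduleE.
    * by move=> x; exists [::]; split=> //; rewrite big_nil; exact: zero_moduleE.
- case=> [|[|[|n]]] j x //.
  + move=> [gx gy]; rewrite res_d0.
    apply: (grZD qp).
      by have := grZM qp gx (grZX qp); rewrite subrK.
    by have := grZM qp gy (grZY qp); rewrite subrK.
  + move=> gx; rewrite res_d1; split=> /=.
      have := grZM qp gx (grZY qp); congr (grZ gr _ _); lia.
    rewrite -scaleNr; apply: (grZZ qp).
    have := grZM qp gx (grZX qp); congr (grZ gr _ _); lia.
  + by move=> _; exact: (grZ0 qp).
- move=> j x gx; rewrite /= /trivial_grading /=.
  have [->|j0] := eqVneq j 0; first by left.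
  right; rewrite qp_epsE; move/(grZE qp): gx; apply.
  by rewrite !muln0 eq_sym.
Qed.

(** Linear maps from B to B are right multiplications, so Hom(-, B) turns the
    resolution into B -> B^2 -> B with left multiplications by X and Y. *)
Lemma hom1E (f : {linear (B^o : lmodType B) -> (B^o : lmodType B)}) (x : B) :
  f x = x * (f 1 : B) :> B.
Proof. by rewrite -[x in f x]mulr1; exact: (linZ f). Qed.

Lemma hom2E (f : {linear ((B^o * B^o)%type : lmodType B) -> (B^o : lmodType B)}) x :
  f x = (x.1 : B) * (f (1, 0) : B) + (x.2 : B) * (f (0, 1) : B) :> B.
Proof.
have -> : x = x.1 *: (1, 0) + x.2 *: (0, 1) :> (B^o * B^o)%type.
  apply: injective_projections => /=.
    by rewrite scaler0 addr0; symmetry; exact: mulr1.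
  by rewrite scaler0 add0r; symmetry; exact: mulr1.
rewrite linearD; congr (_ + _); rewrite (linZ f) /= ?scaler0 ?addr0 ?add0r;
congr (_ * _); symmetry; exact: mulr1.
Qed.

Lemma right_mul_linear (c : B) : linear (fun x : B^o => (x : B) * c : B^o).
Proof. by move=> a x y; rewrite mulrDl -mulrA. Qed.

(** Left multiplication by X is injective. *)
Lemma ext0 j : ext_dim gr (r := res) triv_gradings 0 j 0.
Proof.
exists (fun _ => zero_map _ _); split=> [[]//|f [_ fd]|c _ []//].
exists (fun _ => 0) => x; rewrite big_ord0 subr0.
have := fd (1, 0); rewrite res_d0 mul1r mul0r addr0 hom1E => Xf.
rewrite hom1E; suff -> : (f 1 : B) = 0 by rewrite mulr0.
move: (f 1 : B) Xf => c Xc; apply: ext => i l.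
by rewrite -(coef_XlS qp) Xc !linear0.
Qed.

(** If Y c1 = p X c2, comparing coefficients shows that c1 = X c, and cancelling
    X in Y X c = p X c2 gives c2 = Y c. *)
Lemma ext1 j : ext_dim gr (r := res) triv_gradings 1 j 0.
Proof.
exists (fun _ => zero_map _ _); split=> [[]//|f [fj fd]|c _ []//].
exists (fun _ => 0) => //.
pose c1 : B := f (1, 0); pose c2 : B := f (0, 1).
have Yc1 : Y * c1 = p *: (X * c2).
  have := fd (1 : B^o); rewrite res_d1 hom2E /= !mul1r mulNr -scalerAl => /eqP.
  by rewrite subr_eq0 => /eqP.
have [c hc] := coef_unshiftX qp c1.
have Xc : X * c = c1.
  apply: ext => -[|i] l; last by rewrite (coef_XlS qp) hc.
  rewrite (coef_Xl0 qp) -[RHS]mul1r -(expr0 p) -(coef_YlS qp) Yc1 qp_coefZ.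
  by rewrite (coef_Xl0 qp) mulr0.
have Yc : Y * c = c2.
  have : Y * (X * c) = p *: (X * c2) by rewrite Xc.
  rewrite mulrA (qp_comm qp) -scalerAl -mulrA => /(scalerI (qp_p qp)) e.
  by apply: ext => i l; rewrite -[LHS](coef_XlS qp) -[RHS](coef_XlS qp) e.
have gc : grZ gr j c.
  have g1 : grZ gr (dx%:Z + j) c1.
    apply: (fj dx%:Z (1, 0)); split=> /=; last exact: (grZ0 qp).
    by rewrite subrr; apply/(grZE qp) => i l d; rewrite coef1; case: i l d => [|i] [|l] //; rewrite !muln0.
  apply/(grZE qp) => i l d; rewrite hc; move/(grZE qp): g1; apply.
  by apply: contraNneq d => e; lia.
exists (mk_linear (right_mul_linear c)) => [t x gx|x] /=; first exact: (grZM qp).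
rewrite big_ord0 subr0 hom2E res_d0 mulrDl -!mulrA Xc Yc.
by [].
Qed.

(** The cokernel is B/(XB + YB), spanned by the class of 1; the generator of the
    last term of the resolution has degree dx + dy. *)
Lemma ext2 j : ext_dim gr (r := res) triv_gradings 2 j (j == - (dx + dy)%:Z).
Proof.
have deg_c (f : {linear res 2%N -> B^o}) : hom_degree (r := res) gr triv_gradings j f ->
    grZ gr ((dx + dy)%:Z + j) (f (1 : B^o) : B).
  move=> fj; apply: (fj (dx + dy)%:Z); rewrite /= subrr.
  by apply/(grZE qp) => i l d; rewrite coef1; case: i l d => [|i] [|l] //; rewrite !muln0.
have idL : linear (fun x : B^o => x) by [].
have bound (f : B) : coef 0 0 f = 0 -> grZ gr ((dx + dy)%:Z + j) f ->
    coboundary (n := 2) (r := res) gr triv_gradings j (fun x : B^o => (x : B) * f).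
  move=> f0 gf; have [c2 h2] := coef_unshiftX qp f; have [c1 h1] := coef_unshiftY qp f.
  have fE : Y * c1 + X * c2 = f.
    apply: ext => -[|i] [|l]; rewrite linearD /= ?(coef_Xl0 qp) ?(coef_Yl0 qp)
      ?(coef_XlS qp) ?(coef_YlS qp) ?h1 ?h2 /= ?expr0 ?mul1r ?mulr0 ?addr0 ?add0r //.
  have L : linear (fun x : B^o * B^o =>
      (x.1 : B) * c1 - (x.2 : B) * (p^-1 *: c2) : B^o).
    by move=> c x y; rewrite /= !mulrDl opprD addrACA -!mulrA -mulrBr.
  exists (mk_linear L) => [t [x y] [gx gy]|x].
    have gD s a b : grZ gr s a -> grZ gr s b -> grZ gr s (a - b).
      by move=> ga gb; rewrite -scaleN1r; apply: (grZD qp) => //; exact: (grZZ qp).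
    rewrite /=; apply: gD.
      have -> : t + j = (t - dx%:Z) + (dx%:Z + j) by lia.
      apply: (grZM qp) gx _; apply/(grZE qp) => i l d; rewrite h1; case: eqP => // i0.
      move/(grZE qp): gf; apply; apply: contraNneq d => e; rewrite i0; lia.
    have -> : t + j = (t - dy%:Z) + (dy%:Z + j) by lia.
    apply: (grZM qp) gy _; apply: (grZZ qp); apply/(grZE qp) => i l d; rewrite h2.
    move/(grZE qp): gf; apply; apply: contraNneq d => e; lia.
  rewrite res_d1 /= mulNr opprK -scalerAl -scalerAr scalerA mulfV ?(qp_p qp) // scale1r.
  by rewrite -!mulrA -mulrDr fE.
have [jl|jl] := eqVneq j (- (dx + dy)%:Z).
  exists (fun _ => mk_linear idL); split=> [i|f [fj _]|c [g gj gE] i].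
  - split=> [t x gx|x]; last by [].
    by rewrite /= jl.
  - have := deg_c f fj; rewrite jl subrr => /(grZE qp) gf.
    exists (fun _ => coef 0 0 (f (1 : B^o))).
    have -> : (fun x : res 2%N => (f x : B) - \sum_(i < 1)
        (coef 0 0 (f (1 : B^o)) : k) *: (mk_linear idL x : B)) =
        (fun x : B^o => (x : B) * 0 : B).
      apply: funext => x; rewrite big_ord1 mulr0 hom1E.
      apply/eqP; rewrite subr_eq0 /= -mulr_algr; apply/eqP; congr (_ * _).
      apply: ext => i l; rewrite qp_coefZ coef1.
      case: i => [|i]; case: l => [|l]; rewrite ?mulr1 ?mulr0 // gf //;
      have := qp_dx qp; have := qp_dy qp; lia.
    by rewrite -jl; apply: bound; [rewrite linear0|exact: (grZ0 qp)].
  - have := gE (1 : B^o); rewrite big_ord1 /= res_d1 hom2E /= !mul1r mulNr.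
    rewrite -scalerAl; move=> /(congr1 (fun b => coef 0 0 b)).
    rewrite linearB /= !qp_coefZ (coef_Yl0 qp) (coef_Xl0 qp) mulr0 subr0 coef1 mulr1.
    by move=> c0; rewrite -c0; congr (c _); exact: (ord1 (i : (ordinal 1))).
exists (fun _ => zero_map _ _); split=> [[]//|f [fj _]|c _ []//].
exists (fun _ => 0).
have -> : (fun x : res 2%N => (f x : B) - \sum_(i < 0) 0 *: (0 : B)) =
        (fun x : B^o => (x : B) * (f (1 : B^o) : B)).
  by apply: funext => x; rewrite big_ord0 subr0 hom1E.
have gf := deg_c f fj; apply: bound => //.
move/(grZE qp): gf; apply; rewrite !muln0; apply: contraNneq jl => e; lia.
Qed.

Lemma qp_Gorenstein : AS_Gorenstein gr 2 (dx + dy)%:Z.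
Proof.
exists (qp_eps qp); split; first exact: qp_eps_augmentation.
exists res, triv_gradings; split; first exact: triv_graded.
case=> [|[|[|n]]] j; [exact: ext0|exact: ext1|exact: ext2|].
exists (fun _ => zero_map _ _); split=> [[]//|f [fj _]|c _ []//].
exists (fun _ => 0); exists (zero_map _ _) => [t x _|x]; first exact: (grZ0 qp).
by rewrite big_ord0 subr0 [x]zero_moduleE !linear0.
Qed.

End Gorenstein.

(** * Growth and AS regularity *)

Section Growth.
Variables (R : realType) (k : fieldType) (B : algType k) (X Y : B) (p : k) (dx dy : nat).
Variable gr : nat -> set B.
Hypothesis qp : quantum_plane X Y p dx dy gr.
Local Notation coef := (qp_coef qp).
Local Notation ext := (@qp_ext _ _ _ _ _ _ _ _ qp _ _).

(* The coefficients of b lie in the square [0, N] x [0, N]. *)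
Let bounded N b := forall i j, ~~ ((i <= N) && (j <= N))%N -> coef i j b = 0.

Let bounded_span N b : bounded N b ->
  b = \sum_(i < N.+1) \sum_(j < N.+1) coef i j b *: (X ^+ i * Y ^+ j).
Proof.
move=> hb; have [n nb] := qp_span_big qp b.
pose F i j := coef i j b *: (X ^+ i * Y ^+ j).
have cut m : (N.+1 <= m)%N -> \sum_(i < m) \sum_(j < m) F i j =
    \sum_(i < N.+1) \sum_(j < N.+1) F i j.
  move=> Nm; rewrite (big_ord_widen m (fun i => \sum_(j < N.+1) F i j) Nm).
  rewrite [RHS]big_mkcond; apply: eq_bigr => i _; case: ifP => iN; last first.
    by rewrite big1 // => j _; rewrite /F hb ?scale0r // -ltnS iN.
  rewrite (big_ord_widen m (F i) Nm) [RHS]big_mkcond; apply: eq_bigr => j _.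
  by case: ifP => // jN; rewrite /F hb ?scale0r // -[(j <= N)%N]ltnS jN andbF.
by rewrite {1}(nb (maxn n N.+1)) ?leq_maxl // cut // leq_maxr.
Qed.

Let boundedM N N' b b' : bounded N b -> bounded N' b' -> bounded (N + N') (b * b').
Proof.
move=> hb hb'; rewrite {1}(bounded_span hb) {1}(bounded_span hb').
have b0 N0 : bounded N0 0 by move=> i j _; rewrite linear0.
have bD N0 x y : bounded N0 x -> bounded N0 y -> bounded N0 (x + y).
  by move=> hx hy i j h; rewrite linearD /= hx // hy // addr0.
rewrite mulr_suml; apply: big_ind => [//|?|i _]; first exact: bD.
rewrite mulr_suml; apply: big_ind => [//|?|j _]; first exact: bD.
rewrite mulr_sumr; apply: big_ind => [//|?|i' _]; first exact: bD.
rewrite mulr_sumr; apply: big_ind => [//|?|j' _]; first exact: bD.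
move=> a c h; rewrite -scalerAl -scalerAr (qp_monM qp) !qp_coefZ qp_coefE.
case: (eqVneq a (i + i')%N) => [ai|]; last by rewrite !mulr0.
case: (eqVneq c (j + j')%N) => [cj|]; last by rewrite !mulr0.
by move: h (ltn_ord i) (ltn_ord j) (ltn_ord i') (ltn_ord j'); lia.
Qed.

Let bounded_ex b : exists N, bounded N b.
Proof.
have [n hn] := coef_fin qp b; exists n => i j; apply: contraNeq => /hn.
by case/andP => /ltnW -> /ltnW ->.
Qed.

Let words_bounded N (s : seq B) n : (forall b, b \in s -> bounded N b) ->
  forall w, w \in words s n -> bounded (n * N) w.
Proof.
move=> hs; elim: n => [|n IH] w /=.
  rewrite inE => /eqP -> i j h; rewrite coef1.
  by case: i h => [|i] //; case: j.
by case/allpairsP => -[x y] /= [/hs hx /IH hy ->]; rewrite mulSn; exact: boundedM.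
Qed.

(* Independent elements have independent coefficient vectors in k^((N+1)^2). *)
Let span_dim_bounded N (s : seq B) : (forall b, b \in s -> bounded N b) ->
  (span_dim s <= N.+1 * N.+1)%N.
Proof.
move=> hs; apply/bigmax_leqP => I /asboolP Iind.
pose A : 'M[k]_(#|I|, N.+1 * N.+1) := \matrix_(r < #|I|)
  mxvec (\matrix_(i < N.+1, j < N.+1) (coef i j s`_(enum_val r) : k)).
suff : row_free A by rewrite -row_leq_rank => /leq_trans; apply; exact: rank_leq_col.
rewrite -kermx_eq0; apply/eqP/row_matrixP => r0; rewrite row0.
set v := row r0 (kermx A).
have vA : v *m A = 0 by apply/sub_kermxP; exact: row_sub.
pose c (i : 'I_(size s)) : k := \sum_(r < #|I| | enum_val r == i) v 0 r.
have cE r : c (enum_val r) = v 0 r.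
  by rewrite /c (big_pred1 r) // => r'; rewrite /= (inj_eq enum_val_inj).
have sum0 : \sum_(i in I) c i *: s`_i = 0.
  rewrite big_enum_val; under eq_bigr do rewrite cE.
  apply: ext => i j; rewrite linear0 linear_sum /=.
  have [/andP[iN jN]|ij] := boolP ((i <= N) && (j <= N))%N; last first.
    by rewrite big1 // => r _; rewrite qp_coefZ hs ?mulr0 // mem_nth.
  have := congr1 (fun M => vec_mx M (Ordinal (iN : (i < N.+1)%N)) (Ordinal (jN : (j < N.+1)%N))) vA.
  rewrite mulmx_sum_row !linear_sum /= summxE => e.
  rewrite -[RHS](_ : vec_mx (0 : 'rV[k]_(N.+1 * N.+1)) (Ordinal (iN : (i < N.+1)%N)) (Ordinal (jN : (j < N.+1)%N)) = 0); last by rewrite linear0 mxE.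
  rewrite -e; apply: eq_bigr => r _.
  by rewrite qp_coefZ linearZ /= rowK mxvecK !mxE.
apply/rowP => r; rewrite -cE mxE; apply: (Iind c sum0).
exact: enum_valP.
Qed.

(** Words of length n in elements bounded by N are bounded by nN, so they span at
    most (nN + 1)^2 dimensions.  The bound n^3, valid for large n, absorbs the
    constant N and is enough for finiteness. *)
Lemma qp_GKdim : (GKdim R B < +oo)%E.
Proof.
suff : (GKdim R B <= 3%:R%:E)%E by move/le_lt_trans; apply; exact: ltry.
apply: ge_ereal_sup => _ [s _ <-].
have [N hN] : exists N, forall b, b \in 1 :: s -> bounded N b.
  elim: (1 :: s) => [|b t [N IH]]; first by exists 0%N.
  have [M hM] := bounded_ex b; exists (maxn M N) => x; rewrite inE => /orP[/eqP->|/IH hx].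
    by move=> i j h; apply: hM; move: h; rewrite !leq_max; lia.
  by move=> i j h; apply: hx; move: h; rewrite !leq_max; lia.
pose n0 := (N.+1 * N.+1).+2.
pose u n : \bar R := ((ln (span_dim (words (1 :: s) n))%:R / ln n%:R : R)%:E)%E.
apply: (@le_trans _ _ (ereal_sup (u @` [set n | (n0 <= n)%N])%classic)).
  by apply: ereal_inf_lbound; exists [set n | (n0 <= n)%N]%classic => //; exists n0.
apply: ge_ereal_sup => _ [n /= n0n <-]; rewrite lee_fin.
have ln0n : 0 < ln (n%:R : R) by apply: ln_gt0; rewrite ltr1n; apply: leq_trans n0n.
rewrite ler_pdivrMr //.
have dle : (span_dim (words ((1 : B)%R :: s) n) <= n ^ 3)%N.
  apply: (leq_trans (span_dim_bounded (words_bounded hN))).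
  move: n0n; rewrite /n0 !expnS expn0 muln1 => n0n.
  have : ((n * N).+1 <= n * N.+1)%N by lia.
  by nia.
have [->|d0] := posnP (span_dim (words (1 :: s) n)).
  by rewrite (@ln0 _ 0) // mulr_ge0 // ltW.
have n_gt0 : (0 < n)%N by apply: leq_trans n0n.
have -> : 3%:R * ln (n%:R : R) = ln ((n ^ 3)%:R).
  by rewrite natrX lnXn ?ltr0n // mulr_natl.
by rewrite ler_ln ?qualifE /= ?ltr0n ?expn_gt0 ?n_gt0 // ler_nat.
Qed.

Theorem qp_AS_regular : AS_regular R gr.
Proof.
split; first exact: qp_connected_graded qp.
exists 2%N; split; first exact: qp_gldim qp.
  exact: qp_GKdim.
by exists (dx + dy)%:Z; exact: qp_Gorenstein qp.
Qed.

End Growth.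

(** * Bases recognised by evaluation *)

Section LinearSpan.
Variables (k : fieldType) (V : lmodType k).

(** Inductive, so that linear statements can be proved by induction on a
    combination. *)
Inductive lspan (S : V -> Prop) : V -> Prop :=
| lspan0 : lspan S 0
| lspanS c x y : S x -> lspan S y -> lspan S (c *: x + y).

Lemma lspan_gen S x : S x -> lspan S x.
Proof. by move=> Sx; rewrite -[x]addr0 -[x]scale1r; apply: lspanS => //; exact: lspan0. Qed.

Lemma lspanP S c x y : lspan S x -> lspan S y -> lspan S (c *: x + y).
Proof.
move=> Sx Sy; elim: Sx => [|a x0 x1 Sx0 _ IH]; first by rewrite scaler0 add0r.
by rewrite scalerDr scalerA -addrA; apply: lspanS.
Qed.

Lemma lspanD S x y : lspan S x -> lspan S y -> lspan S (x + y).
Proof. by move=> Sx Sy; rewrite -[x]scale1r; exact: lspanP. Qed.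

Lemma lspanZ S c x : lspan S x -> lspan S (c *: x).
Proof. by move=> Sx; rewrite -[_ *: _]addr0; apply: lspanP => //; exact: lspan0. Qed.

Lemma lspan_sum (I : Type) (r : seq I) (F : I -> V) S :
  (forall i, lspan S (F i)) -> lspan S (\sum_(i <- r) F i).
Proof. by move=> h; apply: big_ind => //; [exact: lspan0|exact: lspanD]. Qed.

Lemma in_spanP (s : seq V) x : in_span s x <-> lspan (fun y => y \in s) x.
Proof.
split=> [[c ->]|].
  by apply: lspan_sum => i; apply/lspanZ/lspan_gen/mem_nth.
elim=> [|c y z ys _ [d ->]].
  by exists (fun=> 0); rewrite big1 // => i _; rewrite scale0r.
have iy : (index y s < size s)%N by rewrite index_mem.
exists (fun i => d i + c * (i == Ordinal iy)%:R).
under [RHS]eq_bigr do rewrite scalerDl.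
rewrite big_split /= [RHS]addrC; congr (_ + _).
rewrite (bigD1 (Ordinal iy)) //= eqxx mulr1 nth_index // big1 ?addr0 // => i /negbTE ->.
by rewrite mulr0 scale0r.
Qed.

End LinearSpan.

Lemma lspan_map (k : fieldType) (V W : lmodType k) (f : V -> W) S S' :
    linear f -> (forall x, S x -> lspan S' (f x)) ->
  forall x, lspan S x -> lspan S' (f x).
Proof.
move=> fL fS x; elim=> [|c y z Sy _ IH].
  have -> : f 0 = 0 by apply: (addIr (f 0)); rewrite add0r -{1}[f 0]scale1r -fL scaler0 add0r.
  exact: lspan0.
by rewrite fL; apply: lspanP => //; exact: fS.
Qed.

Section Coordinates.
Variable k : numFieldType.

Lemma poly_vanish (D : idomainType) (e : nat -> D) (r : {poly D}) :
  injective e -> (forall n, r.[e n] = 0) -> r = 0.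
Proof.
move=> e_inj r0; apply/eqP; apply: contraT => rn0.
pose rs := map e (iota 0 (size r)).
have urs : uniq rs by rewrite map_inj_uniq ?iota_uniq.
have ars : all (root r) rs by apply/allP => _ /mapP[n _ ->]; rewrite rootE r0.
by have := max_poly_roots rn0 ars urs; rewrite size_map size_iota ltnn.
Qed.

(** A polynomial in two variables that vanishes off the coordinate axes is zero,
    by two applications of [poly_vanish]. *)
Lemma poly_vanish2 (r : {poly {poly k}}) :
  (forall x y : k, x != 0 -> y != 0 -> r.[x%:P].[y] = 0) -> r = 0.
Proof.
move=> r0; pose e n : k := n.+1%:R.
have e_inj : injective e by move=> n n' /eqP; rewrite eqr_nat eqSS => /eqP.
have e0 n : e n != 0 by rewrite pnatr_eq0.
apply: (@poly_vanish _ (fun n => (e n)%:P)) => [n n' /polyC_inj /e_inj //|n].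
by apply: (poly_vanish e_inj) => n'; exact: r0.
Qed.

Variables (V : lmodType k) (mon : nat -> nat -> V).
Hypothesis mon_span : forall v, lspan (fun x => exists a b, x = mon a b) v.
Hypothesis mon_eval : forall x y : k, x != 0 -> y != 0 ->
  exists f : {linear V -> k^o}, forall a b, f (mon a b) = x ^+ a * y ^+ b.

(** A linear relation between the mon a b becomes, through the functionals of
    [mon_eval], a polynomial in x and y that vanishes at all points off the axes,
    hence has zero coefficients.  So the spanning family is a basis. *)
Lemma coordinates : exists coef : nat -> nat -> {linear V -> k^o},
  (forall i j a b, coef i j (mon a b) = ((i == a) && (j == b))%:R) /\
  (forall v, exists n, v = \sum_(i < n) \sum_(j < n) coef i j v *: mon i j).
Proof.
pose F := free_module k (nat * nat)%type.
pose L : {linear F -> V} := free_lift (fun e => mon e.1 e.2).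
have L_inj D : L D = 0 -> D = 0.
  rewrite /L free_liftED => D0.
  pose r : {poly {poly k}} :=
    \sum_(e <- dom D) (free_coef e D *: 'X^(e.2)) *: 'X^(e.1).
  have r0 : r = 0.
    apply: poly_vanish2 => x y x0 y0; rewrite horner_sum horner_sum.
    have [f fE] := mon_eval x0 y0; have := congr1 f D0; rewrite linear0 linear_sum /= => E; rewrite -[RHS]E.
    apply: eq_bigr => e _; rewrite linearZ /= fE hornerZ hornerXn !(hornerM, hornerZ, hornerXn).
    rewrite -rmorphXn /= hornerC -mulrA; congr (_ * _); exact: mulrC.
  apply/eqP/freeg_eqP => -[a b]; rewrite coeff0.
  have [ab|/coeff_outdom //] := boolP ((a, b) \in dom D).
  have : r`_a`_b = 0 by rewrite r0 !coef0.
  rewrite coef_sum coef_sum (bigD1_seq (a, b)) ?uniq_dom //= big1 => [|e e_ab].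
    by rewrite coefZ coefXn eqxx mulr1 coefZ coefXn eqxx mulr1 addr0.
  rewrite coefZ coefXn; case: eqVneq => [ea|]; last by rewrite mulr0 coef0.
  rewrite mulr1 coefZ coefXn; case: eqVneq => [eb|]; last by rewrite mulr0.
  by case/eqP: e_ab; rewrite ea eb -surjective_pairing.
have L_surj v : exists D, L D = v.
  elim: (mon_span v) => [|c _ y [a [b ->]] _ [D DE]]; first by exists 0; rewrite linear0.
  exists (c *: free_gen k (a, b) + D); rewrite linearP DE; congr (_ *: _ + _).
  exact: free_liftE.
have /choice[inv invK] := L_surj.
have LK D : inv (L D) = D.
  by apply/eqP; rewrite -subr_eq0; apply/eqP/L_inj; rewrite linearB /= invK subrr.
have invL : linear inv by move=> c x y; rewrite -[x]invK -[y]invK -linearP !LK.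
have cL i j : linear (fun v => free_coef (i, j) (inv v) : k^o).
  by move=> c x y; rewrite invL /free_coef coeffD coeffZ.
pose coef i j := mk_linear (cL i j).
have coefE i j a b : coef i j (mon a b) = ((i == a) && (j == b))%:R.
  have -> : mon a b = L (free_gen k (a, b)) by rewrite /L free_liftE.
  rewrite /= LK /free_coef /free_gen coeffU mul1r; congr (_%:R).
  by rewrite eq_sym.
exists coef; split=> [//|v].
suff [n hn] : exists n, forall N, (n <= N)%N ->
    v = \sum_(i < N) \sum_(j < N) coef i j v *: mon i j.
  by exists n; exact: hn.
elim: (mon_span v) => [|c _ y [a [b ->]] _ [n hn]].
  exists 0%N => N _; rewrite big1 // => i _; rewrite big1 // => j _.
  by rewrite linear0 scale0r.
exists (maxn n (maxn a b).+1) => N; rewrite !geq_max gtn_max => /and3P[/hn {1}-> aN bN].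
under [RHS]eq_bigr do under eq_bigr do rewrite linearP scalerDl.
under [RHS]eq_bigr do rewrite big_split /=.
rewrite big_split /=; congr (_ + _).
rewrite (bigD1 (Ordinal aN)) //= (bigD1 (Ordinal bN)) //=.
have cE i j : c *: (coef i j (mon a b)) = c * ((i == a) && (j == b))%:R :> k.
  by rewrite coefE.
rewrite -!/(coef _ _ _) !cE !eqxx mulr1.
rewrite [X in _ + X + _]big1 => [|j jb]; last first.
  by rewrite cE eqxx /= -[_ == b]/(j == Ordinal bN) (negbTE jb) mulr0 scale0r.
rewrite big1 => [|i ia]; first by rewrite !addr0.
rewrite big1 // => j _; rewrite cE.
by rewrite -[_ == a]/(i == Ordinal aN) (negbTE ia) mulr0 scale0r.
Qed.

End Coordinates.

(** * The algebra A^- is a quantum plane *)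

Lemma aminus_rel_inj (k : fieldType) (lam : k) (i : nat) (A B : algType k)
    (f : {lrmorphism B -> A}) (b : aminus_gen -> B) :
  injective f -> aminus_rel lam i (f \o b) -> aminus_rel lam i b.
Proof. by move=> f_inj h; apply: f_inj; rewrite linearZ !rmorphXn. Qed.

Section Mx2.
Variable k : fieldType.

Definition mx2 (a b c d : k) : 'M[k]_2 :=
  \matrix_(i, j) if i == 0 then if j == 0 then a else b
                 else if j == 0 then c else d.

Lemma mx2M a b c d a' b' c' d' : mx2 a b c d * mx2 a' b' c' d' =
  mx2 (a * a' + b * c') (a * b' + b * d') (c * a' + d * c') (c * b' + d * d').
Proof.
apply/matrixP => i j; rewrite -mulmxE !mxE !big_ord_recl big_ord0 !mxE addr0 /=.
by case: (i == 0); case: (j == 0).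
Qed.

Lemma mx2Z e a b c d : e *: mx2 a b c d = mx2 (e * a) (e * b) (e * c) (e * d).
Proof. by apply/matrixP => i j; rewrite !mxE; case: (i == 0); case: (j == 0). Qed.

Lemma mx2D a b c d a' b' c' d' : mx2 a b c d + mx2 a' b' c' d' =
  mx2 (a + a') (b + b') (c + c') (d + d').
Proof. by apply/matrixP => i j; rewrite !mxE; case: (i == 0); case: (j == 0). Qed.

Lemma mx2_1 : 1 = mx2 1 0 0 1.
Proof.
by apply/matrixP => i j; rewrite !mxE; case: i => [[|[|]]] //; case: j => [[|[|]]].
Qed.

Lemma mx2_diagX a d n : (mx2 a 0 0 d) ^+ n = mx2 (a ^+ n) 0 0 (d ^+ n).
Proof.
elim: n => [|n IH]; first by rewrite !expr0 mx2_1.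
by rewrite !exprS IH mx2M !(mul0r, mulr0, addr0, add0r).
Qed.

(** The first coordinate of M (1, 1)^T. *)
Definition row0_sum (M : 'M[k]_2) : k^o := M 0 0 + M 0 1.

Lemma row0_sum_linear : linear row0_sum.
Proof. by move=> c M N; rewrite /row0_sum !mxE addrACA -mulrDr. Qed.

Definition entry00 (M : 'M[k]_2) : k^o := M 0 0.

Lemma entry00_linear : linear entry00.
Proof. by move=> c M N; rewrite /entry00 !mxE. Qed.

End Mx2.

Section Aminus.
Variables (k : numFieldType) (lam : k) (e : nat) (A : algType k).
Variable x : aminus_gen -> A.
Hypothesis hA : is_aminus lam e x.
Local Notation q := (lam ^+ e).
Local Notation u := (x Gen_u).
Local Notation v := (x Gen_v).

Lemma aminus_uv : u ^+ 2 = q *: v ^+ 2.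
Proof. by case: hA. Qed.

Lemma aminus_rep (B : algType k) (U V : B) : U ^+ 2 = q *: V ^+ 2 ->
  exists f : {lrmorphism A -> B}, f u = U /\ f v = V.
Proof.
move=> UV; case: hA => _ /(_ B (fun g => if g is Gen_u then U else V) UV) [f [fg _]].
by exists f; split; [exact: (fg Gen_u)|exact: (fg Gen_v)].
Qed.

Definition aminus_left_ind := presented_left_ind (@aminus_rel_inj k lam e) hA.

Variable s : k.
Hypotheses (s0 : s != 0) (s2 : s ^+ 2 = q).
Let two0 : (2%:R : k) != 0. Proof. by rewrite pnatr_eq0. Qed.

(** With s^2 = q, these diagonalise the quadratic form u^2 - q v^2. *)
Definition aX : A := u - s *: v.
Definition aY : A := u + s *: v.

Lemma aXaY : aX * aY = s *: (u * v - v * u).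
Proof.
rewrite /aX /aY mulrBl !mulrDr -!scalerAr -!scalerAl scalerA -!expr2 s2 -aminus_uv.
by rewrite (addrC (u ^+ 2)) opprD addrACA subrr addr0 scalerBr.
Qed.

Lemma aYaX : aY * aX = -1 *: (aX * aY).
Proof.
rewrite aXaY scaleN1r -scalerN opprB /aX /aY mulrDl !mulrBr -!scalerAr -!scalerAl.
rewrite scalerA -!expr2 s2 -aminus_uv scalerBr.
by rewrite addrC addrA subrK.
Qed.

(** X and Y act by a J and b K, where J = diag(1, -1) and K, the exchange of the
    two basis vectors, anticommute.  As (1, 0) J = (1, 0) and
    K (1, 1)^T = (1, 1)^T, the functional [row0_sum] takes the value a^i b^j on
    X^i Y^j. *)
Lemma aminus_mon_eval (a b : k) : exists f : {linear A -> k^o},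
  forall i j, f (aX ^+ i * aY ^+ j) = a ^+ i * b ^+ j.
Proof.
pose J : 'M[k]_2 := mx2 1 0 0 (-1); pose K : 'M[k]_2 := mx2 0 1 1 0.
(* u = (X + Y)/2 and v = (Y - X)/(2s). *)
pose U : 'M[k]_2 := 2%:R^-1 *: (a *: J + b *: K).
pose W : 'M[k]_2 := (2%:R * s)^-1 *: (b *: K - a *: J).
have [f [fu fv]] : exists f : {lrmorphism A -> 'M[k]_2}, f u = U /\ f v = W.
  apply: aminus_rep; rewrite -s2 !exprZn /U /W -scaleN1r !mx2Z !mx2D !expr2 !mx2M.
  rewrite !mx2Z /=.
  by congr mx2; field; rewrite ?two0 ?s0.
have fX : f aX = a *: J.
  rewrite linearB linearZ /= fu fv /U /W -!scaleN1r !(mx2Z, mx2D).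
  by congr mx2; field; rewrite ?two0 ?s0.
have fY : f aY = b *: K.
  rewrite linearD linearZ /= fu fv /U /W -!scaleN1r !(mx2Z, mx2D).
  by congr mx2; field; rewrite ?two0 ?s0.
have L : linear (fun z => row0_sum (f z) : k^o).
  by move=> c y z; rewrite linearP row0_sum_linear.
exists (mk_linear L) => i j /=.
rewrite rmorphM !rmorphXn /= fX fY !exprZn -scalerAl -scalerAr scalerA.
have r0Z c M : row0_sum (c *: M) = c * (row0_sum M : k) :> k.
  by rewrite /row0_sum !mxE mulrDr.
rewrite r0Z -[RHS]mulr1; congr (_ * _).
have row0_J M : row0_sum (J ^+ i * M) = row0_sum M.
  rewrite mx2_diagX expr1n /row0_sum -mulmxE !mxE !big_ord_recl !big_ord0 !mxE /=.
  by rewrite !mul1r !mul0r !addr0.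
rewrite row0_J; elim: j => [|j IH]; first by rewrite /row0_sum expr0 !mxE addr0.
rewrite -IH exprSr /row0_sum -mulmxE !mxE !big_ord_recl !big_ord0 !mxE /=.
rewrite !mulr1 !mulr0 !addr0 add0r addrC; congr (_ + _).
by congr (fun_of_matrix _ _ _); apply: val_inj.
Qed.

Let uE : u = 2%:R^-1 *: (aX + aY).
Proof.
rewrite /aX /aY addrACA addNr addr0 -mulr2n -scaler_nat scalerA mulVf ?scale1r //.
Qed.

Let vE : v = (2%:R * s)^-1 *: (aY - aX).
Proof.
rewrite /aX /aY opprB addrC addrA subrK -mulr2n -scaler_nat !scalerA.
by rewrite -mulrA mulVf ?scale1r // mulf_neq0.
Qed.

Let aYXn i : aY * aX ^+ i = (-1) ^+ i *: (aX ^+ i * aY).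
Proof.
elim: i => [|i IH]; first by rewrite !expr0 mulr1 mul1r scale1r.
by rewrite exprS mulrA aYaX -scalerAl -(mulrA aX aY) IH -scalerAr scalerA mulrA (exprS (-1)).
Qed.

Let mulL (c : A) : linear (fun z => c * z).
Proof. by move=> a y z; rewrite mulrDr scalerAr. Qed.

Lemma aminus_span b : lspan (fun z => exists i j, z = aX ^+ i * aY ^+ j) b.
Proof.
set S := fun z => _.
have SX z : lspan S z -> lspan S (aX * z).
  apply: (lspan_map (mulL aX)) => _ [i [j ->]]; apply: lspan_gen.
  by exists i.+1, j; rewrite exprS mulrA.
have SY z : lspan S z -> lspan S (aY * z).
  apply: (lspan_map (mulL aY)) => _ [i [j ->]]; rewrite mulrA aYXn -scalerAl.
  by apply/lspanZ/lspan_gen; exists i, j.+1; rewrite -mulrA -exprS.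
elim/aminus_left_ind: b => [|c y z Sy Sz|[] z Sz].
- by apply: lspan_gen; exists 0%N, 0%N; rewrite mulr1.
- exact: lspanP.
- rewrite uE -scalerAl mulrDl; apply/lspanZ/lspanD; [exact: SX|exact: SY].
rewrite vE -scalerAl mulrBl; apply: lspanZ; rewrite -scaleN1r addrC.
by apply: lspanP; [exact: SX|exact: SY].
Qed.

(** The grading by words in u and v agrees with the grading by degree in X and Y,
    since X, Y and u, v are linear combinations of each other. *)
Lemma aminus_quantum_plane :
  inhabited (quantum_plane aX aY (-1) 1 1 (aminus_grading x)).
Proof.
have [|coef [coefE span]] := coordinates aminus_span.
  by move=> a b _ _; exact: aminus_mon_eval.
pose gr0 (n : nat) : set A :=
  fun b => forall i j, (1 * i + 1 * j)%N != n -> coef i j b = 0.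
have N10 : (-1 : k) != 0 by rewrite oppr_eq0 oner_eq0.
have gr0E n b : gr0 n b <-> forall i j, (1 * i + 1 * j)%N != n -> coef i j b = 0 by [].
pose qp := QuantumPlane N10 (ltn0Sn 0) (ltn0Sn 0) aYaX coefE span gr0E.
suff -> : aminus_grading x = gr0 by constructor.
have g1 : gr0 1 u /\ gr0 1 v.
  have gX := grZX qp; have gY := grZY qp; split.
    by rewrite uE; apply: (grZZ qp (t := 1)); exact: (grZD qp (t := 1)).
  rewrite vE; apply: (grZZ qp (t := 1)); rewrite -scaleN1r.
  by apply: (grZD qp (t := 1)) => //; exact: (grZZ qp (t := 1)).
apply: funext => n; apply: funext => b; apply: propext; split.
  move/in_spanP; elim=> [|c y z yw _ IH]; first exact: (grZ0 qp n%:Z).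
  apply: (grZD qp (t := n%:Z)) => //; apply: (grZZ qp (t := n%:Z)).
  elim: n y yw {IH} => [|n IH] y.
    rewrite /= inE => /eqP -> ; have := grZmon qp 0 0.
    by rewrite mulr1.
  move=> /allpairsPdep[y1 [y2 [y1uv /IH gy2 ->]]].
  have := @grZM _ _ _ _ _ _ _ _ qp 1 n%:Z y1 y2; apply=> //.
  by case: g1 => gu gv; move: y1uv; rewrite !inE => /orP[] /eqP ->.
move=> gb; apply/in_spanP.
have TS c n' z : (forall w, w \in words [:: u; v] n' -> lspan (fun y => y \in words [:: u; v] n'.+1) (c * w)) ->
    lspan (fun y => y \in words [:: u; v] n') z ->
    lspan (fun y => y \in words [:: u; v] n'.+1) (c * z).
  by move=> h; apply: (lspan_map (mulL c)).
have Su n' w : w \in words [:: u; v] n' -> u * w \in words [:: u; v] n'.+1.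
  by move=> wn; apply: allpairs_f => //; rewrite mem_head.
have Sv n' w : w \in words [:: u; v] n' -> v * w \in words [:: u; v] n'.+1.
  by move=> wn; apply: allpairs_f => //; rewrite !inE eqxx orbT.
have SX n' z : lspan (fun y => y \in words [:: u; v] n') z ->
    lspan (fun y => y \in words [:: u; v] n'.+1) (aX * z).
  apply: TS => w wn; rewrite mulrBl -scaleN1r addrC; apply: lspanP.
    by rewrite -scalerAl; apply/lspanZ/lspan_gen/Sv.
  exact/lspan_gen/Su.
have SY n' z : lspan (fun y => y \in words [:: u; v] n') z ->
    lspan (fun y => y \in words [:: u; v] n'.+1) (aY * z).
  apply: TS => w wn; rewrite mulrDl; apply: lspanD; first exact/lspan_gen/Su.
  by rewrite -scalerAl; apply/lspanZ/lspan_gen/Sv.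
apply: (@grZ_ind _ _ _ _ _ _ _ _ qp n%:Z _ _ _ _ b gb); first exact: lspan0.
- by move=> *; exact: lspanD.
move=> c i j [<-]; apply: lspanZ; rewrite !mul1n.
elim: i => [|i IH]; last by rewrite exprS -mulrA; exact: SX.
rewrite expr0 mul1r add0n; elim: j => [|j IH]; last by rewrite exprS; exact: SY.
by apply: lspan_gen; rewrite /= mem_head.
Qed.

End Aminus.

(** * The algebra A_4m: normal form and semisimplicity *)

Lemma masuoka_rel_inj (k : fieldType) (m : nat) (A B : algType k)
    (f : {lrmorphism B -> A}) (b : masuoka_gen -> B) :
  injective f -> masuoka_rel m (f \o b) -> masuoka_rel m b.
Proof.
move=> f_inj [[h1 h2] h3 h4 h5 h6]; split; first split.
all: by apply: f_inj; rewrite ?(rmorphM, rmorphXn, rmorph1).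
Qed.

Section MasuokaAlgebra.
Variables (k : numFieldType) (m : nat) (H : algType k) (g : masuoka_gen -> H).
Hypothesis m_gt0 : (0 < m)%N.
Hypothesis presH : presented_by (masuoka_rel (k := k) m) g.
Local Notation a := (g Gen_a).
Local Notation sp := (g Gen_sp).
Local Notation sm := (g Gen_sm).

(** The rotation of order m of the dihedral group generated by the two
    reflections.  It is locked so that rewriting does not look inside its
    powers. *)
Definition masuoka_c : H := locked (sp * sm).
Local Notation c := masuoka_c.

Lemma masuoka_cE : c = sp * sm.
Proof. by rewrite /masuoka_c -lock. Qed.

Lemma masuoka_asp : a * sp = sp * a. Proof. by case: presH => -[[]]. Qed.
Lemma masuoka_asm : a * sm = sm * a. Proof. by case: presH => -[[]]. Qed.
Lemma masuoka_aa : a * a = 1. Proof. by case: presH => -[] *; rewrite -expr2. Qed.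
Lemma masuoka_spsp : sp * sp = 1. Proof. by case: presH => -[] *; rewrite -expr2. Qed.
Lemma masuoka_smsm : sm * sm = 1. Proof. by case: presH => -[] *; rewrite -expr2. Qed.
Lemma masuoka_cm : c ^+ m = 1. Proof. by rewrite masuoka_cE; case: presH => -[]. Qed.

Lemma masuoka_ac : a * c = c * a.
Proof. by rewrite masuoka_cE mulrA masuoka_asp -!mulrA masuoka_asm. Qed.

Lemma masuoka_sm : sm = sp * c.
Proof. by rewrite masuoka_cE mulrA masuoka_spsp mul1r. Qed.

Lemma masuoka_spc : sp * c = c ^+ m.-1 * sp.
Proof.
have cinj y z : c * y = c * z -> y = z.
  move=> e; rewrite -[y]mul1r -[z]mul1r -masuoka_cm -(prednK m_gt0) exprSr.
  by rewrite -!mulrA e.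
apply: cinj; rewrite [RHS]mulrA -exprS prednK // masuoka_cm mul1r.
by rewrite -masuoka_sm masuoka_cE -mulrA masuoka_smsm mulr1.
Qed.

Definition masuoka_ind := presented_ind (@masuoka_rel_inj k m) presH.
Definition masuoka_left_ind := presented_left_ind (@masuoka_rel_inj k m) presH.

Local Notation hc := (horner_alg c).

Lemma masuoka_a_hc f : a * hc f = hc f * a.
Proof.
elim/poly_ind: f => [|f z IH]; first by rewrite raddf0 mulr0 mul0r.
rewrite rmorphD rmorphM /= horner_algX horner_algC mulrDr mulrDl mulrA IH.
by rewrite -!mulrA masuoka_ac mulr_algr mulr_algl.
Qed.

Lemma masuoka_sp_hc f : sp * hc f = hc (f \Po 'X^(m.-1)) * sp.
Proof.
elim/poly_ind: f => [|f z IH]; first by rewrite comp_poly0 raddf0 mulr0 mul0r.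
rewrite comp_polyD comp_polyM comp_polyC comp_polyX !rmorphD !rmorphM /=.
rewrite rmorphXn /= horner_algX !horner_algC mulrDr mulrDl mulrA IH.
by rewrite -!mulrA masuoka_spc mulr_algr mulr_algl.
Qed.

Lemma masuoka_normal_form h : exists f1 f2 f3 f4,
  h = hc f1 + hc f2 * sp + a * (hc f3 + hc f4 * sp).
Proof.
pose N h := exists f1 f2 f3 f4, h = hc f1 + hc f2 * sp + a * (hc f3 + hc f4 * sp).
have Nc z : N z -> N (c * z).
  move=> [f1 [f2 [f3 [f4 ->]]]]; exists ('X * f1), ('X * f2), ('X * f3), ('X * f4).
  rewrite !rmorphM /= horner_algX mulrDr [c * (a * _)]mulrA -masuoka_ac -mulrA.
  by rewrite !mulrDr !mulrA.
have Nsp z : N z -> N (sp * z).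
  move=> [f1 [f2 [f3 [f4 ->]]]].
  exists (f2 \Po 'X^(m.-1)), (f1 \Po 'X^(m.-1)), (f4 \Po 'X^(m.-1)), (f3 \Po 'X^(m.-1)).
  have spE f f' : sp * (hc f + hc f' * sp) =
      hc (f' \Po 'X^(m.-1)) + hc (f \Po 'X^(m.-1)) * sp.
    by rewrite mulrDr mulrA !masuoka_sp_hc -mulrA masuoka_spsp mulr1 addrC.
  by rewrite mulrDr spE mulrA -masuoka_asp -mulrA spE.
elim/masuoka_left_ind: h => [|z x y [f1 [f2 [f3 [f4 ->]]]] [h1 [h2 [h3 [h4 ->]]]]|[] z Nz].
- by exists 1, 0, 0, 0; rewrite rmorph1 !rmorph0 !mul0r !addr0 mulr0 addr0.
- exists (z *: f1 + h1), (z *: f2 + h2), (z *: f3 + h3), (z *: f4 + h4).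
  have hcP f f' : hc (z *: f + f') = z *: hc f + hc f' by rewrite rmorphD -mul_polyC rmorphM /= horner_algC mulr_algl.
  have T F1 F2 H1 H2 : (z *: F1 + H1) + (z *: F2 + H2) * sp =
      z *: (F1 + F2 * sp) + (H1 + H2 * sp).
    by rewrite mulrDl -scalerAl addrACA -scalerDr.
  have T' U U' W W' : z *: U + U' + a * (z *: W + W') =
      z *: (U + a * W) + (U' + a * W').
    by rewrite mulrDr -scalerAr addrACA -scalerDr.
  by rewrite !hcP !T T'.
- move: Nz => [f1 [f2 [f3 [f4 ->]]]]; exists f3, f4, f1, f2.
  by rewrite mulrDr mulrA masuoka_aa mul1r addrC.
- exact: Nsp.
- by rewrite masuoka_sm -mulrA; apply/Nsp/Nc.
Qed.

(** f is divisible by the product of the X - z^j, which is X^m - 1, and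
    c^m = 1. *)
Lemma masuoka_hc0 (z : k) (f : {poly k}) : m.-primitive_root z ->
  (forall j, f.[z ^+ j] = 0) -> hc f = 0.
Proof.
move=> zm f0; have : 'X^m - 1 %| f.
  rewrite -(factor_Xn_sub_1 zm).
  rewrite -(big_map (fun i => z ^+ i) xpredT (fun w => 'X - w%:P)) /=.
  apply: uniq_roots_dvdp.
    by apply/allP => _ /mapP[j _ ->]; rewrite rootE f0.
  rewrite uniq_rootsE map_inj_in_uniq ?iota_uniq // => i j.
  rewrite !mem_index_iota => im jm /eqP.
  by rewrite (eq_prim_root_expr zm) !modn_small // => /eqP.
case/dvdpP => r ->; rewrite rmorphM rmorphB rmorph1 rmorphXn /= horner_algX.
by rewrite masuoka_cm subrr mulr0.
Qed.

(** Maschke's argument: a linear projection onto a left ideal I is averaged over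
    the powers of c, then over 1 and s_+, then over 1 and a.  The result is
    linear over the generators, and its kernel is a complement of I. *)
Lemma masuoka_semisimple : semisimple_ring H.
Proof.
move=> I [I0 ID IM].
have IZ (z : k) x : I x -> I (z *: x) by move=> Ix; rewrite -mulr_algl; exact: IM.
have Ilin (z : k) x y : I x -> I y -> I (z *: x + y).
  by move=> Ix Iy; apply: ID => //; exact: IZ.
have [K [e [crd [crdI crd0 _]]]] := complement_basis I0 Ilin.
have Isum n (F : 'I_n -> H) : (forall i, I (F i)) -> I (\sum_i F i).
  by move=> h; apply: big_ind.
pose p0 (x : H) := x - free_lift e (crd x).
have p0L z x y : p0 (z *: x + y) = z *: p0 x + p0 y.
  by rewrite /p0 !linearP /= addrACA -scalerDr.
have p0I x : I (p0 x) by exact: crdI.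
have p0id x : I x -> p0 x = x by move=> Ix; rewrite /p0 crd0 // linear0 subr0.
clearbody p0.
pose p1 x := m%:R^-1 *: \sum_(j < m) c ^+ (m - j) * p0 (c ^+ j * x).
have mR : (m%:R : k) != 0 by rewrite pnatr_eq0 -lt0n.
have p1L z x y : p1 (z *: x + y) = z *: p1 x + p1 y.
  rewrite /p1 scalerA mulrC -scalerA -scalerDr; congr (_ *: _).
  rewrite scaler_sumr -big_split; apply: eq_bigr => j _ /=.
  by rewrite mulrDr -scalerAr p0L mulrDr -scalerAr.
have p1I x : I (p1 x) by apply/IZ/Isum => j; exact: IM.
have p1id x : I x -> p1 x = x.
  move=> Ix; rewrite /p1; under eq_bigr => j _.
    rewrite p0id; last exact: IM.
    rewrite mulrA -exprD subnK; last exact: ltnW.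
    rewrite masuoka_cm mul1r.
    over.
  by rewrite sumr_const card_ord -scaler_nat scalerA mulVf // scale1r.
have p1c x : p1 (c * x) = c * p1 x.
  rewrite /p1 -scalerAr; congr (_ *: _); rewrite mulr_sumr.
  pose G j := c ^+ (m - j).+1 * p0 (c ^+ j * x).
  transitivity (\sum_(j < m) G j.+1).
    by apply: eq_bigr => j _; rewrite /G subnSK // [in RHS]exprSr -mulrA.
  transitivity (\sum_(j < m) G j); last first.
    by apply: eq_bigr => j _; rewrite /G exprS mulrA.
  (* The terms are indexed cyclically: G m = G 0. *)
  apply: (addIr (G 0)); rewrite addrC -(big_ord_recl _ (fun j : 'I_m.+1 => G j)) big_ord_recr /=.
  by congr (_ + _); rewrite /G subnn subn0 (exprSr c m) masuoka_cm expr1 expr0 !mul1r.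
clearbody p1.
pose p2 x := 2%:R^-1 *: (p1 x + sp * p1 (sp * x)).
have two0 : (2%:R : k) != 0 by rewrite pnatr_eq0.
have half x : 2%:R^-1 *: (x + x) = x :> H.
  by rewrite -mulr2n -scaler_nat scalerA mulVf // scale1r.
have avgL (t : H) (p : H -> H) : (forall z x y, p (z *: x + y) = z *: p x + p y) ->
    forall z x y, 2%:R^-1 *: (p (z *: x + y) + t * p (t * (z *: x + y))) =
      z *: (2%:R^-1 *: (p x + t * p (t * x))) + 2%:R^-1 *: (p y + t * p (t * y)).
  move=> pL z x y; rewrite scalerA mulrC -scalerA -scalerDr; congr (_ *: _).
  by rewrite mulrDr -scalerAr !pL mulrDr -scalerAr addrACA scalerDr.
have p2L z x y : p2 (z *: x + y) = z *: p2 x + p2 y by exact: (avgL sp p1 p1L).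
have p2I x : I (p2 x) by apply/IZ/ID => //; exact: IM.
have p2id x : I x -> p2 x = x.
  by move=> Ix; rewrite /p2 !p1id ?mulrA ?masuoka_spsp ?mul1r ?half //; exact: IM.
have p1cX j x : p1 (c ^+ j * x) = c ^+ j * p1 x.
  by elim: j => [|j IH]; rewrite ?expr0 ?mul1r // exprS -mulrA p1c IH mulrA.
have p2sp x : p2 (sp * x) = sp * p2 x.
  rewrite /p2 -scalerAr; congr (_ *: _).
  by rewrite mulrDr !mulrA masuoka_spsp !mul1r addrC.
(* The second averaging keeps linearity over c because s_+ inverts c. *)
have p2c x : p2 (c * x) = c * p2 x.
  rewrite /p2 -scalerAr mulrDr p1c; congr (_ *: (_ + _)).
  rewrite mulrA masuoka_spc -mulrA p1cX !mulrA; congr (_ * _).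
  have cc : c * (c ^+ m.-1) = 1 by rewrite -exprS prednK // masuoka_cm.
  have e' : c * sp * c = sp.
    by rewrite -mulrA masuoka_spc mulrA cc mul1r.
  by rewrite -{1}e' -mulrA cc mulr1.
clearbody p2.
pose p3 x := 2%:R^-1 *: (p2 x + a * p2 (a * x)).
have p3I x : I (p3 x) by apply/IZ/ID => //; exact: IM.
have p3id x : I x -> p3 x = x.
  by move=> Ix; rewrite /p3 !p2id ?mulrA ?masuoka_aa ?mul1r ?half //; exact: IM.
have p3L z x y : p3 (z *: x + y) = z *: p3 x + p3 y by exact: (avgL a p2 p2L).
have p3comm t : a * t = t * a -> (forall x, p2 (t * x) = t * p2 x) ->
    forall x, p3 (t * x) = t * p3 x.
  move=> at_ tp x; rewrite /p3 -scalerAr mulrDr tp; congr (_ *: (_ + _)).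
  by rewrite mulrA at_ -mulrA tp !mulrA at_.
have p3a x : p3 (a * x) = a * p3 x.
  rewrite /p3 -scalerAr; congr (_ *: _).
  by rewrite mulrDr !mulrA masuoka_aa !mul1r addrC.
clearbody p3.
have p3M h x : p3 (h * x) = h * p3 x.
  elim/masuoka_ind: h x => [x|z y t IHy IHt x|y t IHy IHt x|[] x] /=.
  - by rewrite !mul1r.
  - by rewrite !mulrDl -!scalerAl -IHy -IHt; exact: p3L.
  - by rewrite -!mulrA IHy IHt.
  - exact: p3a.
  - exact: p3comm masuoka_asp p2sp x.
  - rewrite masuoka_sm -!mulrA; rewrite (p3comm _ masuoka_asp p2sp).
    by rewrite (p3comm _ masuoka_ac p2c).
have p3_0 : p3 0 = 0 by have := p3M 0 0; rewrite !mul0r.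
have p3D x y : p3 (x + y) = p3 x + p3 y by have := p3L 1 x y; rewrite !scale1r.
exists (fun x => p3 x = 0); split=> [|x|x Ix <-]; last by rewrite p3id.
  split=> [//|x y x0 y0|h x x0]; first by rewrite p3D x0 y0 addr0.
  by rewrite p3M x0 mulr0.
exists (p3 x), (x - p3 x); split=> //; last by rewrite subrKC.
apply: (addIr (p3 x)); rewrite add0r.
by have := p3D (x - p3 x) (p3 x); rewrite subrK (p3id (p3 x)) // => <-.
Qed.

End MasuokaAlgebra.

(** * The action of A_4m on A^- is faithful *)

Section Action.
Variables (k : numFieldType) (m : nat) (lam : k) (e : nat).
Variables (H : algType k) (hH : hopf_structure H) (g : masuoka_gen -> H).
Hypothesis hg : is_masuoka m hH g.
Variables (A : algType k) (x : aminus_gen -> A).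
Hypothesis hA : is_aminus lam e x.
Variable act : module_algebra hH A.
Hypothesis hact : acts_by_pi lam e g act x.
Hypothesis modd : odd m.
Hypothesis m_gt1 : (1 < m)%N.
Local Notation q := (lam ^+ e).
Hypothesis qprim : m.-primitive_root q.
Local Notation u := (x Gen_u).
Local Notation v := (x Gen_v).
Local Notation a := (g Gen_a).
Local Notation sp := (g Gen_sp).
Local Notation sm := (g Gen_sm).
Local Notation c := (masuoka_c g).
Local Notation hc := (horner_alg c).

Let two0 : (2%:R : k) != 0. Proof. by rewrite pnatr_eq0. Qed.

Lemma m_gt0 : (0 < m)%N.
Proof. exact: prim_order_gt0 qprim. Qed.

Lemma masuoka_pres : presented_by (masuoka_rel (k := k) m) g.
Proof. by case: hg. Qed.

Lemma q_neq0 : q != 0.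
Proof.
have qm := prim_expr_order qprim; apply: contraTneq isT => q0; move: qm.
by rewrite q0 expr0n gtn_eqF ?m_gt0 // => /eqP; rewrite eq_sym oner_eq0.
Qed.

Lemma actDl h h' z : act (h + h') z = act h z + act h' z.
Proof. by have := hact_linearl act z 1 h h'; rewrite !scale1r. Qed.

Lemma act0l z : act 0 z = 0.
Proof. by apply: (addIr (act 0 z)); rewrite -actDl !add0r. Qed.

Lemma actZl y h z : act (y *: h) z = y *: act h z.
Proof. by have := hact_linearl act z y h 0; rewrite act0l !addr0. Qed.

Lemma actDr h y z : act h (y + z) = act h y + act h z.
Proof. by have := hact_linear act h 1 y z; rewrite !scale1r. Qed.

Lemma act0r h : act h 0 = 0.
Proof. by apply: (addIr (act h 0)); rewrite -actDr !add0r. Qed.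

Lemma actZr h y z : act h (y *: z) = y *: act h z.
Proof. by have := hact_linear act h y z 0; rewrite act0r !addr0. Qed.

(** The right-hand side is bilinear in the components of the coproduct, so any
    representative of the tensor may be used. *)
Lemma act_comult h s y z : tens_eq (comult hH h) s ->
  act h (y * z) = \sum_(p <- s) act p.1 y * act p.2 z.
Proof.
move=> hs; rewrite hactM; apply: (hs A (fun h1 h2 => act h1 y * act h2 z)).
  by move=> h1 d h2 h3; rewrite actDl actZl mulrDr scalerAr.
by move=> h2 d h1 h3; rewrite actDl actZl mulrDl scalerAl.
Qed.

Lemma act_aM y z : act a (y * z) = act a y * act a z.
Proof. by case: hg => _ [ha _] _ _ _; rewrite (act_comult _ _ ha) big_seq1. Qed.

Lemma act_a_sp z : act a (act sp z) = act sp (act a z).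
Proof. by rewrite -!hactMl (masuoka_asp masuoka_pres). Qed.

Lemma act_a_sm z : act a (act sm z) = act sm (act a z).
Proof. by rewrite -!hactMl (masuoka_asm masuoka_pres). Qed.

Lemma act_a_u : act a u = - u. Proof. by case: hact => _ _ []. Qed.
Lemma act_a_v : act a v = - v. Proof. by case: hact => _ _ []. Qed.
Lemma act_sp_u : act sp u = v. Proof. by case: hact => -[]. Qed.
Lemma act_sp_v : act sp v = u. Proof. by case: hact => -[]. Qed.
Lemma act_sm_u : act sm u = q *: v. Proof. by case: hact => _ []. Qed.
Lemma act_sm_v : act sm v = q^-1 *: u. Proof. by case: hact => _ [_ ->]. Qed.

Let half (z : A) : 2%:R^-1 *: (z + z) = z.
Proof. by rewrite -mulr2n -scaler_nat scalerA mulVf // scale1r. Qed.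

Let e0E h z : act (2%:R^-1 *: (1 + a) * h) z = 2%:R^-1 *: (act h z + act a (act h z)).
Proof. by rewrite -scalerAl mulrDl mul1r actZl actDl hactMl. Qed.

Let e1E h z : act (2%:R^-1 *: (1 - a) * h) z = 2%:R^-1 *: (act h z - act a (act h z)).
Proof. by rewrite -scalerAl mulrBl mul1r actZl actDl -mulNr -scaleN1r -scalerAl actZl hactMl scaleN1r. Qed.

(** Even and odd refer to the length of words: a acts on both generators by
    -1. *)
Definition even z := act a z = z.
Definition odd_elt z := act a z = - z.

(** The coproduct of s_+ is s_+ (x) e0 s_+ + s_- (x) e1 s_+, and e0, e1 project
    onto the even and the odd part.  So s_+ is multiplicative when the right
    factor is even, and acts on the left factor through s_- when it is odd; the
    roles are exchanged for s_-. *)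
Lemma act_spE y z : act sp (y * z) =
  act sp y * (2%:R^-1 *: (act sp z + act sp (act a z))) +
  act sm y * (2%:R^-1 *: (act sp z - act sp (act a z))).
Proof.
case: hg => _ _ [hp _] _ _.
by rewrite (act_comult _ _ hp) big_cons big_seq1 /= e0E e1E act_a_sp.
Qed.

Lemma act_smE y z : act sm (y * z) =
  act sm y * (2%:R^-1 *: (act sm z + act sm (act a z))) +
  act sp y * (2%:R^-1 *: (act sm z - act sm (act a z))).
Proof.
case: hg => _ _ [_ hm] _ _.
by rewrite (act_comult _ _ hm) big_cons big_seq1 /= e0E e1E act_a_sm.
Qed.

Lemma act_sp_even y z : even z -> act sp (y * z) = act sp y * act sp z.
Proof. by move=> ez; rewrite act_spE ez half subrr scaler0 mulr0 addr0. Qed.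

Lemma act_sm_even y z : even z -> act sm (y * z) = act sm y * act sm z.
Proof. by move=> ez; rewrite act_smE ez half subrr scaler0 mulr0 addr0. Qed.

Let actN h z : act h (- z) = - act h z.
Proof. by rewrite -scaleN1r actZr scaleN1r. Qed.

Lemma act_sp_odd y z : odd_elt z -> act sp (y * z) = act sm y * act sp z.
Proof. by move=> ez; rewrite act_spE ez actN subrr scaler0 mulr0 add0r opprK half. Qed.

Lemma act_sm_odd y z : odd_elt z -> act sm (y * z) = act sp y * act sm z.
Proof. by move=> ez; rewrite act_smE ez actN subrr scaler0 mulr0 add0r opprK half. Qed.

Lemma evenM y z : even y -> even z -> even (y * z).
Proof. by move=> ey ez; rewrite /even act_aM ey ez. Qed.

Lemma even1 : even 1.
Proof. by case: hg => _ [_ ca] _ _ _; rewrite /even hact1 ca scale1r. Qed.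

Lemma evenX z n : even z -> even (z ^+ n).
Proof. by move=> ez; elim: n => [|n IH]; [exact: even1|rewrite exprS; exact: evenM]. Qed.

Local Notation w := (u ^+ 2).
Local Notation P := (u * v).
Local Notation Q := (v * u).

Lemma odd_u : odd_elt u. Proof. exact: act_a_u. Qed.
Lemma odd_v : odd_elt v. Proof. exact: act_a_v. Qed.

Lemma oddM y z : odd_elt y -> odd_elt z -> even (y * z).
Proof. by move=> oy oz; rewrite /even act_aM oy oz mulrNN. Qed.

Lemma even_w : even w. Proof. exact: oddM odd_u odd_u. Qed.
Lemma even_P : even P. Proof. exact: oddM odd_u odd_v. Qed.
Lemma even_Q : even Q. Proof. exact: oddM odd_v odd_u. Qed.

Lemma even_oddM y z : even y -> odd_elt z -> odd_elt (y * z).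
Proof. by move=> ey oz; rewrite /odd_elt act_aM ey oz mulrN. Qed.

Lemma wE : w = q *: v ^+ 2. Proof. exact: aminus_uv hA. Qed.

Lemma act_sp_w : act sp w = w.
Proof. by rewrite (act_sp_odd _ odd_u) act_sm_u act_sp_u -scalerAl -expr2 -wE. Qed.

Lemma act_sm_w : act sm w = w.
Proof. by rewrite (act_sm_odd _ odd_u) act_sm_u act_sp_u -scalerAr -expr2 -wE. Qed.

Lemma act_sp_P : act sp P = q *: Q.
Proof. by rewrite (act_sp_odd _ odd_v) act_sm_u act_sp_v -scalerAl. Qed.
Lemma act_sp_Q : act sp Q = q^-1 *: P.
Proof. by rewrite (act_sp_odd _ odd_u) act_sm_v act_sp_u -scalerAl. Qed.
Lemma act_sm_P : act sm P = q^-1 *: Q.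
Proof. by rewrite (act_sm_odd _ odd_v) act_sm_v act_sp_u -scalerAr. Qed.
Lemma act_sm_Q : act sm Q = q *: P.
Proof. by rewrite (act_sm_odd _ odd_u) act_sm_u act_sp_v -scalerAr. Qed.

Let counit1 h : h \in [:: sp; sm] -> act h 1 = 1.
Proof.
by case: hg => _ _ _ [cp cm] _; rewrite !inE hact1 => /orP[] /eqP ->; rewrite ?cp ?cm scale1r.
Qed.

Lemma act_spX z n : even z -> act sp (z ^+ n) = act sp z ^+ n.
Proof.
move=> ez; elim: n => [|n IH]; first by rewrite counit1 // mem_head.
by rewrite !exprSr (act_sp_even _ ez) IH.
Qed.

Lemma act_smX z n : even z -> act sm (z ^+ n) = act sm z ^+ n.
Proof.
move=> ez; elim: n => [|n IH]; first by rewrite counit1 // !inE eqxx orbT.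
by rewrite !exprSr (act_sm_even _ ez) IH.
Qed.

Lemma act_cE z : act c z = act sp (act sm z).
Proof. by rewrite masuoka_cE hactMl. Qed.

Lemma act_sp_Pn n : act sp (P ^+ n) = q ^+ n *: Q ^+ n.
Proof. by rewrite act_spX ?act_sp_P ?exprZn //; exact: even_P. Qed.
Lemma act_sp_Qn n : act sp (Q ^+ n) = q^-1 ^+ n *: P ^+ n.
Proof. by rewrite act_spX ?act_sp_Q ?exprZn //; exact: even_Q. Qed.
Lemma act_sm_Pn n : act sm (P ^+ n) = q^-1 ^+ n *: Q ^+ n.
Proof. by rewrite act_smX ?act_sm_P ?exprZn //; exact: even_P. Qed.
Lemma act_sm_Qn n : act sm (Q ^+ n) = q ^+ n *: P ^+ n.
Proof. by rewrite act_smX ?act_sm_Q ?exprZn //; exact: even_Q. Qed.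

Lemma act_c_Pn n : act c (P ^+ n) = q^-1 ^+ n.*2 *: P ^+ n.
Proof. by rewrite act_cE act_sm_Pn actZr act_sp_Qn scalerA -exprD addnn. Qed.
Lemma act_c_Qn n : act c (Q ^+ n) = q ^+ n.*2 *: Q ^+ n.
Proof. by rewrite act_cE act_sm_Qn actZr act_sp_Pn scalerA -exprD addnn. Qed.

Lemma act_sp_Pnu n : act sp (P ^+ n * u) = q^-1 ^+ n *: (Q ^+ n * v).
Proof. by rewrite (act_sp_odd _ odd_u) act_sm_Pn act_sp_u -scalerAl. Qed.
Lemma act_sp_Qnv n : act sp (Q ^+ n * v) = q ^+ n *: (P ^+ n * u).
Proof. by rewrite (act_sp_odd _ odd_v) act_sm_Qn act_sp_v -scalerAl. Qed.
Lemma act_sm_Pnu n : act sm (P ^+ n * u) = q ^+ n.+1 *: (Q ^+ n * v).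
Proof. by rewrite (act_sm_odd _ odd_u) act_sp_Pn act_sm_u -scalerAl -scalerAr scalerA -exprSr. Qed.
Lemma act_sm_Qnv n : act sm (Q ^+ n * v) = q^-1 ^+ n.+1 *: (P ^+ n * u).
Proof. by rewrite (act_sm_odd _ odd_v) act_sp_Qn act_sm_v -scalerAl -scalerAr scalerA -exprSr. Qed.

Lemma act_c_Pnu n : act c (P ^+ n * u) = q ^+ n.*2.+1 *: (P ^+ n * u).
Proof. by rewrite act_cE act_sm_Pnu actZr act_sp_Qnv scalerA -exprD addSn addnn. Qed.
Lemma act_c_Qnv n : act c (Q ^+ n * v) = q^-1 ^+ n.*2.+1 *: (Q ^+ n * v).
Proof. by rewrite act_cE act_sm_Qnv actZr act_sp_Pnu scalerA -exprD addSn addnn. Qed.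

(** On an eigenvector of c a polynomial in c acts by its value at the
    eigenvalue. *)
Lemma act_horner (z : k) f y : act c y = z *: y -> act (hc f) y = f.[z] *: y.
Proof.
move=> cy; elim/poly_ind: f => [|f d IH]; first by rewrite raddf0 act0l horner0 scale0r.
rewrite rmorphD rmorphM /= horner_algX horner_algC hornerMXaddC.
rewrite actDl hactMl cy actZr IH actZl hact1l scalerA -scalerDl.
by rewrite (mulrC z).
Qed.

(** The matrix units u = E_12 and v = E_21 satisfy u^2 = v^2 = 0, and separate
    P^n from Q^n and P^n u from Q^n v. *)
Lemma matrix_units_rep : exists f : {lrmorphism A -> 'M[k]_2},
  [/\ forall n, f (P ^+ n) = mx2 1 0 0 (0 ^+ n),
      forall n, f (Q ^+ n) = mx2 (0 ^+ n) 0 0 1,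
      f u = mx2 0 1 0 0 & f v = mx2 0 0 1 0].
Proof.
have [|f [fu fv]] := @aminus_rep _ _ _ _ _ hA _ (mx2 0 1 0 0 : 'M[k]_2) (mx2 0 0 1 0).
  by rewrite !expr2 !mx2M mx2Z !(mulr0, mul0r, addr0, add0r).
exists f; split=> // n; rewrite rmorphXn rmorphM /= fu fv mx2M.
  by rewrite !(mulr0, mul0r, addr0, add0r, mulr1) mx2_diagX expr1n.
by rewrite !(mulr0, mul0r, addr0, add0r, mulr1) mx2_diagX expr1n.
Qed.

Let mx2_inj (d1 d2 d3 d4 : k) : mx2 d1 d2 d3 d4 = 0 -> [/\ d1 = 0, d2 = 0, d3 = 0 & d4 = 0].
Proof.
move=> h; have E i j := congr1 (fun M : 'M[k]_2 => M i j) h.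
by split; [have := E 0 0|have := E 0 1|have := E 1 0|have := E 1 1]; rewrite !mxE.
Qed.

Lemma even_words_free n y z : y *: P ^+ n.+1 + z *: Q ^+ n.+1 = 0 -> y = 0 /\ z = 0.
Proof.
have [f [fP fQ _ _]] := matrix_units_rep; move/(congr1 f).
rewrite linearD !linearZ /= fP fQ linear0 !mx2Z mx2D !expr0n /=.
by rewrite !(mulr0, addr0, add0r, mulr1) => /mx2_inj[].
Qed.

Lemma odd_words_free n y z : y *: (P ^+ n * u) + z *: (Q ^+ n * v) = 0 -> y = 0 /\ z = 0.
Proof.
have [f [fP fQ fu fv]] := matrix_units_rep; move/(congr1 f).
rewrite linearD !linearZ !rmorphM /= fP fQ fu fv linear0 !mx2M !mx2Z mx2D.
by rewrite !(mulr0, mul0r, addr0, add0r, mulr1) => /mx2_inj[].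
Qed.

Let qV n : q^-1 ^+ n = q ^+ (n * m.-1).
Proof.
have qm := prim_expr_order qprim.
have -> : q^-1 = q ^+ m.-1.
  apply: (mulfI q_neq0); rewrite mulfV ?q_neq0 // -(exprS q) prednK ?m_gt0 //.
by rewrite -(exprM q) mulnC.
Qed.

Let qmod n n' : n = n' %[mod m] -> q ^+ n = q ^+ n'.
Proof. by move=> h; apply/eqP; rewrite (eq_prim_root_expr qprim); apply/eqP. Qed.

(* With m = 2d + 3, a product by m - 1 = 2d + 2 changes the sign modulo m;
   the right-hand sides show that both exponents are j modulo m. *)
Let index_even j d : ((j * d.+1 + d.+1.*2).+1.*2 * d.+1.*2 =
  j + (j * d.*2.+1 + d.+1.*2.*2) * d.+1.*2.+1)%N.
Proof. by rewrite -!muln2; nia. Qed.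

Let index_odd j d : ((j * d.+1 + d.+1).*2.+1 * d.+1.*2 =
  j + (j * d.*2.+1 + d.+1.*2) * d.+1.*2.+1)%N.
Proof. by rewrite -!muln2; nia. Qed.

(** In normal form h is f1(c) + f2(c) s_+ + a (f3(c) + f4(c) s_+).  The words
    P^n and Q^n are eigenvectors of c for q^(-2n) and q^(2n), the words P^n u and
    Q^n v for q^(2n+1) and its inverse.  Killing the even words makes f1 + f3 and
    f2 + f4 vanish at even powers of q, killing the odd words makes f1 - f3 and
    f2 - f4 vanish at odd powers.  As m is odd, either kind exhausts the m-th
    roots of unity, so all four combinations vanish at c. *)
Lemma act_faithful h : (forall z, act h z = 0) -> h = 0.
Proof.
move=> h0; have [f1 [f2 [f3 [f4 hE]]]] := masuoka_normal_form m_gt0 masuoka_pres h.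
pose d := m./2.
have md : m = d.*2.+1 by rewrite -[m]odd_double_half modd.
have d_gt0 : (0 < d)%N by lia.
have hz0 f := masuoka_hc0 masuoka_pres (z := q) (f := f) qprim.
have actE z : act (hc f1 + hc f2 * sp + a * (hc f3 + hc f4 * sp)) z =
    act (hc f1) z + act (hc f2) (act sp z) +
    act (hc f3) (act a z) + act (hc f4) (act sp (act a z)).
  rewrite [a * _]mulrDr [a * (hc f4 * sp)]mulrA !(masuoka_a_hc masuoka_pres).
  by rewrite -mulrA (masuoka_asp masuoka_pres) !actDl !hactMl addrA.
have ev n : (f1 + f3).[q^-1 ^+ n.+1.*2] = 0 /\ (f2 + f4).[q ^+ n.+1.*2] = 0.
  have := h0 (P ^+ n.+1); rewrite hE actE (evenX _ even_P) act_sp_Pn !actZr.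
  rewrite !(act_horner _ (act_c_Pn _)) !(act_horner _ (act_c_Qn _)) !scalerA => E.
  have : (f1 + f3).[q^-1 ^+ n.+1.*2] *: P ^+ n.+1 +
         (q ^+ n.+1 * (f2 + f4).[q ^+ n.+1.*2]) *: Q ^+ n.+1 = 0.
    by rewrite -[RHS]E !hornerD mulrDr !scalerDl addrACA addrA.
  case/even_words_free => -> /eqP; rewrite mulf_eq0 expf_eq0 (negbTE q_neq0) andbF /=.
  by move/eqP.
have od n : (f1 - f3).[q ^+ n.*2.+1] = 0 /\ (f2 - f4).[q^-1 ^+ n.*2.+1] = 0.
  have := h0 (P ^+ n * u); rewrite hE actE (even_oddM (evenX n even_P) odd_u) !actN.
  rewrite act_sp_Pnu !actZr.
  rewrite !(act_horner _ (act_c_Pnu _)) !(act_horner _ (act_c_Qnv _)) !scalerA => E.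
  have : (f1 - f3).[q ^+ n.*2.+1] *: (P ^+ n * u) +
         (q^-1 ^+ n * (f2 - f4).[q^-1 ^+ n.*2.+1]) *: (Q ^+ n * v) = 0.
    by rewrite -[RHS]E !hornerD !hornerN mulrDr !scalerDl mulrN !scaleNr addrACA addrA.
  case/odd_words_free => -> /eqP; rewrite mulf_eq0 expf_eq0 invr_eq0 (negbTE q_neq0) andbF /=.
  by move/eqP.
(* Every power q^j is reached: 2d = -1 and 2(d + 1) = 1 modulo m = 2d + 1. *)
have z13 : hc (f1 + f3) = 0.
  apply: hz0 => j; have [+ _] := ev (j * d + m.-1)%N; rewrite qV.
  congr (_.[_] = _); apply: qmod.
  have -> : ((j * d + m.-1).+1.*2 * m.-1 = j + (j * d.*2.-1 + d.*2.*2) * m)%N.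
    by rewrite md; case: d d_gt0 {md} => // d' _; exact: index_even.
  by rewrite addnC modnMDl.
have z24 : hc (f2 + f4) = 0.
  apply: hz0 => j; have [_ +] := ev (j * d.+1 + m.-1)%N.
  congr (_.[_] = _); apply: qmod.
  have -> : ((j * d.+1 + m.-1).+1.*2 = j + (j + 2) * m)%N by rewrite md; nia.
  by rewrite addnC modnMDl.
have y13 : hc (f1 - f3) = 0.
  apply: hz0 => j; have [+ _] := od (j * d.+1 + d)%N.
  congr (_.[_] = _); apply: qmod.
  have -> : ((j * d.+1 + d).*2.+1 = j + (j + 1) * m)%N by rewrite md; nia.
  by rewrite addnC modnMDl.
have y24 : hc (f2 - f4) = 0.
  apply: hz0 => j; have [_ +] := od (j * d + d)%N; rewrite qV.
  congr (_.[_] = _); apply: qmod.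
  have -> : ((j * d + d).*2.+1 * m.-1 = j + (j * d.*2.-1 + d.*2) * m)%N.
    by rewrite md; case: d d_gt0 {md} => // d' _; exact: index_odd.
  by rewrite addnC modnMDl.
have sub f f' : hc (f + f') = 0 -> hc (f - f') = 0 -> hc f = 0 /\ hc f' = 0.
  rewrite rmorphD rmorphB /= => /eqP; rewrite addr_eq0 => /eqP -> /eqP.
  rewrite -opprD oppr_eq0 -mulr2n -scaler_nat scaler_eq0 (negbTE two0) /= => /eqP ->.
  by rewrite oppr0.
have [e1 e3] := sub _ _ z13 y13; have [e2 e4] := sub _ _ z24 y24.
by rewrite hE e1 e2 e3 e4 !mul0r !addr0 mulr0 addr0.
Qed.

Lemma act_inner_faithful : inner_faithful act.
Proof. by move=> I _ IA h Ih; apply: act_faithful => z; exact: IA. Qed.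

End Action.

(** * Words in A^- *)

Section Words.
Variables (k : numFieldType) (lam : k) (e : nat) (A : algType k) (x : aminus_gen -> A).
Hypothesis hA : is_aminus lam e x.
Local Notation q := (lam ^+ e).
Hypothesis q0 : q != 0.
Local Notation u := (x Gen_u).
Local Notation v := (x Gen_v).
Local Notation w := (u ^+ 2).
Local Notation P := (u * v).
Local Notation Q := (v * u).

Let vvE : v * v = q^-1 *: w.
Proof. by rewrite (aminus_uv hA) scalerA mulVf // scale1r. Qed.

(** u^2 commutes with u, and with v since it is a multiple of v^2. *)
Lemma w_central z : w * z = z * w.
Proof.
elim/(presented_ind (@aminus_rel_inj k lam e) hA): z => [|d y z hy hz|y z hy hz|[]].
- by rewrite mulr1 mul1r.
- by rewrite mulrDr mulrDl -scalerAl -scalerAr hy hz.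
- by rewrite mulrA hy -mulrA hz mulrA.
- by rewrite -exprSr -exprS.
- by rewrite (aminus_uv hA) -scalerAl -scalerAr -exprSr -exprS.
Qed.

Lemma wX_central n z : w ^+ n * z = z * w ^+ n.
Proof. by apply: commr_sym; apply: commrX; rewrite /GRing.comm w_central. Qed.

Lemma v_Pn n : v * P ^+ n = Q ^+ n * v.
Proof.
elim: n => [|n IH]; first by rewrite mulr1 mul1r.
by rewrite exprSr mulrA IH exprSr -!mulrA.
Qed.

Lemma u_Qn n : u * Q ^+ n = P ^+ n * u.
Proof.
elim: n => [|n IH]; first by rewrite mulr1 mul1r.
by rewrite exprSr mulrA IH exprSr -!mulrA.
Qed.

Lemma u_PSn n : u * P ^+ n.+1 = w * (Q ^+ n * v).
Proof. by rewrite exprS -!mulrA v_Pn !mulrA. Qed.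

Lemma v_QSn n : v * Q ^+ n.+1 = q^-1 *: (w * (P ^+ n * u)).
Proof. by rewrite exprS -(mulrA v u) u_Qn mulrA vvE -scalerAl. Qed.

Lemma PQ_mul : P * Q = q^-1 *: w ^+ 2.
Proof. by rewrite mulrA -(mulrA u v v) vvE -scalerAr -scalerAl -w_central -mulrA -!expr2. Qed.

Lemma QP_mul : Q * P = q^-1 *: w ^+ 2.
Proof. by rewrite -mulrA (mulrA u u v) -[u * u]expr2 w_central mulrA vvE -scalerAl -expr2. Qed.

Lemma PQ_expn n : P ^+ n * Q ^+ n = q^-1 ^+ n *: w ^+ (2 * n).
Proof.
have cPQ : GRing.comm P Q by rewrite /GRing.comm PQ_mul QP_mul.
by rewrite -exprMn_comm // PQ_mul exprZn exprM.
Qed.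

Lemma QP_expn n : Q ^+ n * P ^+ n = q^-1 ^+ n *: w ^+ (2 * n).
Proof.
have cQP : GRing.comm Q P by rewrite /GRing.comm PQ_mul QP_mul.
by rewrite -exprMn_comm // QP_mul exprZn exprM.
Qed.

(** The equalities u Q^n = P^n u and v P^n = Q^n v hold in the free algebra; the
    other two, u P^n = Q^n u and v Q^n = P^n v, use that w is central. *)
Lemma PnQn_central n z : (P ^+ n + Q ^+ n) * z = z * (P ^+ n + Q ^+ n).
Proof.
have hu : u * (P ^+ n + Q ^+ n) = (P ^+ n + Q ^+ n) * u.
  rewrite mulrDr mulrDl u_Qn addrC; congr (_ + _).
  case: n => [|n]; first by rewrite mulr1 mul1r.
  by rewrite u_PSn w_central (exprSr Q n) -(mulrA (Q ^+ n) Q) -(mulrA v u u) -expr2 mulrA.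
have hv : v * (P ^+ n + Q ^+ n) = (P ^+ n + Q ^+ n) * v.
  rewrite mulrDr mulrDl v_Pn addrC; congr (_ + _).
  case: n {hu} => [|n]; first by rewrite mulr1 mul1r.
  by rewrite v_QSn w_central (exprSr P n) -(mulrA (P ^+ n) P) -(mulrA u v v) vvE -!scalerAr mulrA.
elim/(presented_ind (@aminus_rel_inj k lam e) hA): z => [|d y z hy hz|y z hy hz|[]] //.
- by rewrite mulr1 mul1r.
- by rewrite mulrDr [in RHS]mulrDl -scalerAl -scalerAr hy hz.
- by rewrite mulrA hy -mulrA hz mulrA.
Qed.

Definition even_word (z : A) := exists i j, z = w ^+ i * P ^+ j \/ z = w ^+ i * Q ^+ j.
Definition odd_word (z : A) :=
  exists i j, z = w ^+ i * (P ^+ j * u) \/ z = w ^+ i * (Q ^+ j * v).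

(** The span of these words contains 1 and is stable under left multiplication by
    u and v: a square u^2 or v^2 becomes a multiple of w and moves to the
    front. *)
Lemma aminus_words z : lspan (fun y => even_word y \/ odd_word y) z.
Proof.
set S := fun y => _.
have mulL (c : A) : linear (fun z => c * z) by move=> b y t; rewrite mulrDr scalerAr.
have wS i y : lspan S y -> lspan S (w ^+ i * y).
  apply: (lspan_map (mulL (w ^+ i))) => _ [] [i' [j []]] ->; apply: lspan_gen.
  - by left; exists (i + i')%N, j; left; rewrite mulrA exprD.
  - by left; exists (i + i')%N, j; right; rewrite mulrA exprD.
  - by right; exists (i + i')%N, j; left; rewrite [LHS]mulrA exprD.
  - by right; exists (i + i')%N, j; right; rewrite [LHS]mulrA exprD.
have SP j : lspan S (P ^+ j) by apply: lspan_gen; left; exists 0%N, j; left; rewrite mul1r.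
have SQ j : lspan S (Q ^+ j) by apply: lspan_gen; left; exists 0%N, j; right; rewrite mul1r.
have SPu j : lspan S (P ^+ j * u).
  by apply: lspan_gen; right; exists 0%N, j; left; rewrite mul1r.
have SQv j : lspan S (Q ^+ j * v).
  by apply: lspan_gen; right; exists 0%N, j; right; rewrite mul1r.
have comm_l y i t : y * (w ^+ i * t) = w ^+ i * (y * t).
  by rewrite !mulrA wX_central.
elim/(presented_left_ind (@aminus_rel_inj k lam e) hA): z => [|c y z Sy Sz|[] z Sz].
- exact: (SP 0%N).
- exact: lspanP.
- apply: (lspan_map (mulL u)) Sz => _ [] [i [j []]] ->; rewrite comm_l; apply: (wS).
  + case: j => [|j]; first by rewrite mulr1 -[u]mul1r; exact: (SPu 0%N).
    by rewrite u_PSn -[w]expr1; exact: wS.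
  + by rewrite u_Qn.
  + case: j => [|j]; first by rewrite mul1r -[u * u]mulr1; exact: (wS 1%N _ (SP 0%N)).
    by rewrite mulrA u_PSn -(mulrA w) -(mulrA _ v u) -exprSr -[w]expr1; exact: wS.
  + by rewrite mulrA u_Qn -mulrA -exprSr.
- apply: (lspan_map (mulL v)) Sz => _ [] [i [j []]] ->; rewrite comm_l; apply: (wS).
  + by rewrite v_Pn.
  + case: j => [|j]; first by rewrite mulr1 -[v]mul1r; exact: (SQv 0%N).
    by rewrite v_QSn -[w]expr1; apply/lspanZ/wS.
  + by rewrite mulrA v_Pn -mulrA -exprSr.
  + case: j => [|j].
      by rewrite mul1r vvE -[w]expr1 -[w ^+ 1]mulr1; apply/lspanZ; exact: (wS 1%N _ (SP 0%N)).
    by rewrite mulrA v_QSn -scalerAl -(mulrA w) -(mulrA _ u v) -exprSr -[w]expr1; apply/lspanZ/wS.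
Qed.

End Words.

(** * Reynolds operator and invariants *)

Section Invariants.
Variables (k : numClosedFieldType) (m : nat) (lam : k) (e : nat).
Variables (H : algType k) (hH : hopf_structure H) (g : masuoka_gen -> H).
Hypothesis hg : is_masuoka m hH g.
Variables (A : algType k) (x : aminus_gen -> A).
Hypothesis hA : is_aminus lam e x.
Variable act : module_algebra hH A.
Hypothesis hact : acts_by_pi lam e g act x.
Hypothesis modd : odd m.
Hypothesis m_gt1 : (1 < m)%N.
Local Notation q := (lam ^+ e).
Hypothesis qprim : m.-primitive_root q.
Local Notation u := (x Gen_u).
Local Notation v := (x Gen_v).
Local Notation a := (g Gen_a).
Local Notation sp := (g Gen_sp).
Local Notation sm := (g Gen_sm).
Local Notation c := (masuoka_c g).
Local Notation hc := (horner_alg c).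
Local Notation w := (u ^+ 2).
Local Notation P := (u * v).
Local Notation Q := (v * u).
Local Notation eps := (counit hH).

Let two0 : (2%:R : k) != 0. Proof. by rewrite pnatr_eq0. Qed.
Let q0 : q != 0. Proof. exact: (q_neq0 qprim). Qed.
Let qm : q ^+ m = 1. Proof. exact: prim_expr_order qprim. Qed.
Let m0 : (m%:R : k) != 0. Proof. by rewrite pnatr_eq0; case: m m_gt1. Qed.

Definition powerT : A := P ^+ m + Q ^+ m.
Local Notation T := powerT.
Definition inv_mon (i j : nat) : A := w ^+ i * T ^+ j.

Lemma eps_gens : [/\ eps a = 1, eps sp = 1 & eps sm = 1].
Proof. by case: hg => _ [_ ?] _ [? ?] _. Qed.

Lemma gens_invariant z : act a z = z -> act sp z = z -> act sm z = z ->
  z \in hinvariant act.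
Proof.
move=> az pz mz; apply/hinvariantP; case: eps_gens => ea ep em.
elim/(masuoka_ind (masuoka_pres hg)) => [|d h h' IH IH'|h h' IH IH'|[]].
- by rewrite hact1l rmorph1 scale1r.
- rewrite actDl actZl IH IH' scalerA -scalerDl; congr (_ *: _).
  by rewrite linearD linearZ.
- rewrite hactMl IH' (actZr act) IH scalerA; congr (_ *: _).
  by rewrite rmorphM mulrC.
- by rewrite ea az scale1r.
- by rewrite ep pz scale1r.
- by rewrite em mz scale1r.
Qed.

Lemma w_invariant : w \in hinvariant act.
Proof.
apply: gens_invariant.
- exact: (even_w hg hact).
- exact: (act_sp_w hg hA hact).
- exact: (act_sm_w hg hA hact).
Qed.

Let qVm : q^-1 ^+ m = 1. Proof. by rewrite exprVn qm invr1. Qed.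

Lemma T_invariant : T \in hinvariant act.
Proof.
apply: gens_invariant; rewrite /T (actDr act).
- by rewrite (evenX hg _ (even_P hg hact)) (evenX hg _ (even_Q hg hact)).
- by rewrite (act_sp_Pn hg hact) (act_sp_Qn hg hact) qm qVm !scale1r addrC.
- by rewrite (act_sm_Pn hg hact) (act_sm_Qn hg hact) qm qVm !scale1r addrC.
Qed.

(** The average over the group generated by c, s_+ and a, that is, the integral of
    the Hopf algebra. *)
Definition reynolds : H :=
  (2%:R^-1 *: (1 + sp)) * (hc (m%:R^-1 *: \sum_(j < m) 'X^j)) * (2%:R^-1 *: (1 + a)).

Let eps_half h : eps h = 1 -> eps (2%:R^-1 *: (1 + h)) = 1.
Proof.
by move=> eh; rewrite linearZ /= rmorphD /= rmorph1 eh -[LHS]/(2%:R^-1 * (1 + 1)) mulVf.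
Qed.

Let eps_c : eps c = 1.
Proof. by case: eps_gens => _ ep em; rewrite masuoka_cE rmorphM /= ep em mulr1. Qed.

Let avg (z : k) : (m%:R^-1 *: \sum_(j < m) 'X^j).[z] = m%:R^-1 * \sum_(j < m) z ^+ j.
Proof.
rewrite hornerZ horner_sum; congr (_ * _); apply: eq_bigr => j _.
by rewrite hornerXn.
Qed.

Lemma reynolds_id z : z \in hinvariant act -> act reynolds z = z.
Proof.
move=> /hinvariantP zinv; have cz : act c z = 1 *: z by rewrite zinv eps_c.
case: eps_gens => ea ep em.
rewrite /reynolds !hactMl zinv (eps_half ea) scale1r (act_horner _ cz) avg.
under eq_bigr do rewrite expr1n.
by rewrite sumr_const card_ord mulVf // scale1r zinv (eps_half ep) scale1r.
Qed.

Let act_a2 z : act (2%:R^-1 *: (1 + a)) z = 2%:R^-1 *: (z + act a z).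
Proof. by rewrite actZl actDl hact1l. Qed.

Lemma reynolds_odd z : odd_elt g act z -> act reynolds z = 0.
Proof.
by move=> oz; rewrite /reynolds !hactMl act_a2 oz subrr scaler0 !(act0r act).
Qed.

Let half (z : A) : 2%:R^-1 *: (z + z) = z.
Proof. by rewrite -mulr2n -scaler_nat scalerA mulVf // scale1r. Qed.

(** For an m-th root of unity y the mean of the powers of y is 1 or 0 according to
    whether y is 1. *)
Lemma reynolds_even z (y : k) : even g act z -> act c z = y *: z -> y ^+ m = 1 ->
  act reynolds z = if y == 1 then 2%:R^-1 *: (z + act sp z) else 0.
Proof.
move=> ez cz ym; rewrite /reynolds !hactMl act_a2 ez half (act_horner _ cz) avg.
have [->|y1] := eqVneq y 1.
  under eq_bigr do rewrite expr1n.
  by rewrite sumr_const card_ord mulVf // scale1r actZl actDl hact1l.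
have -> : \sum_(j < m) y ^+ j = 0.
  have /eqP := subrX1 y m; rewrite ym subrr eq_sym mulf_eq0 subr_eq0 (negbTE y1) /=.
  by move/eqP.
by rewrite mulr0 scale0r (act0r act).
Qed.

Definition inv_span (z : A) := lspan (fun y => exists i j, y = inv_mon i j) z.

Let mulL (d : A) : linear (fun z => d * z).
Proof. by move=> b y t; rewrite mulrDr scalerAr. Qed.

Let inv_span_w i z : inv_span z -> inv_span (w ^+ i * z).
Proof.
apply: (lspan_map (mulL (w ^+ i))) => _ [i' [j ->]]; apply: lspan_gen.
by exists (i + i')%N, j; rewrite /inv_mon mulrA exprD.
Qed.

Let inv_span_T z : inv_span z -> inv_span (T * z).
Proof.
apply: (lspan_map (mulL T)) => _ [i' [j ->]]; apply: lspan_gen.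
by exists i', j.+1; rewrite /inv_mon mulrA (PnQn_central hA q0) -mulrA (exprS T).
Qed.

(** Newton's recursion: with p_j = P^(mj) + Q^(mj) and P^m Q^m = w^(2m), one has
    p_(j+2) = T p_(j+1) - w^(2m) p_j. *)
Lemma power_sums_span j : inv_span (P ^+ (m * j) + Q ^+ (m * j)).
Proof.
suff : inv_span (P ^+ (m * j) + Q ^+ (m * j)) /\
       inv_span (P ^+ (m * j.+1) + Q ^+ (m * j.+1)) by case.
elim: j => [|j [IH0 IH1]].
  split; first by rewrite muln0 -mulr2n -scaler_nat; apply/lspanZ/lspan_gen; exists 0%N, 0%N; rewrite /inv_mon mulr1.
  by rewrite muln1; apply: lspan_gen; exists 0%N, 1%N; rewrite /inv_mon mul1r expr1.
split=> //.
have -> : P ^+ (m * j.+2) + Q ^+ (m * j.+2) =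
    -1 *: (w ^+ (2 * m) * (P ^+ (m * j) + Q ^+ (m * j))) +
    T * (P ^+ (m * j.+1) + Q ^+ (m * j.+1)).
  rewrite /T mulrDl [P ^+ m * _]mulrDr [Q ^+ m * _]mulrDr.
  have eP : Q ^+ m * P ^+ (m * j.+1) = w ^+ (2 * m) * P ^+ (m * j).
    by rewrite mulnS exprD mulrA (QP_expn hA q0) qVm scale1r.
  have eQ : P ^+ m * Q ^+ (m * j.+1) = w ^+ (2 * m) * Q ^+ (m * j).
    by rewrite mulnS exprD mulrA (PQ_expn hA q0) qVm scale1r.
  rewrite eP eQ -!exprD -!mulnS scaleN1r mulrDr.
  set X1 := P ^+ (m * j.+2); set X2 := Q ^+ (m * j.+2).
  set X3 := w ^+ (2 * m) * P ^+ (m * j); set X4 := w ^+ (2 * m) * Q ^+ (m * j).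
  by rewrite (addrC X1 X4) (addrACA X4) [RHS]addrA (addrC X4) addNr add0r.
by apply: lspanP; [exact: inv_span_w|exact: inv_span_T].
Qed.

Let even_sm z : even g act z -> even g act (act sm z).
Proof. by move=> ez; rewrite /even (act_a_sm hg) ez. Qed.

Let sp_w i z : even g act z -> act sp (w ^+ i * z) = w ^+ i * act sp z.
Proof.
move=> ez; rewrite (act_sp_even hg _ ez) (act_spX hg) ?(act_sp_w hg hA hact) //.
exact: (even_w hg hact).
Qed.

Let sm_w i z : even g act z -> act sm (w ^+ i * z) = w ^+ i * act sm z.
Proof.
move=> ez; rewrite (act_sm_even hg _ ez) (act_smX hg) ?(act_sm_w hg hA hact) //.
exact: (even_w hg hact).
Qed.

Let c_w i z : even g act z -> act c (w ^+ i * z) = w ^+ i * act c z.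
Proof. by move=> ez; rewrite !(act_cE g act) sm_w // sp_w //; exact: even_sm. Qed.

Let root1 j : q ^+ j.*2 = 1 -> exists j', j = (m * j')%N.
Proof.
move=> qj; have : (m %| j.*2)%N by rewrite (prim_order_dvd qprim) qj.
rewrite -muln2 Gauss_dvdl; last by rewrite coprimen2.
by case/dvdnP => j' ->; exists j'; rewrite mulnC.
Qed.

(** An invariant equals its image under the Reynolds operator, so it suffices to
    apply that operator to the words.  Odd words go to 0, and so do w^i P^j and
    w^i Q^j unless q^(2j) = 1, that is, unless m divides j. *)
Lemma invariants_span z : z \in hinvariant act -> inv_span z.
Proof.
move=> /reynolds_id <-; have eP j := evenX hg j (even_P hg hact).
have eQ j := evenX hg j (even_Q hg hact); have ew i := evenX hg i (even_w hg hact).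
have rL : linear (act reynolds) by move=> b y t; exact: hact_linear.
have sums i j : inv_span (2%:R^-1 *: (w ^+ i * (P ^+ (m * j) + Q ^+ (m * j)))).
  by apply/lspanZ/inv_span_w/power_sums_span.
have qmj j : q ^+ (m * j) = 1 by rewrite exprM qm expr1n.
have qVmj j : q^-1 ^+ (m * j) = 1 by rewrite exprM qVm expr1n.
apply: (lspan_map rL) (aminus_words hA q0 z) => y [[i [j]]|[i [j]]] [] ->.
- rewrite (@reynolds_even _ (q^-1 ^+ j.*2)); last first.
  + by rewrite exprAC qVm expr1n.
  + by rewrite (c_w _ (eP j)) (act_c_Pn hg hact) scalerAr.
  + exact: (evenM hg (ew i) (eP j)).
  case: eqP => [qj|_]; last exact: lspan0.
  have [|j' ->] := @root1 j; first by apply/eqP; rewrite -invr_eq1 -exprVn qj.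
  rewrite (sp_w _ (eP _)) (act_sp_Pn hg hact) qmj scale1r -mulrDr; exact: sums.
- rewrite (@reynolds_even _ (q ^+ j.*2)); last first.
  + by rewrite exprAC qm expr1n.
  + by rewrite (c_w _ (eQ j)) (act_c_Qn hg hact) scalerAr.
  + exact: (evenM hg (ew i) (eQ j)).
  case: eqP => [qj|_]; last exact: lspan0.
  have [j' ->] := root1 qj.
  by rewrite (sp_w _ (eQ _)) (act_sp_Qn hg hact) qVmj scale1r -mulrDr addrC; exact: sums.
- rewrite reynolds_odd; first exact: lspan0.
  exact: (even_oddM hg (ew i) (even_oddM hg (eP j) (odd_u hact))).
- rewrite reynolds_odd; first exact: lspan0.
  exact: (even_oddM hg (ew i) (even_oddM hg (eQ j) (odd_v hact))).
Qed.

(** It suffices to find a representation in which w and T act as the scalars b and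
    d.  With u^2 = b and P = diag(y, b^2/(q y)) the matrix T is scalar, equal to
    y^m + b^(2m)/y^m, so y^m must be a root z of z^2 - d z + b^(2m). *)
Lemma inv_mon_eval (b d : k) : b != 0 -> exists f : {linear A -> k^o},
  forall i j, f (inv_mon i j) = b ^+ i * d ^+ j.
Proof.
move=> b0; pose bm := b ^+ (2 * m).
pose r := sqrtC (d ^+ 2 - 4%:R * bm); pose z := (d + r) / 2%:R.
have hr : r ^+ 2 = d ^+ 2 - 4%:R * bm by exact: sqrtCK.
have zE : z * (d - z) = bm.
  apply: (mulfI (_ : (4%:R : k) != 0)); first by rewrite pnatr_eq0.
  have -> : 4%:R * bm = d ^+ 2 - r ^+ 2 by rewrite hr; ring.
  by rewrite /z; field.
have z0 : z != 0.
  by apply: contraNneq (expf_neq0 (2 * m) b0) => z0; rewrite -/bm -zE z0 mul0r.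
have mgt0 : (0 < m)%N by exact: ltnW.
pose y := m.-root z; have ym : y ^+ m = z by rewrite rootCK.
have y0 : y != 0 by apply: contraNneq z0 => y0; rewrite -ym y0 expr0n; case: m mgt0.
have [|f [fu fv]] := aminus_rep hA (B := 'M[k]_2)
    (U := mx2 0 b 1 0) (V := mx2 0 (q^-1 * b ^+ 2 / y) (y / b) 0).
  rewrite !expr2 !mx2M mx2Z !(mulr0, mul0r, addr0, add0r).
  by congr mx2; field; rewrite ?q0 ?b0 ?y0.
have fw : f w = mx2 b 0 0 b.
  by rewrite rmorphXn /= fu expr2 mx2M !(mulr0, mul0r, addr0, add0r, mulr1, mul1r).
have fP : f P = mx2 y 0 0 (q^-1 * b ^+ 2 / y).
  rewrite rmorphM /= fu fv mx2M !(mulr0, mul0r, addr0, add0r, mul1r).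
  by congr mx2; field.
have fQ : f Q = mx2 (q^-1 * b ^+ 2 / y) 0 0 y.
  rewrite rmorphM /= fu fv mx2M !(mulr0, mul0r, addr0, add0r, mulr1).
  by congr mx2; field.
have ydm : (q^-1 * b ^+ 2 / y) ^+ m = d - z.
  apply: (mulfI z0); rewrite zE !exprMn qVm mul1r exprVn ym -exprD addnn -mul2n -/bm.
  by rewrite mulrCA mulfV // mulr1.
have fT : f T = mx2 d 0 0 d.
  rewrite /T rmorphD !rmorphXn /= fP fQ !mx2_diagX mx2D ym ydm !addr0.
  by congr mx2; ring.
have L : linear (fun t => entry00 (f t) : k^o).
  by move=> s t t'; rewrite linearP entry00_linear.
exists (mk_linear L) => i j /=.
rewrite /inv_mon rmorphM (rmorphXn f i) (rmorphXn f j) /= fw fT !mx2_diagX mx2M /entry00 !mxE /=.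
by rewrite mulr0 addr0.
Qed.

End Invariants.

(** * The ring of invariants is a quantum plane *)

Section InvariantRing.
Variables (k : numClosedFieldType) (m : nat) (lam : k) (e : nat).
Variables (H : algType k) (hH : hopf_structure H) (g : masuoka_gen -> H).
Hypothesis hg : is_masuoka m hH g.
Variables (A : algType k) (x : aminus_gen -> A).
Hypothesis hA : is_aminus lam e x.
Variable act : module_algebra hH A.
Hypothesis hact : acts_by_pi lam e g act x.
Hypothesis modd : odd m.
Hypothesis m_gt1 : (1 < m)%N.
Local Notation q := (lam ^+ e).
Hypothesis qprim : m.-primitive_root q.
Local Notation u := (x Gen_u).
Local Notation v := (x Gen_v).
Local Notation a := (g Gen_a).
Local Notation sp := (g Gen_sp).
Local Notation sm := (g Gen_sm).
Local Notation w := (u ^+ 2).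
Local Notation T := (powerT m x).
Local Notation mon := (inv_mon m x).
Local Notation V := (invariants act).
Local Notation gr := (aminus_grading x).
Local Notation G := (grZ gr).

Let q0 : q != 0. Proof. exact: (q_neq0 qprim). Qed.

Lemma aminus_qp : exists (X Y : A), inhabited (quantum_plane X Y (-1) 1 1 gr).
Proof.
exists (aX x (sqrtC q)), (aY x (sqrtC q)).
by apply: (aminus_quantum_plane hA); rewrite ?sqrtC_eq0 ?sqrtCK.
Qed.

Lemma aminus_grading_ops : exists pr, projections G pr /\
  [/\ (forall t y z, G t y -> G t z -> G t (y + z)),
      (forall t c y, G t y -> G t (c *: y)) &
      (forall s t y z, G s y -> G t z -> G (s + t) (y * z))].
Proof.
have [X [Y [qp]]] := aminus_qp; have [pr hpr] := grZ_projections qp.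
exists pr; split=> //; split.
- by move=> t y z; exact: (grZD qp).
- by move=> t c y; exact: (grZZ qp).
- by move=> s t y z; exact: (grZM qp).
Qed.

Lemma gr_u : G 1 u.
Proof.
apply/in_spanP/lspan_gen; rewrite -[X in X \in _]mulr1; apply: allpairs_f.
  exact: mem_head.
by rewrite inE.
Qed.

Lemma gr_v : G 1 v.
Proof.
apply/in_spanP/lspan_gen; rewrite -[X in X \in _]mulr1; apply: allpairs_f.
  by rewrite !inE eqxx orbT.
by rewrite inE.
Qed.

Lemma gr_exp n y i : G n%:Z y -> G (n * i)%N%:Z (y ^+ i).
Proof.
have [pr [hpr [GD GZ GM]]] := aminus_grading_ops.
move=> gy; elim: i => [|i IH].
  by rewrite muln0 expr0; apply/in_spanP/lspan_gen/mem_head.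
by rewrite exprS; have := GM _ _ _ _ gy IH; congr (G _ _); lia.
Qed.

Lemma gr_mon i j : G (2 * i + 2 * m * j)%N%:Z (mon i j).
Proof.
have [pr [hpr [GD GZ GM]]] := aminus_grading_ops.
have gw : G 2%:Z w by exact: (gr_exp (n := 1) 2 gr_u).
have gP : G 2%:Z (u * v) by exact: (GM _ _ _ _ gr_u gr_v).
have gQ : G 2%:Z (v * u) by exact: (GM _ _ _ _ gr_v gr_u).
have gT : G (2 * m)%N%:Z T by apply: GD; exact: gr_exp.
have := GM _ _ _ _ (gr_exp i gw) (gr_exp j gT); congr (G _ _); lia.
Qed.

Definition inv_w : V := Invariant (w_invariant hg hA hact).
Definition inv_T : V := Invariant (T_invariant hg hact qprim).

Let val_linear : linear (fun z : V => val z). Proof. by []. Qed.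
Let val_monoid : monoid_morphism (fun z : V => val z). Proof. by []. Qed.
Definition inv_val : {lrmorphism V -> A} := mk_lrmorphism val_linear val_monoid.

(** These three statements spell out the linearity of [inv_val] with the module
    structures that the other lemmas use. *)
Lemma inv_valP c y z : inv_val (c *: y + z) = c *: inv_val y + inv_val z.
Proof. by []. Qed.

Lemma inv_valZ c y : inv_val (c *: y) = c *: inv_val y.
Proof. by []. Qed.

Lemma inv_val_sum (I : Type) (s : seq I) (F : I -> V) :
  inv_val (\sum_(i <- s) F i) = \sum_(i <- s) inv_val (F i).
Proof. exact: (raddf_sum inv_val). Qed.

Lemma inv_val_mon i j : inv_val (inv_w ^+ i * inv_T ^+ j) = mon i j.
Proof. by rewrite rmorphM !rmorphXn. Qed.

Lemma inv_ring_span (z : V) :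
  lspan (fun y => exists i j, y = inv_w ^+ i * inv_T ^+ j) z.
Proof.
suff lift y : inv_span m x y -> exists z' : V, inv_val z' = y /\
    lspan (fun y => exists i j, y = inv_w ^+ i * inv_T ^+ j) z'.
  have [z' [/val_inj <-]] := lift _ (invariants_span hg hA hact modd m_gt1 qprim (valP z)).
  by [].
elim=> [|c y1 t [i [j ->]] _ [z1 [z1E z1S]]].
  by exists 0; split; [exact: linear0|exact: lspan0].
exists (c *: (inv_w ^+ i * inv_T ^+ j) + z1); split.
  by rewrite inv_valP inv_val_mon z1E.
by apply: lspanS => //; exists i, j.
Qed.

Lemma inv_ring_eval (b d : k) : b != 0 -> d != 0 -> exists f : {linear V -> k^o},
  forall i j, f (inv_w ^+ i * inv_T ^+ j) = b ^+ i * d ^+ j.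
Proof.
move=> b0 _; have [f fE] := inv_mon_eval hA m_gt1 qprim d b0.
have L : linear (fun z : V => f (inv_val z) : k^o) by move=> c y z; rewrite !linearP.
by exists (mk_linear L) => i j; rewrite -fE -inv_val_mon.
Qed.

Lemma inv_ring_comm : inv_T * inv_w = 1 *: (inv_w * inv_T).
Proof. by rewrite scale1r; apply: val_inj; exact: (PnQn_central hA q0 m w). Qed.

(** The monomials in w and T are a basis by [coordinates].  The grading induced
    from A is the one by degree 2 in w and 2m in T: if an invariant is
    homogeneous of degree n in A, the sum of its monomials of other degrees is
    both homogeneous of degree n and without component of degree n, hence 0. *)
Lemma invariants_quantum_plane : inhabited
  (quantum_plane inv_w inv_T 1 2 (2 * m) (invariants_grading (act := act) gr)).
Proof.
have [coef [coefE span]] := coordinates inv_ring_span inv_ring_eval.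
pose gr' (n : nat) : set V :=
  fun b => forall i j, (2 * i + 2 * m * j)%N != n -> coef i j b = 0.
have gr'E n b : gr' n b <-> forall i j, (2 * i + 2 * m * j)%N != n -> coef i j b = 0 by [].
have m2 : (0 < 2 * m)%N by rewrite muln_gt0 /=; exact: ltnW.
pose qp := QuantumPlane (oner_neq0 k) (ltn0Sn 1) m2 inv_ring_comm coefE span gr'E.
suff -> : invariants_grading (act := act) gr = gr' by constructor.
have [pr [hpr [GD GZ GM]]] := aminus_grading_ops.
have pr0 n : pr n%:Z 0 = 0 by have := prB hpr n%:Z 0 0; rewrite !subrr.
have sub n z : gr' n z -> G n%:Z (inv_val z).
  move=> gz; apply: (@grZ_ind _ _ _ _ _ _ _ _ qp n%:Z (fun z => G n%:Z (inv_val z))) gz.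
  - by rewrite linear0; have := pr_in hpr n%:Z 0; rewrite pr0.
  - by move=> y t gy gt; rewrite linearD; exact: GD.
  - move=> c i j [<-]; rewrite inv_valZ inv_val_mon; apply: GZ; exact: gr_mon.
apply: funext => n; apply: funext => z; apply: propext; split; last exact: sub.
move=> gz; have [zn znE] := coef_filter qp (fun i j => (2 * i + 2 * m * j)%N == n) z.
have gzn : gr' n zn by move=> i j /negbTE d; rewrite [LHS]znE d.
suff -> : z = zn by [].
apply/eqP; rewrite -subr_eq0; apply/eqP; set d := z - zn.
have dE i j : (2 * i + 2 * m * j)%N = n -> coef i j d = 0.
  by move=> ij; have := znE i j; rewrite ij eqxx /d linearB /= => ->; rewrite subrr.
apply: val_inj; rewrite -[LHS]/(inv_val d) -[RHS]/(inv_val 0) linear0.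
have <- : pr n%:Z (inv_val d) = inv_val d.
  apply: (pr_id hpr); rewrite /d linearB -scaleN1r; apply: GD; first exact: gz.
  by apply: GZ; exact: sub.
have prD y t : pr n%:Z (y + t) = pr n%:Z y + pr n%:Z t.
  have prN : pr n%:Z (- t) = - pr n%:Z t by rewrite -sub0r (prB hpr) pr0 sub0r.
  by rewrite -{1}[t]opprK (prB hpr) prN opprK.
have [N ->] := span d.
rewrite inv_val_sum (big_morph (pr n%:Z) prD (pr0 n)) big1 // => i _.
rewrite inv_val_sum (big_morph (pr n%:Z) prD (pr0 n)) big1 // => j _.
rewrite inv_valZ inv_val_mon.
have [ij|ij] := eqVneq (2 * i + 2 * m * j)%N n; first by rewrite dE // scale0r.
apply: (pr_ne hpr (i := (2 * i + 2 * m * j)%N%:Z)); first by apply: GZ; exact: gr_mon.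
by rewrite eq_sym.
Qed.

Lemma w_all_central (z : A) : GRing.comm z w.
Proof. by rewrite /GRing.comm (w_central hA). Qed.

Lemma T_all_central (z : A) : GRing.comm z T.
Proof. by rewrite /GRing.comm (PnQn_central hA q0). Qed.

Let h (i : 'I_2) : A := if i == 0 then w else T.
Let phi (p : mpoly 2 k) : A := mmap (in_alg A) h p.

Let mmap1E mu : mmap1 h mu = mon (mu (0 : 'I_2)) (mu (1 : 'I_2)).
Proof. by rewrite /mmap1 !big_ord_recl big_ord0 mulr1; congr (_ * _ ^+ (mu _)); apply: val_inj. Qed.

Let phi_linear : linear phi.
Proof. by move=> c p p'; rewrite /phi mmapD mmapZ mulr_algl. Qed.

Let phi_monoid : monoid_morphism phi.
Proof.
have hc i z : GRing.comm z (h i).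
  by rewrite /h; case: ifP => _; [exact: w_all_central|exact: T_all_central].
have [|hM h1] := @commr_mmap_is_multiplicative 2 k A h (in_alg A) hc.
  by move=> p mu mu'; rewrite /GRing.comm mulr_algl mulr_algr.
by split.
Qed.

(** The evaluation at w and T is a ring morphism as these are central; its image is
    the span of their monomials, and their independence makes it injective. *)
Lemma invariants_polynomial : polynomial_ring_on (hinvariant act) w T.
Proof.
pose phiL := mk_lrmorphism phi_linear phi_monoid.
have X0 : phi (mpolyX k (mnm1 (0 : 'I_2))) = w by rewrite /phi mmapX mmap1U.
have X1 : phi (mpolyX k (mnm1 (1 : 'I_2))) = T by rewrite /phi mmapX mmap1U.
pose lift (p : mpoly 2 k) : V :=
  \sum_(mu <- msupp p) mcoeff mu p *: (inv_w ^+ (mu (0 : 'I_2)) * inv_T ^+ (mu (1 : 'I_2))).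
have liftE p : inv_val (lift p) = phi p.
  rewrite inv_val_sum; apply: eq_bigr => mu _.
  by rewrite inv_valZ inv_val_mon mmap1E mulr_algl.
have [coef [coefE _]] := coordinates inv_ring_span inv_ring_eval.
exists phiL; split=> //.
  move=> p p' pp'; apply/eqP; rewrite -subr_eq0; apply/eqP.
  have : phi (p - p') = 0.
    by rewrite (raddfB phiL p p' : phi (p - p') = phi p - phi p') (pp' : phi p = phi p') subrr.
  move: (p - p') => r; rewrite -liftE -[0]/(inv_val 0) => /val_inj r0.
  apply/mpolyP => mu; rewrite mcoeff0.
  have [rmu|/memN_msupp_eq0 //] := boolP (mu \in msupp r).
  have := congr1 (coef (mu (0 : 'I_2)) (mu (1 : 'I_2))) r0.
  rewrite linear0 linear_sum /= (bigD1_seq mu) ?msupp_uniq //= big1 => [|nu nm].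
    by rewrite linearZ /= coefE !eqxx addr0 => <-; rewrite [RHS]mulr1.
  rewrite linearZ /= coefE; case: eqP => [e0|_]; last exact: mulr0.
  case: eqP => [e1|_]; last exact: mulr0.
  case/eqP: nm; apply/mnmP => -[[|[|//]] li].
    by rewrite -[Ordinal li](_ : 0 = _) ?e0 //; apply: val_inj.
  by rewrite -[Ordinal li](_ : 1 = _) ?e1 //; apply: val_inj.
move=> z; split=> [/(invariants_span hg hA hact modd m_gt1 qprim)|[p ->]].
  elim=> [|c y t [i [j ->]] _ [p ->]]; first by exists 0; rewrite linear0.
  exists (c *: (mpolyX k (mnm1 (0 : 'I_2)) ^+ i * mpolyX k (mnm1 (1 : 'I_2)) ^+ j) + p).
  by rewrite linearP rmorphM !rmorphXn /= X0 X1.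
by rewrite -[phiL p]liftE; exact: (valP (lift p)).
Qed.

(** By induction on the length of words; s_+ and s_- are treated together, because
    s_+ acts on a product through both of them. *)
Lemma act_preserves_grading : preserves_grading act gr.
Proof.
have [pr [hpr [GD GZ GM]]] := aminus_grading_ops.
have fromwords (f : A -> A) n : linear f ->
    (forall y, y \in words [:: u; v] n -> gr n (f y)) -> forall z, gr n z -> gr n (f z).
  move=> fL fw z /in_spanP zs; apply/in_spanP; apply: (lspan_map fL) zs => y /fw.
  by move/in_spanP.
have actL h' : linear (act h') by exact: hact_linear.
have uvE y : y \in [:: u; v] -> y = u \/ y = v.
  by rewrite !inE => /orP[] /eqP ->; [left|right].
have gr1 : gr 0 1 by apply/in_spanP/lspan_gen/mem_head.
have act1 h' : gr 0 (act h' 1) by rewrite hact1; apply: (GZ 0).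
have pa n z : gr n z -> gr n (act a z).
  move: z; elim: n => [|n IH]; apply: (fromwords _ _ (actL a)) => y.
    by rewrite inE => /eqP ->.
  move=> /allpairsPdep[y1 [y2 [/uvE y12 yn ->]]]; rewrite (act_aM hg act).
  apply: (GM 1 n%:Z); last by apply: IH; apply/in_spanP/lspan_gen.
  by case: y12 => ->; rewrite ?(act_a_u hact) ?(act_a_v hact) -scaleN1r; apply: (GZ 1); [exact: gr_u|exact: gr_v].
have gsp y : y = u \/ y = v -> gr 1 (act sp y).
  by case=> ->; rewrite ?(act_sp_u hact) ?(act_sp_v hact); [exact: gr_v|exact: gr_u].
have gsm y : y = u \/ y = v -> gr 1 (act sm y).
  by case=> ->; rewrite ?(act_sm_u hact) ?(act_sm_v hact); apply: (GZ 1); [exact: gr_v|exact: gr_u].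
have ps n : (forall z, gr n z -> gr n (act sp z)) /\ (forall z, gr n z -> gr n (act sm z)).
  elim: n => [|n [IHp IHm]].
    by split; [apply: (fromwords _ _ (actL sp))|apply: (fromwords _ _ (actL sm))] => y; rewrite inE => /eqP ->.
  have av t : gr n t -> gr n (2%:R^-1 *: (t + act a t)) /\ gr n (2%:R^-1 *: (t - act a t)).
    move=> gt; split; apply: (GZ n%:Z); apply: (GD n%:Z) => //; first exact: pa.
    by rewrite -scaleN1r; apply: (GZ n%:Z); exact: pa.
  split; [apply: (fromwords _ _ (actL sp))|apply: (fromwords _ _ (actL sm))];
  move=> y /allpairsPdep[y1 [y2 [/uvE y12 yn ->]]];
  have g2 : gr n y2 by [apply/in_spanP/lspan_gen].
    rewrite (act_spE hg act) -(act_a_sp hg); have [h1 h2] := av _ (IHp _ g2).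
    by apply: (GD n.+1%:Z); apply: (GM 1 n%:Z) => //; [exact: gsp|exact: gsm].
  rewrite (act_smE hg act) -(act_a_sm hg); have [h1 h2] := av _ (IHm _ g2).
  by apply: (GD n.+1%:Z); apply: (GM 1 n%:Z) => //; [exact: gsm|exact: gsp].
move=> h' n; elim/(masuoka_ind (masuoka_pres hg)): h' => [z|d h1 h2 IH1 IH2 z gz|h1 h2 IH1 IH2 z gz|[] z gz].
- by rewrite hact1l.
- rewrite actDl actZl; apply: (GD n%:Z); last exact: IH2.
  by apply: (GZ n%:Z); exact: IH1.
- by rewrite hactMl; apply/IH1/IH2.
- exact: pa.
- by case: (ps n) => + _; apply.
- by case: (ps n) => _; apply.
Qed.

End InvariantRing.

(** * The root of unity and the theorem *)

(** De Moivre's formula. *)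
Lemma cis_exp (R : realType) (t : R) n :
  Complex (cos t) (sin t) ^+ n = Complex (cos (n%:R * t)) (sin (n%:R * t)) :> R[i].
Proof.
elim: n => [|n IH]; first by rewrite mul0r cos0 sin0.
rewrite exprS IH mulrSr mulrDl mul1r cosD sinD.
apply/eqP; rewrite eq_complex /=; apply/andP; split; apply/eqP; ring.
Qed.

(** For 0 < n < m the angle n pi/m lies in (0, pi), so its sine is not 0 and
    cos (2 n pi/m) = 1 - 2 sin^2 (n pi/m) is not 1. *)
Lemma exp_2pi_i_div_prim (R : realType) m :
  (0 < m)%N -> m.-primitive_root (exp_2pi_i_div R m).
Proof.
move=> m0; have m0R : (m%:R : R) != 0 by rewrite pnatr_eq0 -lt0n.
apply/andP; split=> //; apply/forallP => -[j jm]; rewrite unity_rootE cis_exp /=.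
rewrite eq_complex /= eqn_leq jm /=.
have [->|nm] := eqVneq j.+1 m.
  have -> : m%:R * (2%:R * pi / m%:R) = pi *+ 2 :> R by rewrite mulrC divfK // mulr_natl.
  by rewrite cos2pi sin2pi !eqxx leqnn.
have lt_jm : (j.+1 < m)%N by rewrite ltn_neqAle nm.
rewrite leqNgt lt_jm /=.
have -> : j.+1%:R * (2%:R * pi / m%:R) = (j.+1%:R * pi / m%:R) *+ 2 :> R by rewrite -[RHS]mulr_natl; field.
have s0 : 0 < sin (j.+1%:R * pi / m%:R : R).
  apply: sin_gt0_pi; rewrite divr_gt0 ?mulr_gt0 ?pi_gt0 ?ltr0n //=.
  by rewrite ltr_pdivrMr ?ltr0n // mulrC ltr_pM2l ?pi_gt0 // ltr_nat.
rewrite cos_mulr2n -[cos _ ^+ 2](addrK (sin (j.+1%:R * pi / m%:R : R) ^+ 2)) cos2Dsin2.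
have -> : (1 - sin (j.+1%:R * pi / m%:R : R) ^+ 2) *+ 2 - 1 = 1 - sin (j.+1%:R * pi / m%:R : R) ^+ 2 *+ 2 by ring.
apply/eqP; apply/negP => /andP[+ _]; rewrite subr_eq addrC -subr_eq subrr eq_sym.
by rewrite mulrn_eq0 /= expf_eq0 /= gt_eqF.
Qed.

Theorem theorem5p6 (R : realType) (m i : nat)
  (hm : (2 <= m)%N) (hodd : odd m)
  (hi : (1 <= i <= (m - 1) %/ 2)%N) (him : coprime i m)
  (H : algType R[i]) (hH : hopf_structure H) (g : masuoka_gen -> H)
  (hg : is_masuoka m hH g)
  (A : algType R[i]) (x : aminus_gen -> A)
  (hA : is_aminus (exp_2pi_i_div R m) i x)
  (act : module_algebra hH A)
  (hact : acts_by_pi (exp_2pi_i_div R m) i g act x) :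
  let u := x Gen_u in
  let v := x Gen_v in
  polynomial_ring_on (hinvariant act)
    (u ^+ 2) ((u * v) ^+ m + (v * u) ^+ m) /\
  reflection_hopf_algebra R act (aminus_grading x).
Proof.
move=> u v; have m0 : (0 < m)%N by exact: ltnW.
have qprim : m.-primitive_root (exp_2pi_i_div R m ^+ i).
  by rewrite prim_root_exp_coprime // exp_2pi_i_div_prim.
split; first exact: (invariants_polynomial hg hA hact hodd hm qprim).
have [X [Y [qpA]]] := aminus_qp hA qprim.
have [qpI] := invariants_quantum_plane hg hA hact hodd hm qprim.
split.
- exact: (masuoka_semisimple m0 (masuoka_pres hg)).
- exact: (act_inner_faithful hg hA hact hodd hm qprim).
- exact: (act_preserves_grading hg hA hact qprim).
- exact: (qp_AS_regular R qpA).
- exact: (qp_AS_regular R qpI).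
Qed.
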